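(* Let $d\in\{1,2,3\}$ and let $D\subset\mathbb{R}^d$ be a bounded, convex, polyhedral domain. Let $\kappa:\Xi\to C^1(\bar D)$ be strongly measurable and suppose there are $\kappa_{\min},\kappa_{\max},\kappa_{\max,1}\in(0,\infty)$ with $\kappa_{\min}\le\kappa(\xi)(x)\le\kappa_{\max}$ and $\|\kappa(\xi)\|_{C^1(\bar D)}\le\kappa_{\max,1}$ for all $(\xi,x)\in\Xi\times\bar D$. For each $h\in(0,1)$ let $Y_h$ be a finite dimensional subspace of $H_0^1(D)$, and suppose there is $C_Y>0$ independent of $h$ with $\inf_{v_h\in Y_h}|v-v_h|_{H^1(D)}\le C_Y h\|v\|_{H^2(D)}$ for all $v\in H_0^1(D)\cap H^2(D)$ and $h\in(0,1)$. For each $h\in(0,1)$ let $n_h\in\mathbb{N}$ and $\phi_h^1,\dots,\phi_h^{n_h}\in L^\infty(D)$ satisfy $\phi_h^j\ge0$ a.e. in $D$, $\|\phi_h^j\|_{L^\infty(D)}=1$ for $j=1,\dots,n_h$, and $\sum_{j=1}^{n_h}\phi_h^j=1$ a.e. in $D$. Suppose there is $C_U>0$ independent of $h$ such that for all $h\in(0,1)$ and $u\in H^1(D)$, $$\|u-\mathcal{I}_hu\|_{L^2(D)}\le C_Uh|u|_{H^1(D)}\quad\text{and}\quad\|u-\mathcal{I}_hu\|_{H^1(D)^*}\le C_Uh^2\|u\|_{H^1(D)}.$$ Let $u^*$ be the solution of the risk-neutral problem and $u_{h,N}^*$ the solution of the discretized sample average approximation (SAA) problem (both defined in the context). Put $\mathcal{C}^*=\frac{C_D^2}{\kappa_{\min}}\|u^*\|_{L^2(D)}+\|y_d\|_{L^2(D)}$.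 Let $\varepsilon>0$ and $\delta,h\in(0,1)$. If $N\in\mathbb{N}$ satisfies $N\ge 2\ln(2/\delta)/\varepsilon^2$, then with probability at least $1-\delta$, $$\begin{aligned}\|u_{h,N}^*-u^*\|_{L^2(D)}<{}&\frac{h}{\alpha}\Big(8C_U^{1/2}\alpha+17C_U\alpha+\frac{16C_UC_D^4}{\kappa_{\min}^2}\Big)\|u^*\|_{H^1(D)}+\frac{32}{\alpha}\,\varepsilon\,\frac{C_D^2\,\mathcal{C}^*}{\kappa_{\min}}\\&+\frac{4}{\alpha}\,h\,\frac{C_U^{1/2}(C_D+1)C_D\,\mathcal{C}^*}{\kappa_{\min}}+\frac{32}{\alpha}\,h^2\,C_Y^2C_{H^2}^2\,\frac{\kappa_{\max}^{7/2}}{\kappa_{\min}^{17/2}}\,\kappa_{\max,1}^4\,\mathcal{C}^*.\end{aligned}$$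
   Context: Setting: $\Xi$ is a complete separable metric space with its Borel sigma-field; $\xi$ is a $\Xi$-valued random element; $\xi^1,\xi^2,\dots$ are i.i.d. $\Xi$-valued random elements with the distribution of $\xi$, defined on a complete probability space $(\Omega,\mathcal{F},P)$. $y_d\in L^2(D)$, $\alpha>0$, $\gamma\ge0$, $\mathfrak{l},\mathfrak{u}\in\mathbb{R}$ with $\mathfrak{l}\le0\le\mathfrak{u}$, and $U_{\rm ad}=\{u\in L^2(D):\mathfrak{l}\le u\le\mathfrak{u}\text{ a.e. in }D\}$. $|y|_{H^1(D)}=\|\nabla y\|_{L^2(D)^d}$ and $\|y\|_{H^1(D)}^2=\|y\|_{L^2(D)}^2+|y|_{H^1(D)}^2$. $C_D=\sup_{v\in H_0^1(D)\setminus\{0\}}\|v\|_{L^2(D)}/|v|_{H^1(D)}<\infty$ is Friedrichs' constant. $L^2(D)$ is identified with its dual, so $L^2(D)\hookrightarrow H^1(D)^*$ via the $L^2(D)$ inner product. For $(u,\xi)\in L^2(D)\times\Xi$, $S(u,\xi)\in H_0^1(D)$ solves $\int_D\kappa(\xi)\nabla S(u,\xi)\cdot\nabla v\,dx=\int_Duv\,dx$ for all $v\in H_0^1(D)$, and $S_h(u,\xi)\in Y_h$ solves $\int_D\kappa(\xi)\nabla S_h(u,\xi)\cdot\nabla v_h\,dx=\int_Duv_h\,dx$ for all $v_h\in Y_h$. $C_{H^2}>0$ is a constant with $S(u,\xi)\in H^2(D)$ and $\|S(u,\xi)\|_{H^2(D)}\le C_{H^2}(\kappa_{\max}/\kappa_{\min}^4)\kappa_{\max,1}^2\|u\|_{L^2(D)}$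 for all $(u,\xi)\in L^2(D)\times\Xi$ (such a constant exists under the stated hypotheses on $D$ and $\kappa$). $U_h$ is the linear span of $\{\phi_h^1,\dots,\phi_h^{n_h}\}$ and $U_{{\rm ad},h}=U_{\rm ad}\cap U_h$. The quasi-interpolation operator $\mathcal{I}_h:L^1(D)\to U_h$ is $\mathcal{I}_hu=\sum_{j=1}^{n_h}\pi_h^j[u]\phi_h^j$ with $\pi_h^j[u]=\int_D\phi_h^ju\,dx\big/\int_D\phi_h^j\,dx$. Risk-neutral problem: $u^*$ is the unique minimizer over $u\in U_{\rm ad}$ of $\frac12\mathbb{E}[\|S(u,\xi)-y_d\|_{L^2(D)}^2]+\frac\alpha2\|u\|_{L^2(D)}^2+\gamma\|u\|_{L^1(D)}$ (it belongs to $H^1(D)$). Discretized SAA problem: $u_{h,N}^*$ is the unique (random, measurable) minimizer over $u_h\in U_{{\rm ad},h}$ of $\frac1{2N}\sum_{i=1}^N\|S_h(u_h,\xi^i)-y_d\|_{L^2(D)}^2+\frac\alpha2\|u_h\|_{L^2(D)}^2+\gamma\|u_h\|_{L^1(D)}$.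
   Formalization: The formal theorem also assumes that y_d is not zero a.e. in D: if y_d = 0, then u* = u*_{h,N} = 0 and C* = 0, so both sides of the strict inequality vanish and the claim as stated fails. *)

(* Defs.v *)
From HB Require Import structures.
From mathcomp Require Import all_boot all_order all_algebra.
From mathcomp Require Import all_classical all_reals all_analysis.
Set Implicit Arguments.
Unset Strict Implicit.
Unset Printing Implicit Defensive.
Import Order.TTheory GRing.Theory Num.Theory.
Import numFieldNormedType.Exports.
Local Open Scope classical_set_scope.
Local Open Scope ring_scope.

(* R^n is 'rV[R]_n, with the product sigma-algebra, generated by the
   coordinate maps; it coincides with the Borel sigma-algebra. *)
Section rV_measurable.
Context (R : realType) (n : nat).

Definition rV_coord (i : 'I_n) (v : 'rV[R]_n) : R := v 0 i.

Let rV_set0 : g_sigma_preimage rV_coord set0.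
Proof. exact: sigma_algebra0. Qed.

Let rV_setC A : g_sigma_preimage rV_coord A -> g_sigma_preimage rV_coord (~` A).
Proof. exact: sigma_algebraC. Qed.

Let rV_bigcup (F : _^nat) : (forall i, g_sigma_preimage rV_coord (F i)) ->
  g_sigma_preimage rV_coord (\bigcup_i (F i)).
Proof. exact: sigma_algebra_bigcup. Qed.

Definition rV_display : measure_display. Proof. exact. Qed.

HB.instance Definition _ := @isMeasurable.Build rV_display
  'rV[R]_n (g_sigma_preimage rV_coord) rV_set0 rV_setC rV_bigcup.

Lemma measurable_rV_coord (i : 'I_n) : measurable_fun setT (rV_coord i).
Proof.
move=> _ Y mY; rewrite setTI; apply: sub_sigma_algebra => /=.
rewrite -bigcup_seq/=; exists i => /=; first by rewrite mem_index_enum.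
by exists Y => //; rewrite setTI.
Qed.

Lemma measurable_fun_rVP d (T : measurableType d) (f : T -> 'rV[R]_n) :
  (forall i, measurable_fun setT (fun x => f x 0 i)) -> measurable_fun setT f.
Proof.
move=> mf.
suff H : measurable `<=` [set A : set 'rV[R]_n | measurable (f @^-1` A)].
  by move=> _ A mA; rewrite setTI; exact: H.
apply: smallest_sub.
  split => [|A mA|F mF] /=; first by rewrite preimage_set0; apply: measurable0.
  - by rewrite setTD preimage_setC; exact: measurableC.
  - by rewrite preimage_bigcup; apply: bigcup_measurable => k _; exact: mF.
rewrite -bigcup_seq/= => A [i _ [B mB <-]] /=.
by rewrite setTI -comp_preimage -[X in measurable X]setTI; exact: mf.
Qed.

End rV_measurable.

Section leb_cons.
Context (R : realType) (n : nat) (m : {sigma_finite_measure set 'rV[R]_n -> \bar R}).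

Definition rV_cons (p : R * 'rV[R]_n) : 'rV[R]_n.+1 :=
  row_mx (p.1%:M : 'rV_1) p.2.

Definition rV_uncons (v : 'rV[R]_n.+1) : R * 'rV[R]_n :=
  (v 0 0, \row_j v 0 (lift 0 j)).

Lemma rV_cons0 p : rV_cons p 0 0 = p.1.
Proof. by rewrite mxE; case: splitP => //= j _; rewrite mxE (ord1 j) eqxx. Qed.

Lemma rV_consS p j : rV_cons p 0 (lift 0 j) = p.2 0 j.
Proof.
rewrite mxE; case: splitP => [k|k]; first by rewrite (ord1 k).
by rewrite /= /bump /= => /eqP; rewrite eqSS => /eqP/val_inj ->.
Qed.

Lemma rV_consK : cancel rV_cons rV_uncons.
Proof.
move=> [x w]; rewrite /rV_uncons rV_cons0; congr pair.
by apply/rowP => j; rewrite mxE rV_consS.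
Qed.

Lemma measurable_rV_cons : measurable_fun setT rV_cons.
Proof.
apply: measurable_fun_rVP => i.
case: (unliftP 0 i) => [j ->|->].
  rewrite (_ : (fun x => _) = rV_coord j \o snd); last first.
    by apply/funext => p; rewrite rV_consS.
  exact: measurableT_comp (measurable_rV_coord j) measurable_snd.
rewrite (_ : (fun x => _) = fst); first exact: measurable_fst.
by apply/funext => p; rewrite rV_cons0.
Qed.

Lemma measurable_rV_uncons : measurable_fun setT rV_uncons.
Proof.
apply/measurable_fun_pairP; split; first exact: (@measurable_rV_coord R n.+1 0).
apply: measurable_fun_rVP => j.
rewrite (_ : (fun x => _) = rV_coord (lift 0 j)); last first.
  by apply/funext => v /=; rewrite mxE.
exact: measurable_rV_coord.
Qed.

Definition leb_cons : set 'rV[R]_n.+1 -> \bar R :=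
  pushforward (@lebesgue_measure R \x m)%E rV_cons.

Let leb_cons0 : leb_cons set0 = 0%E.
Proof. by rewrite /leb_cons /pushforward preimage_set0 measure0. Qed.

Let leb_cons_ge0 A : (0 <= leb_cons A)%E.
Proof. by rewrite /leb_cons /pushforward; apply: measure_ge0. Qed.

Let leb_cons_sigma_additive : semi_sigma_additive leb_cons.
Proof.
have mc A : measurable A -> measurable (rV_cons @^-1` A).
  by move=> mA; rewrite -[X in measurable X]setTI; exact: measurable_rV_cons.
move=> F mF tF mUF; rewrite /leb_cons /pushforward preimage_bigcup.
apply: measure_semi_sigma_additive => [i||]; first exact: mc.
- apply/trivIsetP => i j _ _ ij; rewrite -preimage_setI.
  by move/trivIsetP : tF => /(_ _ _ _ _ ij) ->//; rewrite preimage_set0.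
- by rewrite -preimage_bigcup; exact: mc.
Qed.

HB.instance Definition _ := isMeasure.Build _ _ _
  leb_cons leb_cons0 leb_cons_ge0 leb_cons_sigma_additive.

Let leb_cons_sigma_finite : sigma_finite setT leb_cons.
Proof.
have /sigma_finiteP[G [GT ndG Goo]] := sigma_finiteT m.
have /sigma_finiteP[F [FT ndF Foo]] := sigma_finiteT (@lebesgue_measure R).
exists (fun k => rV_uncons @^-1` (F k `*` G k)).
  rewrite -preimage_bigcup (_ : \bigcup_k _ = setT) ?preimage_setT//.
  rewrite -setXTT FT GT predeqE => -[x y]; split => [[k _ []/= ? ?]|].
    by split; exists k.
  move=> [/= [k _ Fkx] [l _ Gly]]; exists (maxn k l) => //; split.
  - by move: x Fkx; exact/subsetPset/ndF/leq_maxl.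
  - by move: y Gly; exact/subsetPset/ndG/leq_maxr.
move=> k; have [mF Fk] := Foo k; have [mG Gk] := Goo k; split.
  rewrite -[X in measurable X]setTI; apply: measurable_rV_uncons => //.
  exact: measurableX.
rewrite /leb_cons /pushforward -comp_preimage (_ : rV_uncons \o rV_cons = id).
  by rewrite preimage_id product_measure1E// lte_mul_pinfty// ge0_fin_numE.
by apply/funext => p; exact: rV_consK.
Qed.

HB.instance Definition _ := @Measure_isSigmaFinite.Build _ _ _
  leb_cons leb_cons_sigma_finite.

End leb_cons.

Fixpoint leb (R : realType) (n : nat) :
    {sigma_finite_measure set 'rV[R]_n -> \bar R} :=
  match n with
  | 0 => [the {sigma_finite_measure set 'rV[R]_0 -> \bar R} of
            \d_(0 : 'rV[R]_0)]
  | n.+1 => [the {sigma_finite_measure set 'rV[R]_n.+1 -> \bar R} of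
              leb_cons (leb R n)]
  end.

Lemma leb_box (R : realType) n (A : 'I_n -> set R) :
  (forall i, measurable (A i)) ->
  leb R n [set x | forall i, A i (x 0 i)] =
  (\prod_(i < n) @lebesgue_measure R (A i))%E.
Proof.
elim: n A => [|n IH] A mA.
  rewrite big_ord0 /= diracE (_ : 0 \in _ = true)//.
  by apply/asboolP => -[].
have mbox : measurable [set x : 'rV[R]_n | forall i, A (lift 0 i) (x 0 i)].
  rewrite (_ : [set x | _] =
      \bigcap_(i in setT) (rV_coord i @^-1` A (lift 0 i))); last first.
    by apply/seteqP; split => [x Ax i _|x Ax i]; exact: Ax.
  apply: fin_bigcap_measurable => // i _.
  by rewrite -[X in measurable X]setTI; exact: measurable_rV_coord.
rewrite big_ord_recl -(IH (A \o lift 0)); last by move=> i; exact: mA.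
rewrite /= /leb_cons /pushforward.
rewrite (_ : @rV_cons R n @^-1` _ =
  A 0 `*` [set x : 'rV[R]_n | forall i, A (lift 0 i) (x 0 i)]).
  by rewrite product_measure1E//; exact: mA.
apply/seteqP; split => [[x w] /= Axw|[x w] /= [Ax Aw] i].
  split; first by have := Axw 0; rewrite rV_cons0.
  by move=> i; have := Axw (lift 0 i); rewrite rV_consS.
by case: (unliftP 0 i) => [j ->|->]; rewrite ?rV_consS ?rV_cons0.
Qed.

Section spaces.
Context (R : realType) (d : nat).
Local Notation X := 'rV[R]_d.
Implicit Types (D : set X) (u v f g : X -> R).

(* A domain is a nonempty connected open set (convexity gives connectedness);
   polyhedral convex: the closure is a finite intersection of half-spaces. *)
Definition convex_polyhedral_domain D :=
  [/\ open D, D !=set0, bounded_set D, convex_set (D : set (convex_lmodType X)) &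
      exists m (A : 'M[R]_(m, d)) (b : 'cV[R]_m),
        closure D = [set x | forall i, (A *m x^T) i 0 <= b i 0]].

Definition partial (i : 'I_d) f (x : X) : R := 'D_(delta_mx 0 i) f x.

(* Elements of L^p(D) are represented by functions on R^d of which only the
   values on D matter: the library's Lp notions are applied to the extension by
   zero. Equality in L^p(D) is equality a.e. in D. *)
Definition Lp D (p : \bar R) u := (u \_ D) \in Lfun (leb R d) p.
Definition Lpnorm D (p : \bar R) u := fine ('N[leb R d]_p[EFin \o (u \_ D)])%E.
Definition L2 D := Lp D 2%:E.
Definition L2norm D := Lpnorm D 2%:E.
Definition L2dot D u v : R := \int[leb R d]_(x in D) (u x * v x).
Definition ae_in D (P : X -> Prop) := {ae leb R d, forall x, D x -> P x}.

(* Linear span in L^2(D), as a set closed under a.e. equality. *)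
Definition L2span D m (b : 'I_m -> X -> R) : set (X -> R) :=
  [set u | L2 D u /\
    exists c : 'I_m -> R, ae_in D (fun x => u x = \sum_(j < m) c j * b j x)].

Definition L2open D (A : set (X -> R)) :=
  A `<=` L2 D /\
  forall u, A u -> exists2 r, 0 < r &
    forall v, L2 D v -> L2norm D (v \- u) < r -> A v.

(* Borel measurability of an L^2(D)-valued map. *)
Definition L2random D d0 (T : measurableType d0) (u : T -> X -> R) :=
  (forall w, L2 D (u w)) /\
  (forall A, L2open D A -> measurable (u @^-1` A)).

Fixpoint Ck (k : nat) f : Prop :=
  continuous f /\
  if k is k'.+1 then
    forall i : 'I_d, (forall x, derivable f x (delta_mx 0 i)) /\ Ck k' (partial i f)
  else True.

Definition test_function D f :=
  (forall k, Ck k f) /\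
  exists2 K : set X, compact K /\ K `<=` D & forall x, ~ K x -> f x = 0.

Definition is_weak_partial D (i : 'I_d) u g :=
  L2 D g /\
  forall phi, test_function D phi -> L2dot D u (partial i phi) = - L2dot D g phi.

Definition H1 D u := L2 D u /\ forall i, exists g, is_weak_partial D i u g.

(* A representative of the weak partial derivative, unique a.e. in D if u is in
   H^1(D); the default value 0 is not meaningful. *)
Definition wpartial D (i : 'I_d) u : X -> R :=
  xget (fun=> 0) [set g | is_weak_partial D i u g].

Definition H1semi D u := Num.sqrt (\sum_(i < d) L2norm D (wpartial D i u) ^+ 2).
Definition H1norm D u := Num.sqrt (L2norm D u ^+ 2 + H1semi D u ^+ 2).

Definition H2 D u := H1 D u /\ forall i, H1 D (wpartial D i u).

(* Sum over the multi-indices of length at most 2. *)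
Definition H2norm D u :=
  Num.sqrt (H1norm D u ^+ 2 +
    \sum_(i < d) \sum_(j < d | (i <= j)%N)
      L2norm D (wpartial D j (wpartial D i u)) ^+ 2).

(* Closure in H^1(D) of the test functions (which all belong to H^1(D)). *)
Definition H10 D u := H1 D u /\
  forall e, 0 < e ->
    exists2 phi, test_function D phi /\ H1 D phi & H1norm D (u \- phi) < e.

(* Norm in H^1(D)^* of the functional v |-> (w, v)_{L^2(D)}. *)
Definition H1dual_norm D w : \bar R :=
  ereal_sup [set `|L2dot D w v|%:E | v in [set v | H1 D v /\ H1norm D v <= 1]].

(* The quotient is that of \bar R, where a / 0 = +oo for a > 0. *)
Definition friedrichs D : \bar R :=
  ereal_sup [set ((L2norm D v)%:E / (H1semi D v)%:E)%E |
    v in [set v | H10 D v /\ ~ ae_in D (fun x => v x = 0)]].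

Definition finite_dim_subspace D (V Y : set (X -> R)) :=
  exists m (b : 'I_m -> X -> R), (forall j, V (b j)) /\ Y = L2span D b.

Definition C1bar D f :=
  {within closure D, continuous f} /\
  forall i : 'I_d, (forall x, D x -> derivable f x (delta_mx 0 i)) /\
    exists2 g, {within closure D, continuous g} &
      forall x, D x -> g x = partial i f x.

Definition C1norm D f : R :=
  sup [set `|f x| | x in closure D] +
  \sum_(i < d) sup [set `|partial i f x| | x in D].

(* Strong measurability: pointwise limit in C^1 of simple maps. *)
Definition C1simple D d0 (T : measurableType d0) (s : T -> X -> R) :=
  exists m (A : 'I_m -> set T) (f : 'I_m -> X -> R),
    [/\ forall j, measurable (A j), forall j, C1bar D (f j) &
        forall t, s t = fun x => \sum_(j < m) \1_(A j) t * f j x].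

Definition C1strongly_measurable D d0 (T : measurableType d0) (k : T -> X -> R) :=
  (forall t, C1bar D (k t)) /\
  exists s : nat -> T -> X -> R, (forall n, C1simple D (s n)) /\
    forall t, C1norm D (s n t \- k t) @[n --> \oo] --> 0.

(* y is the (Galerkin) solution in Y of -div(k grad y) = u. *)
Definition is_galerkin_solution D (Y : set (X -> R)) (k u y : X -> R) :=
  Y y /\ forall v, Y v ->
    \int[leb R d]_(x in D)
      (k x * \sum_(i < d) wpartial D i y x * wpartial D i v x) = L2dot D u v.

Definition Uad D (l r : R) : set (X -> R) :=
  [set u | L2 D u /\ ae_in D (fun x => l <= u x <= r)].

Definition quasi_interp D m (phi : 'I_m -> X -> R) u : X -> R :=
  fun x => \sum_(j < m)
    L2dot D (phi j) u / (\int[leb R d]_(z in D) phi j z) * phi j x.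

Definition control_cost D (alpha gamma : R) u : R :=
  alpha / 2 * L2norm D u ^+ 2 + gamma * Lpnorm D 1%E u.

Definition rn_objective D (yd : X -> R) (alpha gamma : R)
    (Xi : Type) (S : (X -> R) -> Xi -> X -> R)
    d0 (T : measurableType d0) (P : probability T R) (xi : T -> Xi) u : \bar R :=
  ((2^-1)%:E * 'E_P[fun t => (L2norm D (S u (xi t) \- yd) ^+ 2)%R] +
   (control_cost D alpha gamma u)%:E)%E.

Definition saa_objective D (yd : X -> R) (alpha gamma : R)
    (Xi : Type) (Sh : (X -> R) -> Xi -> X -> R)
    (N : nat) (xis : nat -> Xi) u : R :=
  (2 * N%:R)^-1 * \sum_(i < N) L2norm D (Sh u (xis i) \- yd) ^+ 2 +
  control_cost D alpha gamma u.

End spaces.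

Definition is_minimizer (T : Type) d0 (V : porderType d0) (A : set T) (J : T -> V) u :=
  A u /\ forall v, A v -> (J u <= J v)%O.

#[short(type="completeMetricType")]
HB.structure Definition CompleteMetric (R : numDomainType) :=
  {T of CompletePseudoMetric R T & Metric R T}.

Definition separable (T : topologicalType) := exists2 A : set T, countable A & dense A.

Notation borel T := (g_sigma_algebraType (@open T)).

Definition mutually_independent d0 (Omega : measurableType d0) (R : realType)
    (P : probability Omega R) d1 (T : measurableType d1) (X : nat -> Omega -> T) :=
  forall (s : seq nat) (A : nat -> set T),
    uniq s -> (forall i, measurable (A i)) ->
    P (\bigcap_(i in [set` s]) (X i @^-1` A i)) =
    (\prod_(i <- s) P (X i @^-1` A i))%E.

Definition iid_copies d0 (Omega : measurableType d0) d1 (Omega0 : measurableType d1)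
    (R : realType) (P : probability Omega R) (P0 : probability Omega0 R)
    d2 (T : measurableType d2) (X : nat -> Omega -> T) (X0 : Omega0 -> T) :=
  mutually_independent P X /\
  forall i A, measurable A -> P (X i @^-1` A) = P0 (X0 @^-1` A).

(* Main.v *)
Require Import Defs.
From HB Require Import structures.
From mathcomp Require Import all_boot all_order all_algebra.
From mathcomp Require Import all_classical all_reals all_analysis.
From mathcomp Require Import measurable_realfun ring lra.
Set Implicit Arguments.
Unset Strict Implicit.
Unset Printing Implicit Defensive.
Import Order.TTheory GRing.Theory Num.Theory.
Import numFieldNormedType.Exports.
Local Open Scope classical_set_scope.
Local Open Scope ring_scope.

(* The adjoint state p(z) = S(S(u*, z) - y_d, z) of the risk-neutral solution is
   bounded in L^2(D) by tau = C_D^2 C* / kappa_min, and it is Lipschitz in the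
   sup norm of kappa, so that strong measurability makes it a limit of countably
   valued maps. An exponential moment bound in Hilbert space puts the sample mean
   of p within 12 tau eps of its expectation with probability at least 1 - delta.

   On that event, test the variational inequality of the risk-neutral problem
   with u_{h,N}^*, that of the SAA problem with I_h u*, and add. The L^1 terms
   cancel because I_h does not increase the L^1 norm, and the sampled misfit is
   convex. With e = u_{h,N}^* - u* and w = I_h u* - u* this gives
     alpha |e|^2 <= (12 tau eps + 2 q C* + alpha |w|) |e|
                    + (p_h, w) + alpha (u*, w) + |S_h w|^2 / 4,
   where p_h is the sample mean of the discrete adjoint states, the last term is
   averaged over the sample too, and q = O(h^2) bounds S - S_h by Aubin-Nitsche
   duality (the adjoint equation is the state equation). Both (p_h, w) and
   (u*, w) are O(h^2) by the H^1(D)^* estimate for I_h, and it remains to solve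
   the quadratic inequality. *)

(** The sampling error is tested with [u_{h,N}^* - u^*], which itself depends on the sample, so a
    scalar tail bound for one fixed test function would not do: the deviation has to be controlled
    in the norm of L^2(D), uniformly in [v]. Since gradients are needed only at the deterministic
    [u^*], the summands are i.i.d.

    No L^2(D)-valued integral is ever formed. Expectations occur only as integrals of [(p, v)] for
    fixed [v]; a mean in L^2(D) appears only once [p] has been replaced by a map with finitely many
    values, which the first N samples follow except on an event of probability at most delta/4.
    Exponential moments are then finite sums over tuples.

    Functions stand for their classes, and solution operators are arbitrary selections, so linearity
    and identities between gradients hold only almost everywhere. Weak derivatives are determined
    a.e. by the fundamental lemma, which is why smooth bumps are built.

    The constants of the statement exceed those obtained; strictness comes from the term in [eps],
    positive because [yd] is not a.e. zero and hence [C* > 0]. *)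

(** The common source of Cauchy-Schwarz for [L2dot], for finite sums and for energy forms; the
    polynomial in [t] is then the squared norm of [u + t v]. *)
Lemma discriminant_le (R : realFieldType) (a b c : R) : 0 <= b ->
  (forall t, 0 <= a + t * c *+ 2 + t ^+ 2 * b) -> c ^+ 2 <= a * b.
Proof.
move=> b0 q; have [b00|bn0] := eqVneq b 0.
  rewrite b00 mulr0; have [->|cn0] := eqVneq c 0; first by rewrite expr0n.
  (* With [b = 0] the polynomial is affine, and at this point it takes the value -1. *)
  have := q (- (a + 1) / (c *+ 2)); rewrite b00 mulr0 addr0 -mulrnAr.
  by rewrite divfK ?mulrn_eq0// opprD addNKr; lra.
have bp : 0 < b by rewrite lt_neqAle eq_sym bn0.
have := q (- c / b); rewrite (_ : a + _ + _ = (a * b - c ^+ 2) / b).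
  by rewrite pmulr_lge0 ?invr_gt0// subr_ge0.
by field.
Qed.

(** * The space L^2(D) *)

Section L2_theory.
Context (R : realType) (d : nat) (D : set 'rV[R]_d).
Context (mD : measurable D).
Local Notation X := 'rV[R]_d.
Local Notation mu := (leb R d).
Implicit Types (u v w : X -> R) (a : R).

Lemma ae_in_imp (P Q : X -> Prop) :
  (forall x, D x -> P x -> Q x) -> ae_in D P -> ae_in D Q.
Proof. by rewrite /ae_in => PQ; apply: filterS => x h Dx; exact/PQ/h. Qed.

Lemma ae_in_imp2 (P P' Q : X -> Prop) :
  (forall x, D x -> P x -> P' x -> Q x) -> ae_in D P -> ae_in D P' -> ae_in D Q.
Proof.
by rewrite /ae_in => PQ; apply: filterS2 => x h h' Dx; apply: PQ; [|exact: h|exact: h'].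
Qed.

Lemma L2_measurable u : L2 D u -> measurable_fun D u.
Proof.
move=> /sub_Lfun_mfun; rewrite inE => mu_.
by apply/(measurable_restrictT _ mD).
Qed.

Lemma L2dot_integrable u v : L2 D u -> L2 D v ->
  mu.-integrable D (EFin \o (u \* v)).
Proof.
move=> lu lv; apply/(integrable_mkcond _ mD).
have /Lfun1_integrable := Lfun2_mul_Lfun1 lu lv.
rewrite restrict_EFin; congr (integrable _ _ _).
by apply/funext => x /=; rewrite !patchE; case: ifP => //=; rewrite mulr0.
Qed.

Lemma sqr_integrable_L2 u : measurable_fun D u ->
  mu.-integrable D (EFin \o (fun x => u x ^+ 2)) -> L2 D u.
Proof.
move=> mu_ /(integrable_mkcond _ mD); rewrite restrict_EFin => iu.
apply/andP; split; first by rewrite inE; apply/(measurable_restrictT _ mD).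
rewrite inE /= /finite_norm unlock poweR_lty//.
have /integrableP[_] := iu; congr (_ < _)%E; apply: eq_integral => x _ /=.
congr EFin; rewrite !patchE; case: ifP => _; last by rewrite !normr0 powR0.
by rewrite powR_mulrn ?normr_ge0// normrX.
Qed.

Lemma L2_0 : L2 D 0.
Proof.
apply: sqr_integrable_L2; first exact: measurable_cst.
apply: (eq_integrable mD (cst 0%E)); last exact: integrable0.
by move=> x _ /=; rewrite expr0n.
Qed.

Lemma L2D u v : L2 D u -> L2 D v -> L2 D (u + v).
Proof.
rewrite /L2 /Lp => lu lv; rewrite (_ : (u + v) \_ D = u \_ D + v \_ D).
  by have [_] := @Lfun_addr_closed _ _ R mu 2%:E (lee1n 2); apply.
by apply/funext => x; rewrite !fctE !patchE; case: ifP => //; rewrite addr0.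
Qed.

Lemma L2Z a u : L2 D u -> L2 D (a *: u).
Proof.
rewrite /L2 /Lp => lu; rewrite (_ : (a *: u) \_ D = a \o* (u \_ D)).
  by apply: Lfun_scale => //; rewrite ler1n.
apply/funext => x; rewrite /= !patchE; case: ifP => _; last by rewrite mul0r.
by rewrite mulrC.
Qed.

Lemma L2N u : L2 D u -> L2 D (- u).
Proof. by rewrite -scaleN1r; exact: L2Z. Qed.

Lemma L2B u v : L2 D u -> L2 D v -> L2 D (u - v).
Proof. by move=> lu lv; apply: L2D => //; exact: L2N. Qed.

Lemma L2_sum (I : Type) (s : seq I) (P : pred I) (f : I -> X -> R) :
  (forall i, L2 D (f i)) -> L2 D (\sum_(i <- s | P i) f i).
Proof.
move=> lf; elim/big_rec: _ => [|i u _ lu]; first exact: L2_0.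
exact: L2D.
Qed.

Lemma L2_bounded_mul (k : X -> R) u (M : R) : measurable_fun D k ->
  (forall x, D x -> `|k x| <= M) -> L2 D u -> L2 D (k \* u).
Proof.
move=> mk kM lu; have mu_ := L2_measurable lu.
apply: sqr_integrable_L2; first exact: measurable_funM.
have := integrableZl mD (M ^+ 2) (L2dot_integrable lu lu).
apply: le_integrable => //.
  by apply/measurable_EFinP/measurable_funX; exact: measurable_funM.
move=> x Dx /=; rewrite lee_fin exprMn -(expr2 (u x)) !normrM ler_wpM2r//.
have h := le_trans (kM _ Dx) (ler_norm M).
by rewrite ler_pM.
Qed.

Lemma L2_bounded u (M : R) : (mu D < +oo)%E -> measurable_fun D u ->
  (forall x, D x -> `|u x| <= M) -> L2 D u.
Proof.
move=> Doo mu_ uM; apply: sqr_integrable_L2 => //.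
apply: measurable_bounded_integrable => //; first exact: measurable_funX.
exists (M ^+ 2); split; first exact: num_real.
move=> y My x Dx /=; rewrite normrX (le_trans _ (ltW My))//.
by rewrite lerXn2r// ?nnegrE ?(le_trans _ (uM _ Dx)) ?uM.
Qed.

Lemma L2_integrable u : (mu D < +oo)%E -> L2 D u -> mu.-integrable D (EFin \o u).
Proof.
move=> Doo lu; have l1 : L2 D (cst 1).
  by apply: (@L2_bounded _ 1) => // x _ /=; rewrite normr1.
have := L2dot_integrable lu l1; congr (integrable _ _ _).
by apply/funext => x /=; rewrite mulr1.
Qed.

Lemma L2dotC u v : L2dot D u v = L2dot D v u.
Proof. by apply: eq_Rintegral => x _; rewrite mulrC. Qed.

Lemma L2dotDl u v w : L2 D u -> L2 D v -> L2 D w ->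
  L2dot D (u + v) w = L2dot D u w + L2dot D v w.
Proof.
move=> lu lv lw; rewrite /L2dot -RintegralD//; try exact: L2dot_integrable.
by apply: eq_Rintegral => x _; rewrite mulrDl.
Qed.

Lemma L2dotZl a u w : L2 D u -> L2 D w -> L2dot D (a *: u) w = a * L2dot D u w.
Proof.
move=> lu lw; rewrite /L2dot -RintegralZl//; try exact: L2dot_integrable.
by apply: eq_Rintegral => x _; rewrite mulrA.
Qed.

Lemma L2dotNl u w : L2 D u -> L2 D w -> L2dot D (- u) w = - L2dot D u w.
Proof. by move=> lu lw; rewrite -scaleN1r L2dotZl// mulN1r. Qed.

Lemma L2dotBl u v w : L2 D u -> L2 D v -> L2 D w ->
  L2dot D (u - v) w = L2dot D u w - L2dot D v w.
Proof. by move=> lu lv lw; rewrite L2dotDl ?L2dotNl//; exact: L2N. Qed.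

Lemma L2dotDr u v w : L2 D u -> L2 D v -> L2 D w ->
  L2dot D w (u + v) = L2dot D w u + L2dot D w v.
Proof. by move=> *; rewrite !(L2dotC w) L2dotDl. Qed.

Lemma L2dotZr a u w : L2 D u -> L2 D w -> L2dot D w (a *: u) = a * L2dot D w u.
Proof. by move=> *; rewrite !(L2dotC w) L2dotZl. Qed.

Lemma L2dotNr u w : L2 D u -> L2 D w -> L2dot D w (- u) = - L2dot D w u.
Proof. by move=> *; rewrite !(L2dotC w) L2dotNl. Qed.

Lemma L2dotBr u v w : L2 D u -> L2 D v -> L2 D w ->
  L2dot D w (u - v) = L2dot D w u - L2dot D w v.
Proof. by move=> *; rewrite !(L2dotC w) L2dotBl. Qed.

Lemma L2dot0l w : L2dot D 0 w = 0.
Proof.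
rewrite /L2dot (@eq_Rintegral _ _ _ _ _ (cst 0)); last by move=> x _; rewrite mul0r.
by rewrite Rintegral_cst// mul0r.
Qed.

Lemma L2dot_suml (I : Type) (s : seq I) (P : pred I) (f : I -> X -> R) w :
  (forall i, L2 D (f i)) -> L2 D w ->
  L2dot D (\sum_(i <- s | P i) f i) w = \sum_(i <- s | P i) L2dot D (f i) w.
Proof.
move=> lf lw; elim: s => [|i s IH]; first by rewrite !big_nil L2dot0l.
by rewrite !big_cons; case: ifP => // _; rewrite L2dotDl ?IH//; exact: L2_sum.
Qed.

Lemma L2dot_ge0 u : 0 <= L2dot D u u.
Proof. by apply: Rintegral_ge0 => x _; rewrite -expr2 sqr_ge0. Qed.

Lemma Lpnorm_ge0 p u : 0 <= Lpnorm D p u.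
Proof. by rewrite /Lpnorm fine_ge0// Lnorm_ge0. Qed.

Lemma L2norm_ge0 u : 0 <= L2norm D u.
Proof. exact: Lpnorm_ge0. Qed.

Lemma sqr_L2norm u : L2 D u -> L2norm D u ^+ 2 = L2dot D u u.
Proof.
move=> lu; have fu : ('N[mu]_(2%:E)[EFin \o (u \_ D)] \is a fin_num)%E.
  rewrite ge0_fin_numE ?Lnorm_ge0//.
  by move: lu => /sub_Lfun_finLfun; rewrite inE.
apply: EFin_inj; rewrite -powR_mulrn ?L2norm_ge0//.
rewrite -poweR_EFin /L2norm /Lpnorm fineK// poweR_Lnorm//.
rewrite /L2dot /Rintegral fineK; last first.
  by apply: integrable_fin_num => //; exact: L2dot_integrable.
rewrite [RHS]integral_mkcond; apply: eq_integral => x _ /=.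
rewrite !patchE; case: ifP => _; last by rewrite normr0 powR0.
by rewrite powR_mulrn// -normrX ger0_norm ?sqr_ge0// expr2.
Qed.

Lemma L2dot_le u v : L2 D u -> L2 D v -> `|L2dot D u v| <= L2norm D u * L2norm D v.
Proof.
move=> lu lv; have nu := L2norm_ge0 u; have nv := L2norm_ge0 v.
rewrite -(ler_sqr (normr_ge0 _)) ?nnegrE ?mulr_ge0//= exprMn !sqr_L2norm//.
rewrite real_normK ?num_real//.
set a := L2dot D u u; set b := L2dot D v v; set c := L2dot D u v.
have q t : 0 <= a + t * c *+ 2 + t ^+ 2 * b.
  have := L2dot_ge0 (u + t *: v).
  have ltv := L2Z t lv; have luv := L2D lu ltv.
  rewrite L2dotDl// !L2dotDr// !L2dotZl// !L2dotZr// (L2dotC v u) -/a -/b -/c.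
  by congr (_ <= _); ring.
exact: discriminant_le (L2dot_ge0 v) q.
Qed.

Lemma L2dot_ler u v : L2 D u -> L2 D v -> L2dot D u v <= L2norm D u * L2norm D v.
Proof. by move=> lu lv; exact: le_trans (ler_norm _) (L2dot_le lu lv). Qed.

Lemma L2norm_triangle u v : L2 D u -> L2 D v ->
  L2norm D (u + v) <= L2norm D u + L2norm D v.
Proof.
move=> lu lv; have nu := L2norm_ge0 u; have nv := L2norm_ge0 v.
rewrite -ler_sqr ?nnegrE ?addr_ge0 ?L2norm_ge0//= sqr_L2norm ?L2dotDl ?L2dotDr//;
  try exact: L2D.
rewrite (L2dotC v u) sqrrD !sqr_L2norm//; have := L2dot_ler lu lv; lra.
Qed.

Lemma L2normZ a u : L2 D u -> L2norm D (a *: u) = `|a| * L2norm D u.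
Proof.
move=> lu; apply/eqP; rewrite -(eqrXn2 (n := 2)) ?L2norm_ge0 ?mulr_ge0 ?L2norm_ge0//.
rewrite exprMn !sqr_L2norm ?L2dotZl ?L2dotZr//; try exact: L2Z.
by rewrite real_normK ?num_real// expr2 mulrA.
Qed.

Lemma L2normN u : L2 D u -> L2norm D (- u) = L2norm D u.
Proof. by move=> lu; rewrite -scaleN1r L2normZ// normrN1 mul1r. Qed.

Lemma L2norm_triangleB u v : L2 D u -> L2 D v ->
  L2norm D (u - v) <= L2norm D u + L2norm D v.
Proof.
by move=> lu lv; rewrite -(L2normN lv) L2norm_triangle//; exact: L2N.
Qed.

Lemma L2_sqr_normD u v : L2 D u -> L2 D v ->
  L2norm D (u + v) ^+ 2 = L2norm D u ^+ 2 + L2dot D u v *+ 2 + L2norm D v ^+ 2.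
Proof.
move=> lu lv; rewrite !sqr_L2norm; try exact: L2D; try by [].
by rewrite L2dotDl ?L2dotDr ?(L2dotC v u)//; [ring|exact: L2D].
Qed.

Lemma L2norm_eq0 u : L2 D u -> L2norm D u = 0 <-> ae_in D (fun x => u x = 0).
Proof.
move=> lu; have iu := L2dot_integrable lu lu.
have muu := measurable_int _ iu.
have E : (L2norm D u ^+ 2)%:E = (\int[mu]_(x in D) `|(u x * u x)%:E|)%E.
  rewrite sqr_L2norm// /L2dot /Rintegral fineK; last exact: integrable_fin_num.
  by apply: eq_integral => x _ /=; rewrite -expr2 ger0_norm ?sqr_ge0.
split=> [u0|u0].
  have /(ae_eq_integral_abs _ mD muu) : (\int[mu]_(x in D) `|(u x * u x)%:E| = 0)%E.
    by rewrite -E u0 expr0n.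
  by apply: filterS => x /= h Dx; have [/eqP] := h Dx; rewrite mulf_eq0 orbb => /eqP.
apply/eqP; rewrite -sqrf_eq0 -eqe; apply/eqP; rewrite E.
apply/(ae_eq_integral_abs _ mD muu); move: u0; rewrite /ae_in; apply: filterS => x /= h Dx.
by rewrite h// mulr0.
Qed.

Lemma L2dot_ae u u' v : L2 D u -> L2 D u' -> L2 D v ->
  ae_in D (fun x => u x = u' x) -> L2dot D u v = L2dot D u' v.
Proof.
move=> lu lu' lv uu'; congr fine; apply: ae_eq_integral => //.
- exact: measurable_int (L2dot_integrable lu lv).
- exact: measurable_int (L2dot_integrable lu' lv).
- by move: uu'; rewrite /ae_in; apply: filterS => x /= h Dx; rewrite h.
Qed.

Lemma L2norm_ae u u' : L2 D u -> L2 D u' ->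
  ae_in D (fun x => u x = u' x) -> L2norm D u = L2norm D u'.
Proof.
move=> lu lu' uu'; apply/eqP; rewrite -(eqrXn2 (n := 2)) ?L2norm_ge0//.
rewrite !sqr_L2norm// (L2dot_ae lu lu')// L2dotC (L2dot_ae lu lu')//.
Qed.

Lemma L2norm_sub_eq0 u v : L2 D u -> L2 D v ->
  L2norm D (u - v) = 0 -> ae_in D (fun x => u x = v x).
Proof.
move=> lu lv /(L2norm_eq0 (L2B lu lv)); apply: ae_in_imp => x _ /eqP.
by rewrite /= subr_eq0 => /eqP.
Qed.

(** Only [g = u] is used in the proof. The hypothesis is stated for all [g] because errors of
    solution operators are estimated by pairing them with arbitrary data [g] and moving the operator
    onto [g]. *)
Lemma L2norm_le_dual u c : L2 D u -> 0 <= c ->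
  (forall g, L2 D g -> L2dot D u g <= c * L2norm D g) -> L2norm D u <= c.
Proof.
move=> lu c0 /(_ _ lu); rewrite -sqr_L2norm// expr2.
have := L2norm_ge0 u; rewrite le_eqVlt => /predU1P[<-//|u0].
by rewrite ler_pM2r.
Qed.

End L2_theory.

(** * Test functions and the fundamental lemma of the calculus of variations *)

Section flat_function.
Context (R : realType).
Implicit Types (c x : R) (p : nat).

(* The products [x^-p * exp(-c/x)], extended by 0, are closed under derivation
   up to linear combinations. *)
Definition flat c p x : R := if 0 < x then x^-1 ^+ p * expR (- (c * x^-1)) else 0.

Lemma flat_ge0 c p x : 0 <= flat c p x.
Proof.
rewrite /flat; case: ifP => // x0.
by rewrite mulr_ge0 ?exprn_ge0 ?invr_ge0 ?expR_ge0// ltW.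
Qed.

(** From [expR y >= y ^ (p+2) / (p+2)!] at [y = c / x]: after cancelling [x^-p] two powers of [x]
    survive, and the difference quotient at the origin consumes one of them. *)
Lemma flat_le c p x : 0 < c -> flat c p x <= (p.+2`!)%:R / c ^+ p.+2 * x ^+ 2.
Proof.
move=> c0; have K0 : 0 <= (p.+2`!)%:R / c ^+ p.+2.
  by rewrite divr_ge0// exprn_ge0// ltW.
rewrite /flat; case: ifP => x0; last by rewrite mulr_ge0// sqr_ge0.
have y0 : 0 < c * x^-1 by rewrite mulr_gt0// invr_gt0.
have := @expR_ge1Dxn _ (c * x^-1) p.+1 (ltW y0).
rewrite expRN => h.
have h2 : (c * x^-1) ^+ p.+2 / (p.+2`!)%:R <= expR (c * x^-1).
  by apply: le_trans h; rewrite lerDr.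
have q0 : 0 < (c * x^-1) ^+ p.+2 / (p.+2`!)%:R.
  by rewrite divr_gt0 ?exprn_gt0// ltr0n fact_gt0.
have -> : (p.+2`!)%:R / c ^+ p.+2 * x ^+ 2 =
    x^-1 ^+ p * ((c * x^-1) ^+ p.+2 / (p.+2`!)%:R)^-1.
  rewrite invf_div exprMn -addn2 (exprD x^-1) !exprVn.
  have xn0 : x != 0 by rewrite gt_eqF.
  have cn0 : c != 0 by rewrite gt_eqF.
  field.
  by rewrite xn0 !expf_neq0.
by rewrite ler_wpM2l ?exprn_ge0 ?invr_ge0 ?(ltW x0)// lef_pV2// posrE expR_gt0.
Qed.

Lemma is_derive_flat c p x : 0 < c ->
  is_derive x 1 (flat c p) (c * flat c p.+2 x - p%:R * flat c p.+1 x).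
Proof.
move=> c0; have [x0|x0|x0] := ltgtP x 0.
- rewrite /flat ltNge (ltW x0)/= !mulr0 subr0.
  apply: (@near_eq_is_derive _ _ _ (cst 0)).
    by near=> y; rewrite /flat ifF//; apply/negbTE; rewrite -leNgt ltW//; near: y; exact: lt_nbhsl.
- have xn0 : x != 0 by rewrite gt_eqF.
  rewrite /flat x0; apply: (@near_eq_is_derive _ _ _
      (fun y : R => y^-1 ^+ p * expR (- (c * y^-1)) : R)).
    by near=> y; rewrite /flat ifT//; near: y; exact: lt_nbhsr.
  have dV : is_derive x 1 (fun y : R => y^-1) (- x ^- 2 *: 1).
    exact: is_deriveV.
  have dVp : is_derive x 1 (fun y : R => y^-1 ^+ p) (- (p%:R * x^-1 ^+ p.+1)).
    case: p => [|p]; first by rewrite mul0r oppr0; exact: is_derive_cst.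
    rewrite (_ : (fun y : R => _) = (fun y : R => y^-1) ^+ p.+1); last first.
      by apply/funext => y; rewrite exprfctE.
    have dX := is_deriveX p.+1 dV; refine (is_derive_eq dX _).
    by rewrite /GRing.scale /= mulr1 mulrN -exprVn -mulrA -exprD addn2.
  have dcV : is_derive x 1 (fun y : R => - (c * y^-1)) (c * x^-1 ^+ 2).
    have dcZ := is_deriveN (is_deriveZ c dV); refine (is_derive_eq dcZ _).
    by rewrite /GRing.scale /= mulr1 mulrN opprK exprVn.
  have dE := @is_derive1_comp _ expR _ x _ _ (is_derive_expR _) dcV.
  have dM := is_deriveM dVp dE; refine (is_derive_eq dM _) => /=.
  rewrite /GRing.scale /= -[in p.+2]addn2 exprD; ring.
- have f0 q : flat c q 0 = 0 by rewrite /flat ltxx.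
  rewrite x0 !f0 !mulr0 subr0.
  have : 0 <= (p.+2`!)%:R / c ^+ p.+2 by rewrite divr_ge0// exprn_ge0// ltW.
  have := fun y => flat_le p y c0; move: (_ / _) => K fle K0.
  (* By the quadratic bound the difference quotient at the origin is of order [|h|], so the
     derivative there is 0. *)
  have h : h^-1 *: ((flat c p \o shift (0:R)) (h *: (1:R)) - flat c p 0)
     @[h --> (0:R)^'] --> (0 : R).
    apply/cvgr0Pnorm_le => e e0; near=> h.
    have hn0 : h != 0 by near: h; exact: nbhs_dnbhs_neq.
    rewrite /= addr0 f0 subr0 /GRing.scale /= mulr1.
    rewrite normrM normfV ler_pdivrMl ?normr_gt0// ger0_norm ?flat_ge0//.
    apply: (le_trans (fle h)); rewrite -(real_normK (num_real h)).
    rewrite expr2 mulrA mulrC ler_wpM2l//.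
    have : `|h| <= e / (K + 1) by near: h; apply: dnbhs0_le; rewrite divr_gt0//; lra.
    rewrite ler_pdivlMr; last lra.
    by apply: le_trans; rewrite mulrC ler_wpM2l//; lra.
  apply: DeriveDef; first by apply/cvg_ex; exists 0.
  exact: cvg_lim h.
Unshelve. all: by end_near. Qed.

End flat_function.

(** * Functions of class C^k *)

Section Ck_theory.
Context (R : realType) (d : nat).
Local Notation X := 'rV[R]_d.
Implicit Types (f g : X -> R) (k : nat).

Lemma CkW k f : Ck k.+1 f -> Ck k f.
Proof.
elim: k f => [|k IH] f; first by case=> cf _.
move=> [cf df]; split=> // i; have [dfi cfi] := df i; split=> //.
exact: IH.
Qed.

Lemma Ck_cst k (a : R) : Ck k (cst a : X -> R).
Proof.
elim: k a => [|k IH] a; split; try exact: cst_continuous; first by [].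
move=> i; split; first by move=> x; exact: derivable_cst.
rewrite (_ : partial i _ = cst 0)//.
by apply/funext => x; rewrite /partial derive_cst.
Qed.

Lemma CkD k f g : Ck k f -> Ck k g -> Ck k (f + g).
Proof.
elim: k f g => [|k IH] f g [cf df] [cg dg]; split=> //;
  try by move=> x; exact: continuousD (cf x) (cg x).
move=> i; have [dfi cfi] := df i; have [dgi cgi] := dg i; split.
  by move=> x; exact: derivableD (dfi x) (dgi x).
rewrite (_ : partial i _ = partial i f + partial i g); first exact: IH.
by apply/funext => x; rewrite /partial deriveD.
Qed.

Lemma CkM k f g : Ck k f -> Ck k g -> Ck k (f * g).
Proof.
elim: k f g => [|k IH] f g [cf df] [cg dg]; split=> //;
  try by move=> x; exact: continuousM (cf x) (cg x).
move=> i; have [dfi cfi] := df i; have [dgi cgi] := dg i; split.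
  by move=> x; exact: derivableM (dfi x) (dgi x).
rewrite (_ : partial i _ = f * partial i g + g * partial i f).
  by apply: CkD; apply: IH => //; apply: CkW; split.
by apply/funext => x; rewrite /partial deriveM.
Qed.

Lemma CkZ k (a : R) f : Ck k f -> Ck k (a *: f).
Proof.
rewrite (_ : a *: f = cst a * f); first by apply: CkM; exact: Ck_cst.
by [].
Qed.

Lemma Ck_prod k (I : Type) (s : seq I) (F : I -> X -> R) :
  (forall i, Ck k (F i)) -> Ck k (\prod_(i <- s) F i).
Proof.
move=> CF; elim/big_rec: _ => [|i f _ Cf]; first exact: (Ck_cst k 1).
exact: CkM.
Qed.

(** The difference quotient in direction [delta_mx 0 j] is literally one of [psi] at [s * x 0 i + b]
    with increment [s * (i == j)], so the chain rule reduces to dimension one. *)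
Lemma is_derive_affine_coord (psi : R -> R) (s b dpsi : R) (i j : 'I_d) (x : X) :
  is_derive (s * x 0 i + b) 1 psi dpsi ->
  is_derive x (delta_mx 0 j) (fun y : X => psi (s * y 0 i + b))
    (s * (i == j)%:R * dpsi).
Proof.
move=> [dp <-]; set v := s * (i == j)%:R; set y := s * x 0 i + b.
have E : (fun h : R => h^-1 *: (((fun y : X => psi (s * y 0 i + b)) \o shift x)
     (h *: delta_mx 0 j) - psi (s * x 0 i + b))) =
   (fun h : R => h^-1 *: ((psi \o shift y) (h *: v) - psi y)).
  apply/funext => h; rewrite /= !mxE eqxx /= /y /v; congr (_ *: (psi _ - _)).
  rewrite /GRing.scale /=; ring.
have dv : derivable psi y v by apply/diff_derivable/derivable1_diffP.
apply: DeriveDef; first by rewrite /derivable E.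
rewrite /derive E -/(derive psi y v) deriveE; last exact/derivable1_diffP.
by rewrite deriv1E// derive1E.
Qed.

(** The induction on [k] treats all exponents [p] at once, since a derivative raises the exponent by
    one and by two. *)
Lemma Ck_flat_coord k (c s b : R) p (i : 'I_d) : 0 < c ->
  Ck k (fun y : X => flat c p (s * y 0 i + b)).
Proof.
move=> c0; have cont q : continuous (fun y : X => flat c q (s * y 0 i + b)).
  move=> x; apply: (@continuous_comp _ _ _ (fun y : X => s * y 0 i + b) (flat c q)).
    apply: continuousD; last exact: cst_continuous.
    apply: continuousM; first exact: cst_continuous.
    exact: coord_continuous.
  apply/differentiable_continuous/derivable1_diffP.
  by have [] := is_derive_flat q (s * x 0 i + b) c0.
elim: k p => [|k IH] p; split=> //.
move=> j; have D (x : X) := is_derive_affine_coord j (is_derive_flat p (s * x 0 i + b) c0).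
split; first by move=> x; have [] := D x.
rewrite (_ : partial j _ = (s * (i == j)%:R) *: (
  c *: (fun y : X => flat c p.+2 (s * y 0 i + b)) +
  (- p%:R) *: (fun y : X => flat c p.+1 (s * y 0 i + b)))).
  by apply: CkZ; apply: CkD; apply: CkZ.
apply/funext => x; rewrite /partial; have [_ ->] := D x.
by rewrite !fctE /GRing.scale /= mulNr.
Qed.

End Ck_theory.

(** * Boxes, and the sigma-algebra they generate *)

Section boxes.
Context (R : realType) (d : nat).
Local Notation X := 'rV[R]_d.
Implicit Types (a b x : X) (D : set X).

Definition obox a b : set X := [set x | forall i, a 0 i < x 0 i < b 0 i].
Definition cbox a b : set X := [set x | forall i, a 0 i <= x 0 i <= b 0 i].

Lemma obox_cbox a b : obox a b `<=` cbox a b.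
Proof. by move=> x xab i; have /andP[/ltW -> /ltW ->] := xab i. Qed.

Lemma measurable_obox a b : measurable (obox a b).
Proof.
rewrite (_ : obox a b = \bigcap_(i in setT) (rV_coord i @^-1` `]a 0 i, b 0 i[)).
  apply: fin_bigcap_measurable => // i _.
  by rewrite -[X in measurable X]setTI; exact: measurable_rV_coord.
apply/seteqP; split => [x xab i _ /=|x xab i]; first by rewrite in_itv; exact: xab.
by have /= := xab i I; rewrite in_itv.
Qed.

Lemma measurable_cbox a b : measurable (cbox a b).
Proof.
rewrite (_ : cbox a b = \bigcap_(i in setT) (rV_coord i @^-1` `[a 0 i, b 0 i])).
  apply: fin_bigcap_measurable => // i _.
  by rewrite -[X in measurable X]setTI; exact: measurable_rV_coord.
apply/seteqP; split => [x xab i _ /=|x xab i]; first by rewrite in_itv; exact: xab.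
by have /= := xab i I; rewrite in_itv.
Qed.

Lemma leb_cbox_lty a b : (leb R d (cbox a b) < +oo)%E.
Proof.
rewrite (_ : cbox a b = [set x | forall i, `[a 0 i, b 0 i]%classic (x 0 i)]).
  rewrite (leb_box (A := fun i => `[a 0 i, b 0 i]%classic))//.
  rewrite ltey_eq; apply/orP; left.
  elim/big_ind : _ => [//|u v u0 v0|i _]; first exact: fin_numM.
  by rewrite lebesgue_measure_itv /=; case: ifP => _; rewrite -?EFinB.
by apply/seteqP; split => x xab i; have := xab i; rewrite /= in_itv.
Qed.

Lemma compact_cbox a b : compact (cbox a b).
Proof.
rewrite (_ : cbox a b = [set x : X | forall i, `[a 0 i, b 0 i]%classic (x ord0 i)]).
  apply: (@rV_compact R d (fun i => `[a 0 i, b 0 i]%classic)) => i.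
  exact: segment_compact.
by apply/seteqP; split => x xab i; have := xab i; rewrite /= in_itv.
Qed.

Lemma obox_setI a b a' b' : obox a b `&` obox a' b' =
  obox (\row_i Num.max (a 0 i) (a' 0 i)) (\row_i Num.min (b 0 i) (b' 0 i)).
Proof.
apply/seteqP; split => [x [xab xab'] i|x xab].
  by rewrite !mxE gt_max lt_min; have /andP[-> ->] := xab i; have /andP[-> ->] := xab' i.
by split=> i; have := xab i; rewrite !mxE gt_max lt_min => /andP[/andP[? ?] /andP[? ?]]; apply/andP.
Qed.

Definition boxes : set (set X) := [set A | exists a b, A = obox a b].

Lemma boxes_generate : measurable `<=` <<s boxes >>.
Proof.
have [S0 SC SU] := smallest_sigma_algebra setT boxes.
apply: smallest_sub; first by split.
rewrite -bigcup_seq => A [i _ [B mB <-]] /=; rewrite setTI.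
have : (@RGenOpens.G R).-sigma.-measurable B by rewrite -RGenOpens.measurableE.
move: B {mB}; apply: smallest_sub.
  split=> [|B SB|F SF] /=; first by rewrite preimage_set0.
    by rewrite setTD preimage_setC -setTD; exact: SC.
  by rewrite preimage_bigcup; exact: SU.
move=> B [x [y ->]] /=.
(* A slab in direction [i] is exhausted by boxes whose other sides are []-n, n[]; for a given point,
   any [n] above the sum of the absolute values of its coordinates will do. *)
rewrite (_ : _ @^-1` _ = \bigcup_n
  obox (\row_j if j == i then x else - n%:R) (\row_j if j == i then y else n%:R)).
  by apply: SU => n; apply: sub_gen_smallest; eexists; eexists.
apply/seteqP; split => [z|z [n _ /(_ i)]]; rewrite /= in_itv /=; last first.
  by rewrite !mxE eqxx.
move=> xzy; exists (Num.trunc (\sum_j `|z 0 j|)).+1 => // j; rewrite !mxE.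
case: eqP => [->//|_]; rewrite -ltr_norml.
apply: le_lt_trans (truncnS_gt _); rewrite (bigD1 j)//= lerDl.
exact: sumr_ge0.
Qed.

(** Boxes with rational corners, enumerated by [pickle]; a code that does not decode to a pair of
    corners, or whose closed box leaves [D], yields the empty set. The closed box is kept inside [D]
    so that bumps on the box are test functions of [D]. *)
Lemma open_bigcup_obox D : open D -> exists F : nat -> set X,
  D = \bigcup_n F n /\
  forall n, F n = set0 \/ exists a b, F n = obox a b /\ cbox a b `<=` D.
Proof.
move=> oD; pose ra (q : 'rV[rat]_d) : X := \row_i ratr (q 0 i).
pose F n := if (unpickle n : option ('rV[rat]_d * 'rV[rat]_d)) is Some (p, q)
  then if `[< cbox (ra p) (ra q) `<=` D >] then obox (ra p) (ra q) else set0
  else set0.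
exists F; split; last first.
  move=> n; rewrite /F; case: unpickle => [[p q]|]; last by left.
  by case: asboolP => ?; [right; exists (ra p), (ra q)|left].
apply/seteqP; split => [x Dx|x [n _]]; last first.
  rewrite /F; case: unpickle => [[p q]|//]; case: asboolP => // pqD.
  by move=> /obox_cbox; exact: pqD.
have [e /= e0 eD] : exists2 e : R, 0 < e & ball x e `<=` D.
  by apply/nbhs_ballP; exact: open_nbhs_nbhs.
have /choice[p Hp] : forall i, exists q : rat, x 0 i - e < ratr q < x 0 i.
  move=> i; have [|q] := @rat_in_itvoo _ (x 0 i - e) (x 0 i); first lra.
  by rewrite in_itv /= => ?; exists q.
have /choice[q Hq] : forall i, exists q : rat, x 0 i < ratr q < x 0 i + e.
  move=> i; have [|q] := @rat_in_itvoo _ (x 0 i) (x 0 i + e); first lra.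
  by rewrite in_itv /= => ?; exists q.
exists (pickle (\row_i p i, \row_i q i)) => //; rewrite /F pickleK asboolT.
  move=> i; rewrite !mxE; have /andP[_ ->] := Hp i.
  by have /andP[-> _] := Hq i.
move=> y yb; apply: eD; split=> // i j; rewrite (ord1 i) /ball /=.
have := yb j; rewrite !mxE; have := Hp j; have := Hq j.
rewrite ltr_distlC; lra.
Qed.

Lemma open_rV_measurable D : open D -> measurable D.
Proof.
move=> /open_bigcup_obox[F [-> HF]]; apply: bigcup_measurable => n _.
have [->//|[a [b [-> _]]]] := HF n; exact: measurable_obox.
Qed.

Lemma continuous_rV_measurable D (f : X -> R) :
  open D -> (forall x, D x -> {for x, continuous f}) -> measurable_fun D f.
Proof.
move=> oD cf; have mD := open_rV_measurable oD.
apply: (measurability (@RGenOpens.G R) (RGenOpens.measurableE R)).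
move=> _ [_ [x [y ->]] <-]; apply: open_rV_measurable.
rewrite openE => z [Dz fz]; apply: filterI; first exact: open_nbhs_nbhs.
apply: (cf _ Dz); apply: open_nbhs_nbhs; split=> //.
Qed.

Lemma bounded_cbox D : bounded_set D -> exists a b, D `<=` cbox a b.
Proof.
move=> [M [Mr bM]]; pose N := Num.max M 0 + 1.
have N0 : M < N by rewrite /N; case: (leP M 0) => ?; lra.
exists (const_mx (- N)), (const_mx N) => x Dx i; rewrite !mxE -ler_norml.
apply: le_trans (bM _ N0 _ Dx); rewrite /Num.norm /= mx_normrE.
exact: (le_bigmax _ (fun ij => `|x ij.1 ij.2|) (0, i)).
Qed.

End boxes.

(** * The fundamental lemma *)

Section weak_zero.
Context (R : realType) (d : nat).
Local Notation X := 'rV[R]_d.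
Local Notation mu := (leb R d).
Implicit Types (a b x : X) (D : set X).

(** A smooth function supported in the closed box that increases to the indicator of the open box as
    [c] decreases to 0. *)
Definition bump (c : R) a b : X -> R :=
  \prod_(i < d) ((fun x : X => flat c 0 (1 * x 0 i + - a 0 i)) *
                 (fun x : X => flat c 0 (-1 * x 0 i + b 0 i))).

Lemma bumpE c a b x :
  bump c a b x = \prod_(i < d) (flat c 0 (x 0 i - a 0 i) * flat c 0 (b 0 i - x 0 i)).
Proof.
rewrite /bump fct_prodE; apply: eq_bigr => i _; rewrite !fctE.
by rewrite mul1r mulN1r addrC (addrC (- x 0 i)) addrC.
Qed.

Lemma flat0_le1 (c x : R) : 0 < c -> flat c 0 x <= 1.
Proof.
move=> c0; rewrite /flat; case: ifP => // x0.
by rewrite expr0 mul1r -expR0 ler_expR oppr_le0 mulr_ge0 ?invr_ge0// ltW.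
Qed.

Lemma bump_ge0 c a b x : 0 <= bump c a b x.
Proof. by rewrite bumpE; apply: prodr_ge0 => i _; rewrite mulr_ge0// flat_ge0. Qed.

Lemma bump_le1 c a b x : 0 < c -> bump c a b x <= 1.
Proof.
move=> c0; rewrite bumpE; apply: prodr_ile1 => i.
by rewrite mulr_ge0 ?flat_ge0//= mulr_ile1 ?flat_ge0 ?flat0_le1.
Qed.

Lemma bump_out c a b x : ~ obox a b x -> bump c a b x = 0.
Proof.
move=> /existsNP[i abi]; rewrite bumpE (bigD1 i)//= /flat !subr_gt0.
case: ifP => h1; last by rewrite !mul0r.
case: ifP => h2; last by rewrite mulr0 mul0r.
by exfalso; apply: abi; rewrite h1.
Qed.

Lemma test_function_bump D c a b : 0 < c -> cbox a b `<=` D ->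
  test_function D (bump c a b).
Proof.
move=> c0 abD; split.
  by move=> k; apply: Ck_prod => i; apply: CkM; exact: Ck_flat_coord.
exists (cbox a b); first by split => //; exact: compact_cbox.
by move=> x xab; apply: bump_out; apply: contra_not xab; exact: obox_cbox.
Qed.

Lemma cvg_bump a b x : obox a b x -> bump n.+1%:R^-1 a b x @[n --> \oo] --> (1 : R).
Proof.
move=> xab.
have F (y : R) : 0 < y -> flat n.+1%:R^-1 0 y @[n --> \oo] --> (1 : R).
  move=> y0; rewrite /flat y0.
  under eq_fun do rewrite expr0 mul1r.
  suff : expR (- (n.+1%:R^-1 * y^-1)) @[n --> \oo] --> expR (- (0 * y^-1)).
    by rewrite mul0r oppr0 expR0.
  apply: continuous_cvg; first exact: continuous_expR.
  apply: cvgN; apply: cvgMl; exact: cvg_harmonic.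
under eq_fun do rewrite bumpE.
suff : \prod_(i < d) (flat n.+1%:R^-1 0 (x 0 i - a 0 i) *
    flat n.+1%:R^-1 0 (b 0 i - x 0 i)) @[n --> \oo] --> \prod_(i < d) (1 * 1 : R).
  by rewrite [X in _ --> X]big1// => i _; rewrite mulr1.
apply: cvg_big; first exact: mul_continuous.
move=> i _; have /andP[h1 h2] := xab i.
by apply: cvgM; apply: F; rewrite subr_gt0.
Qed.

Lemma L2_subset D E u : measurable D -> measurable E -> E `<=` D -> L2 D u -> L2 E u.
Proof.
move=> mD mE ED lu; apply: sqr_integrable_L2 => //.
  exact: measurable_funS mD ED (L2_measurable mD lu).
have := integrableS mD mE ED (L2dot_integrable mD lu lu).
by congr (integrable _ _ _); apply/funext => x /=; rewrite expr2.
Qed.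

Lemma leb_obox_lty a b : (mu (obox a b) < +oo)%E.
Proof.
apply: le_lt_trans (leb_cbox_lty a b).
by rewrite le_measure ?inE//;
  [exact: measurable_obox|exact: measurable_cbox|exact: obox_cbox].
Qed.

(** Dominated convergence along the bumps with [c = 1 / (n + 1)]: they are bounded by 1, and [g] is
    integrable on the box because the box has finite measure. *)
Lemma weak_zero_obox D g a b : open D -> cbox a b `<=` D -> L2 D g ->
  (forall phi, test_function D phi -> L2dot D g phi = 0) ->
  (\int[mu]_(x in obox a b) (g x)%:E = 0)%E.
Proof.
move=> oD abD lg gphi; have mD := open_rV_measurable oD.
have mB := measurable_obox a b.
have BD : obox a b `<=` D by move=> x /obox_cbox; exact: abD.
have lgB := L2_subset mD mB BD lg.
have ig := L2_integrable mB (leb_obox_lty a b) lgB.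
have mg := measurable_int _ ig.
pose f (n : nat) (x : X) := (g x * bump n.+1%:R^-1 a b x)%:E.
have mbump n : measurable_fun (obox a b) (bump n.+1%:R^-1 a b).
  apply: measurable_funS (continuous_rV_measurable openT _) => //.
  have c0 : 0 < n.+1%:R^-1 :> R by rewrite invr_gt0.
  have [/(_ 0%N)[cb _] _] := test_function_bump c0 abD.
  by move=> x _; exact: cb.
have mf n : measurable_fun (obox a b) (f n).
  by apply/measurable_EFinP; apply: measurable_funM => //; exact/measurable_EFinP.
have ffg : {ae mu, forall x, obox a b x -> f^~ x @ \oo --> (g x)%:E}.
  apply: aeW => x xab; apply: cvg_EFin; first by apply: nearW.
  rewrite -[X in _ --> X]mulr1; apply: cvgM; first exact: cvg_cst.
  exact: cvg_bump.
have fg : {ae mu, forall x n, obox a b x -> (`|f n x| <= `|(g x)%:E|)%E}.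
  apply: aeW => x n _; rewrite lee_fin normrM ler_piMr// ger0_norm ?bump_ge0//.
  by rewrite bump_le1// invr_gt0.
have [_ _ +] := @dominated_convergence _ _ _ mu _ mB f (EFin \o g)
  (fun x => `|(g x)%:E|%E) mf mg ffg (integrable_abse ig) fg.
have f0 n : (\int[mu]_(x in obox a b) f n x = 0)%E.
  have c0 : 0 < n.+1%:R^-1 :> R by rewrite invr_gt0.
  have := gphi _ (test_function_bump c0 abD).
  have E : (\int[mu]_(x in obox a b) f n x = \int[mu]_(x in D) f n x)%E.
    rewrite integral_mkcond [RHS]integral_mkcond; apply: eq_integral => x _.
    rewrite !patchE; case: ifPn => [/set_mem xab|/negP xab].
      by rewrite ifT// inE; exact: BD.
    by case: ifP => // _; rewrite /f bump_out ?mulr0// => /mem_set.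
  rewrite /L2dot /Rintegral -/(f n) -E => fE0.
  rewrite -[LHS]fineK ?fE0//.
  apply: integrable_fin_num => //; apply: (le_integrable mB (mf n) _ ig).
  move=> x _; rewrite lee_fin normrM ler_piMr// ger0_norm ?bump_ge0//.
  by rewrite bump_le1.
under eq_fun do rewrite f0.
by move=> /(cvg_lim (@ereal_hausdorff R)) <-; rewrite lim_cst.
Qed.

(** Integrals of [g] over small boxes vanish; boxes are stable under intersection and generate the
    sigma-algebra, so by the pi-lambda theorem the integral of [g] vanishes over every measurable
    part of a box. Countably many boxes cover [D]. *)
Lemma weak_zero D g : open D -> L2 D g ->
  (forall phi, test_function D phi -> L2dot D g phi = 0) ->
  ae_in D (fun x => g x = 0).
Proof.
move=> oD lg gphi; have mD := open_rV_measurable oD.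
have [F [DF HF]] := open_bigcup_obox oD.
suff : forall n, {ae mu, forall x, F n x -> g x = 0}.
  move=> /ae_foralln; rewrite /ae_in; apply: filterS => x h.
  by rewrite {1}DF => -[n _]; exact: h.
move=> n; have [->|[a [b [-> abD]]]] := HF n; first exact: aeW.
have mB := measurable_obox a b.
have BD : obox a b `<=` D by move=> x /obox_cbox; exact: abD.
have ig := L2_integrable mB (leb_obox_lty a b) (L2_subset mD mB BD lg).
have inter A : measurable A -> mu.-integrable (obox a b `&` A) (EFin \o g).
  move=> mA; apply: (integrableS mB) => //; exact: measurableI.
(* The class is localized to one fixed box: there [g] is integrable, and the whole space belongs to
   the class because the integral over the box itself is zero. *)
pose H : set (set X) := [set A | measurable A /\ (\int[mu]_(x in obox a b `&` A) (g x)%:E = 0)%E].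
have BE A : boxes A -> H A.
  move=> [a' [b' ->]]; split; first exact: measurable_obox.
  rewrite obox_setI; apply: (weak_zero_obox oD) => //.
  move=> x xab; apply: abD => i; have := xab i.
  by rewrite !mxE ge_max le_min => /andP[/andP[-> _] /andP[-> _]].
have HB0 : (\int[mu]_(x in obox a b) (g x)%:E = 0)%E by exact: (weak_zero_obox oD).
have dH : dynkin H.
  split; first by split; [exact: measurableT|rewrite setIT].
    move=> A [mA gA]; split; first exact: measurableC.
    have := @integral_setU_EFin _ _ _ mu (obox a b `&` A) (obox a b `&` ~` A) g.
    rewrite -setIUr setUv setIT HB0 gA add0e => <- //.
    - exact: measurableI.
    - by apply: measurableI => //; exact: measurableC.
    - by have /measurable_EFinP := measurable_int _ ig.
    - apply/disj_setPS => x /= [[_ ?] [_ ?]] //.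
  move=> G tG HG; have mG k : measurable (G k) by case: (HG k).
  split; first exact: bigcup_measurable.
  rewrite setI_bigcupr integral_bigcup//.
  - by rewrite eseries0// => k _ _; case: (HG k).
  - by apply: trivIset_setIl.
  - by move=> k; exact: measurableI.
  - by rewrite -setI_bigcupr; apply: inter; exact: bigcup_measurable.
have mH : measurable `<=` H.
  move=> A /boxes_generate; apply: (lambda_system_subset _ _ BE) => //.
  - move=> _ _ [a1 [b1 ->]] [a2 [b2 ->]]; rewrite obox_setI.
    by eexists; eexists.
  - exact/dynkin_lambda_system.
have := @integral_ae_eq _ _ _ mu _ mB (cst 0%E) (EFin \o g) ig (measurable_cst _).
move=> /(_ _)/wrap[].
  move=> E EB mE; rewrite integral0.
  by have [_] := mH _ mE; rewrite setIidr.
by apply: filterS => x h xB; have [] := h xB.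
Qed.

End weak_zero.

(** * Energy forms *)

Lemma le_sqrt_mul (R : rcfType) (a b c : R) : 0 <= a -> 0 <= b ->
  c ^+ 2 <= a * b -> `|c| <= Num.sqrt a * Num.sqrt b.
Proof.
move=> a0 b0 h; rewrite -sqrtrM// -sqrtr_sqr ler_sqrt//.
by rewrite mulr_ge0.
Qed.

Lemma sum_mul_le_sqrt (R : rcfType) (I : finType) (a b : I -> R) :
  \sum_i a i * b i <= Num.sqrt (\sum_i a i ^+ 2) * Num.sqrt (\sum_i b i ^+ 2).
Proof.
have a0 : 0 <= \sum_i a i ^+ 2 by apply: sumr_ge0 => i _; exact: sqr_ge0.
have b0 : 0 <= \sum_i b i ^+ 2 by apply: sumr_ge0 => i _; exact: sqr_ge0.
apply: le_trans (ler_norm _) _; apply: le_sqrt_mul => //.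
apply: discriminant_le => // t.
rewrite mulr_sumr -sumrMnl mulr_sumr -!big_split /=.
apply: sumr_ge0 => i _; have := sqr_ge0 (a i + t * b i); congr (_ <= _); ring.
Qed.

Section L2_fields.
Context (R : realType) (d : nat) (D : set 'rV[R]_d) (mD : measurable D).
Local Notation X := 'rV[R]_d.
Local Notation mu := (leb R d).
Implicit Types (u v w k : X -> R) (p q : 'I_d -> X -> R).

(** Energy forms act on arbitrary fields rather than on gradients: the gradient of a difference
    agrees with the difference of gradients only almost everywhere, whereas fields can be subtracted
    exactly. *)
Definition L2field p := forall i, L2 D (p i).

Definition fieldnorm p : R := Num.sqrt (\sum_i L2norm D (p i) ^+ 2).

Definition wform k p q : R := \int[mu]_(x in D) (k x * \sum_i p i x * q i x).

Definition weight (m M : R) k := measurable_fun D k /\ forall x, D x -> m <= k x <= M.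

Lemma L2field_lin (a : R) p q : L2field p -> L2field q -> L2field (a *: p + q).
Proof. by move=> lp lq i; exact: (L2D (L2Z a (lp i)) (lq i)). Qed.

Lemma L2fieldB p q : L2field p -> L2field q -> L2field (p - q).
Proof. by move=> lp lq i; exact: (L2B (lp i) (lq i)). Qed.

Lemma fieldnorm_ge0 p : 0 <= fieldnorm p. Proof. exact: sqrtr_ge0. Qed.

Lemma sqr_fieldnorm p : fieldnorm p ^+ 2 = \sum_i L2norm D (p i) ^+ 2.
Proof. by rewrite sqr_sqrtr//; apply: sumr_ge0 => i _; exact: sqr_ge0. Qed.

Lemma fieldnormZ (a : R) p : L2field p -> fieldnorm (a *: p) = `|a| * fieldnorm p.
Proof.
move=> lp; rewrite /fieldnorm -sqrtr_sqr -sqrtrM ?sqr_ge0//; congr Num.sqrt.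
rewrite mulr_sumr; apply: eq_bigr => i _.
by rewrite [(a *: p) i](_ : _ = a *: p i)// (L2normZ mD)// exprMn real_normK ?num_real.
Qed.

Lemma fieldnorm_triangle p q : L2field p -> L2field q ->
  fieldnorm (p + q) <= fieldnorm p + fieldnorm q.
Proof.
move=> lp lq; rewrite -ler_sqr ?nnegrE ?addr_ge0 ?fieldnorm_ge0//.
rewrite sqrrD !sqr_fieldnorm.
have := sum_mul_le_sqrt (fun i => L2norm D (p i)) (fun i => L2norm D (q i)).
rewrite -/(fieldnorm p) -/(fieldnorm q) => h.
apply: le_trans (_ : \sum_i (L2norm D (p i) + L2norm D (q i)) ^+ 2 <= _).
  apply: ler_sum => i _; rewrite lerXn2r ?nnegrE ?addr_ge0 ?L2norm_ge0//.
  exact: (L2norm_triangle mD).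
rewrite (eq_bigr (fun i => L2norm D (p i) ^+ 2 + (L2norm D (p i) * L2norm D (q i)) *+ 2
   + L2norm D (q i) ^+ 2)); last by move=> i _; rewrite sqrrD.
rewrite !big_split /= ?sumrMnl; lra.
Qed.

Lemma fieldnorm_ae p q : L2field p -> L2field q ->
  (forall i, ae_in D (fun x => p i x = q i x)) -> fieldnorm p = fieldnorm q.
Proof.
move=> lp lq pq; congr Num.sqrt; apply: eq_bigr => i _.
by rewrite (L2norm_ae mD (lp i) (lq i) (pq i)).
Qed.

Lemma L2norm_bounded_mul k u (M : R) : measurable_fun D k ->
  (forall x, D x -> `|k x| <= M) -> 0 <= M -> L2 D u ->
  L2norm D (k \* u) <= M * L2norm D u.
Proof.
move=> mk kM M0 lu; have lku := L2_bounded_mul mD mk kM lu.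
rewrite -ler_sqr ?nnegrE ?mulr_ge0 ?L2norm_ge0// exprMn !(sqr_L2norm mD)//.
rewrite /L2dot -RintegralZl//; last exact: (L2dot_integrable mD).
apply: le_Rintegral => //; first exact: (L2dot_integrable mD).
  by have := integrableZl mD (M ^+ 2) (L2dot_integrable mD lu lu).
move=> x Dx /=; rewrite mulrACA -2!expr2 ler_wpM2r ?sqr_ge0//.
by rewrite -(real_normK (num_real (k x))) lerXn2r ?nnegrE// kM.
Qed.

Lemma Rintegral_sum (I : Type) (s : seq I) (f : I -> X -> R) :
  (forall i, mu.-integrable D (EFin \o f i)) ->
  \int[mu]_(x in D) (\sum_(i <- s) f i x) = \sum_(i <- s) \int[mu]_(x in D) f i x.
Proof.
move=> fi; elim: s => [|i s IH].
  rewrite big_nil (@eq_Rintegral _ _ _ _ _ (cst 0)); last by move=> x _; rewrite big_nil.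
  by rewrite Rintegral_cst// mul0r.
rewrite big_cons -IH -RintegralD//; first by apply: eq_Rintegral => x _; rewrite big_cons.
rewrite (_ : _ \o _ = (fun x => \sum_(i <- s) (EFin \o f i) x)%E); last first.
  by apply/funext => x /=; rewrite sumEFin.
exact: integrable_sum.
Qed.

Lemma wform_sum k p q : (forall i, L2 D (k \* p i)) -> L2field q ->
  wform k p q = \sum_i L2dot D (k \* p i) (q i).
Proof.
move=> lp lq; rewrite /wform /L2dot -Rintegral_sum.
  by apply: eq_Rintegral => x _; rewrite mulr_sumr; apply: eq_bigr => i _; rewrite /= mulrA.
by move=> i; exact: (L2dot_integrable mD (lp i) (lq i)).
Qed.

Section weighted.
Context (m M : R) (k : X -> R) (m0 : 0 < m) (wk : weight m M k).

Lemma weight_norm x : D x -> `|k x| <= M.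
Proof.
move=> Dx; have [_ /(_ x Dx)/andP[h1 h2]] := wk; by rewrite ger0_norm// (le_trans (ltW m0)).
Qed.

Lemma L2field_weight p i : L2field p -> L2 D (k \* p i).
Proof.
by move=> lp; apply: (L2_bounded_mul mD _ weight_norm) => //; case: wk.
Qed.

Lemma wformE p q : L2field p -> L2field q ->
  wform k p q = \sum_i L2dot D (k \* p i) (q i).
Proof. by move=> lp; apply: wform_sum => i; exact: L2field_weight. Qed.

Lemma wformC p q : wform k p q = wform k q p.
Proof.
apply: eq_Rintegral => x _; congr (_ * _).
by apply: eq_bigr => i _; rewrite mulrC.
Qed.

Lemma wform_linl (a : R) p p' q : L2field p -> L2field p' -> L2field q ->
  wform k (a *: p + p') q = a * wform k p q + wform k p' q.
Proof.
move=> lp lp' lq; rewrite !wformE//; last exact: L2field_lin.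
rewrite mulr_sumr -big_split /=; apply: eq_bigr => i _.
rewrite -(L2dotZl mD) ?(lq i)//; last exact: L2field_weight.
rewrite -(L2dotDl mD) ?(lq i)//; try exact: L2field_weight; last first.
  exact: (L2Z a (L2field_weight i lp)).
congr L2dot; apply/funext => x /=; rewrite !fctE /GRing.scale /=; ring.
Qed.

Lemma wformBl p p' q : L2field p -> L2field p' -> L2field q ->
  wform k (p - p') q = wform k p q - wform k p' q.
Proof.
move=> lp lp' lq; rewrite (_ : p - p' = -1 *: p' + p).
  by rewrite wform_linl// mulN1r addrC.
by rewrite scaleN1r addrC.
Qed.

Lemma wformBr p p' q : L2field p -> L2field p' -> L2field q ->
  wform k q (p - p') = wform k q p - wform k q p'.
Proof. by move=> *; rewrite !(wformC q) wformBl. Qed.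

Lemma wform_coercive p : L2field p -> m * fieldnorm p ^+ 2 <= wform k p p.
Proof.
move=> lp; rewrite sqr_fieldnorm wformE// mulr_sumr; apply: ler_sum => i _.
rewrite (sqr_L2norm mD) ?(lp i)// /L2dot -RintegralZl//; last exact: (L2dot_integrable mD).
apply: le_Rintegral => //.
- by have := integrableZl mD m (L2dot_integrable mD (lp i) (lp i)).
- by apply: (L2dot_integrable mD) => //; exact: L2field_weight.
- move=> x Dx; have [_ /(_ x Dx)/andP[h1 h2]] := wk.
  by rewrite /= -mulrA ler_wpM2r// -expr2 sqr_ge0.
Qed.

Lemma wform_ge0 p : L2field p -> 0 <= wform k p p.
Proof.
move=> lp; apply: le_trans (wform_coercive lp).
by rewrite mulr_ge0 ?sqr_ge0// ltW.
Qed.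

Lemma wform_le_sqrt p q : L2field p -> L2field q ->
  `|wform k p q| <= Num.sqrt (wform k p p) * Num.sqrt (wform k q q).
Proof.
move=> lp lq; apply: le_sqrt_mul; try exact: wform_ge0.
apply: discriminant_le; first exact: wform_ge0.
move=> t; have ltq := L2field_lin t lq lp; have := wform_ge0 ltq.
rewrite wform_linl// (wformC q) (wformC p) !wform_linl//.
rewrite (wformC q p); congr (_ <= _); ring.
Qed.

(** Here [k'] may change sign, as the difference of two coefficients does, so Cauchy-Schwarz is
    applied to each component and then to the sum over components instead of to an energy form. *)
Lemma wform_le (M' : R) (k' : X -> R) p q : measurable_fun D k' ->
  (forall x, D x -> `|k' x| <= M') -> 0 <= M' -> L2field p -> L2field q ->
  `|\int[mu]_(x in D) (k' x * \sum_i p i x * q i x)| <=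
  M' * fieldnorm p * fieldnorm q.
Proof.
move=> mk' k'M M'0 lp lq.
have lkp i : L2 D (k' \* p i) by exact: (L2_bounded_mul mD mk' k'M).
rewrite -/(wform k' p q) (wform_sum lkp lq).
apply: le_trans (ler_norm_sum _ _ _) _.
have := sum_mul_le_sqrt (fun i => L2norm D (p i)) (fun i => L2norm D (q i)).
rewrite -/(fieldnorm p) -/(fieldnorm q) -mulrA => h.
apply: le_trans (ler_wpM2l M'0 h); rewrite mulr_sumr; apply: ler_sum => i _.
apply: le_trans (L2dot_le mD (lkp i) (lq i)) _; rewrite mulrA ler_wpM2r ?L2norm_ge0//.
exact: L2norm_bounded_mul.
Qed.

End weighted.
End L2_fields.

(** * Sobolev spaces *)

Lemma sqrt_minkowski (R : rcfType) (x y z w : R) :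
  Num.sqrt ((x + z) ^+ 2 + (y + w) ^+ 2) <=
  Num.sqrt (x ^+ 2 + y ^+ 2) + Num.sqrt (z ^+ 2 + w ^+ 2).
Proof.
have ge0 (s t : R) : 0 <= s ^+ 2 + t ^+ 2 by rewrite addr_ge0 ?sqr_ge0.
rewrite -ler_sqr ?nnegrE ?addr_ge0 ?sqrtr_ge0// (sqr_sqrtr (ge0 _ _)).
have := le_sqrt_mul (ge0 x y) (ge0 z w) (_ : (x * z + y * w) ^+ 2 <= _).
have h : (x * z + y * w) ^+ 2 <= (x ^+ 2 + y ^+ 2) * (z ^+ 2 + w ^+ 2).
  (* Lagrange's identity: this square is the difference of the two sides. *)
  have := sqr_ge0 (x * w - y * z); nra.
move=> /(_ h) /(le_trans (ler_norm _)) => h2.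
rewrite [X in _ <= X]sqrrD !(sqr_sqrtr (ge0 _ _)); lra.
Qed.

Local Opaque L2norm L2dot.

Section sobolev.
Context (R : realType) (d : nat) (D : set 'rV[R]_d).
Context (oD : open D) (bD : bounded_set D).
Local Notation X := 'rV[R]_d.
Local Notation mu := (leb R d).
Local Notation mD := (open_rV_measurable oD).
Implicit Types (u v w g phi : X -> R) (a : R) (i : 'I_d).

Lemma leb_bounded_lty : (mu D < +oo)%E.
Proof.
have [a [b Dab]] := bounded_cbox bD.
apply: le_lt_trans (leb_cbox_lty a b).
by rewrite le_measure ?inE//; [exact: mD|exact: measurable_cbox].
Qed.

Lemma continuous_bounded f : continuous (f : X -> R) ->
  exists M, forall x, D x -> `|f x| <= M.
Proof.
move=> cf; have [a [b Dab]] := bounded_cbox bD.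
have cK : compact (f @` cbox a b).
  by apply: continuous_compact; [exact: continuous_subspaceT|exact: compact_cbox].
have [M [_ HM]] := compact_bounded cK.
exists (M + 1) => x Dx; apply: (HM (M + 1)); first by rewrite ltrDl.
by exists x => //; exact: Dab.
Qed.

Lemma continuous_L2 f : continuous (f : X -> R) -> L2 D f.
Proof.
move=> cf; have [M fM] := continuous_bounded cf.
apply: (L2_bounded mD leb_bounded_lty _ fM).
by apply: continuous_rV_measurable => // x _; exact: cf.
Qed.

Lemma test_function_L2 phi : test_function D phi -> L2 D phi.
Proof. by move=> [/(_ 0%N)[cphi _] _]; exact: continuous_L2. Qed.

Lemma test_function_partial_L2 phi i : test_function D phi -> L2 D (partial i phi).
Proof.
by move=> [/(_ 1%N)[_ /(_ i)[_ [cphi _]]] _]; exact: continuous_L2.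
Qed.

Lemma test_functionD phi psi : test_function D phi -> test_function D psi ->
  test_function D (phi + psi).
Proof.
move=> [cphi [K [cK KD] phi0]] [cpsi [K' [cK' K'D] psi0]]; split.
  by move=> k; exact: CkD.
exists (K `|` K'); first by split; [exact: compactU|move=> x []; [exact: KD|exact: K'D]].
by move=> x /not_orP[h h']; rewrite !fctE phi0// psi0// addr0.
Qed.

Lemma test_functionZ a phi : test_function D phi -> test_function D (a *: phi).
Proof.
move=> [cphi [K [cK KD] phi0]]; split; first by move=> k; exact: CkZ.
by exists K => // x h; rewrite !fctE phi0// scaler0.
Qed.

(** This makes the representative picked by [wpartial] meaningful: a weak derivative found by hand
    must agree a.e. with the chosen one, and linearity of [wpartial] follows. *)
Lemma weak_partial_unique i u g g' : is_weak_partial D i u g ->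
  is_weak_partial D i u g' -> ae_in D (fun x => g x = g' x).
Proof.
move=> [lg hg] [lg' hg'].
have : ae_in D (fun x => (g - g') x = 0).
  apply: (weak_zero oD (L2B lg lg')) => phi tphi.
  have lphi := test_function_L2 tphi.
  rewrite (L2dotBl mD)//; apply/eqP; rewrite subr_eq0; apply/eqP.
  by apply: oppr_inj; rewrite -hg// -hg'.
by apply: ae_in_imp => x _ /eqP; rewrite !fctE subr_eq0 => /eqP.
Qed.

Lemma wpartialP i u : H1 D u -> is_weak_partial D i u (wpartial D i u).
Proof. by move=> [_ /(_ i)[g hg]]; exact: (xgetPex (fun=> 0) (ex_intro _ g hg)). Qed.

Lemma wpartial_L2 u : H1 D u -> L2field D (fun i => wpartial D i u).
Proof. by move=> Hu i; have [] := wpartialP i Hu. Qed.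

Lemma weak_partial_lin a i u v g g' : L2 D u -> L2 D v ->
  is_weak_partial D i u g -> is_weak_partial D i v g' ->
  is_weak_partial D i (a *: u + v) (a *: g + g').
Proof.
move=> lu lv [lg hg] [lg' hg']; split; first exact: L2D (L2Z a lg) lg'.
move=> phi tphi; have lp := test_function_L2 tphi.
have lpi := test_function_partial_L2 i tphi.
rewrite !(L2dotDl mD)//; try exact: L2Z.
by rewrite !(L2dotZl mD)// hg// hg'//; ring.
Qed.

Lemma H1_lin a u v : H1 D u -> H1 D v -> H1 D (a *: u + v).
Proof.
move=> Hu Hv; split; first by apply: L2D (L2Z a _) _; [case: Hu|case: Hv].
move=> i; exists (a *: wpartial D i u + wpartial D i v).
by apply: weak_partial_lin; try exact: wpartialP; [case: Hu|case: Hv].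
Qed.

Lemma wpartial_lin a i u v : H1 D u -> H1 D v ->
  ae_in D (fun x => wpartial D i (a *: u + v) x =
                    (a *: wpartial D i u + wpartial D i v) x).
Proof.
move=> Hu Hv; apply: (@weak_partial_unique i (a *: u + v)).
  exact/wpartialP/H1_lin.
by apply: weak_partial_lin; try exact: wpartialP; [case: Hu|case: Hv].
Qed.

Lemma H1semiE u : H1semi D u = fieldnorm D (fun i => wpartial D i u).
Proof. by []. Qed.

Lemma H1semi_ge0 u : 0 <= H1semi D u. Proof. exact: sqrtr_ge0. Qed.

Lemma H1norm_ge0 u : 0 <= H1norm D u. Proof. exact: sqrtr_ge0. Qed.

Lemma sqr_H1norm u : H1norm D u ^+ 2 = L2norm D u ^+ 2 + H1semi D u ^+ 2.
Proof. by rewrite /H1norm sqr_sqrtr// addr_ge0// sqr_ge0. Qed.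

Lemma H1semi_lin a u v : H1 D u -> H1 D v ->
  H1semi D (a *: u + v) =
  fieldnorm D (a *: (fun i => wpartial D i u) + (fun i => wpartial D i v)).
Proof.
move=> Hu Hv; rewrite H1semiE; apply: (fieldnorm_ae mD).
- exact: wpartial_L2 (H1_lin a Hu Hv).
- by apply: L2field_lin; exact: wpartial_L2.
- by move=> i; exact: wpartial_lin.
Qed.

Lemma H1_0 : H1 D 0.
Proof.
split; first exact: (L2_0 mD); move=> i; exists 0; split; first exact: (L2_0 mD).
by move=> phi _; rewrite !(L2dot0l mD) oppr0.
Qed.

Lemma H1D u v : H1 D u -> H1 D v -> H1 D (u + v).
Proof. by move=> Hu Hv; rewrite -[u]scale1r; exact: H1_lin. Qed.

Lemma H1Z a u : H1 D u -> H1 D (a *: u).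
Proof. by move=> Hu; rewrite -[_ *: _]addr0; exact: H1_lin H1_0. Qed.

Lemma H1semi_triangle u v : H1 D u -> H1 D v ->
  H1semi D (u + v) <= H1semi D u + H1semi D v.
Proof.
move=> Hu Hv; rewrite -[u in X in X <= _]scale1r H1semi_lin// scale1r.
by apply: (fieldnorm_triangle mD); exact: wpartial_L2.
Qed.

Lemma wpartial_0 i : ae_in D (fun x => wpartial D i (0 : X -> R) x = 0).
Proof.
apply: (@weak_partial_unique i 0 _ 0); first exact/wpartialP/H1_0.
split; first exact: (L2_0 mD).
by move=> phi _; rewrite !(L2dot0l mD) oppr0.
Qed.

Lemma H1semiZ a u : H1 D u -> H1semi D (a *: u) = `|a| * H1semi D u.
Proof.
move=> Hu; have lu := wpartial_L2 Hu.
rewrite -[a *: u]addr0 H1semi_lin//; last exact: H1_0.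
rewrite [in RHS](_ : H1semi D u = fieldnorm D (fun i => wpartial D i u))//.
rewrite -(fieldnormZ mD)//.
apply: (fieldnorm_ae mD).
- by apply: L2field_lin => //; exact: wpartial_L2 H1_0.
- by move=> i; exact: (L2Z a (lu i)).
- by move=> i; apply: ae_in_imp (wpartial_0 i) => x _ h; rewrite !fctE h addr0.
Qed.

Lemma H1norm_triangle u v : H1 D u -> H1 D v ->
  H1norm D (u + v) <= H1norm D u + H1norm D v.
Proof.
move=> Hu Hv; apply: le_trans (sqrt_minkowski _ _ _ _).
rewrite /H1norm ler_sqrt ?addr_ge0 ?sqr_ge0// lerD// lerXn2r ?nnegrE ?addr_ge0
  ?L2norm_ge0 ?H1semi_ge0//; last exact: H1semi_triangle.
by apply: (L2norm_triangle mD); [case: Hu|case: Hv].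
Qed.

Lemma H1normZ a u : H1 D u -> H1norm D (a *: u) = `|a| * H1norm D u.
Proof.
move=> Hu; rewrite /H1norm H1semiZ// (L2normZ mD); last by case: Hu.
by rewrite !exprMn -mulrDr sqrtrM ?sqr_ge0// sqrtr_sqr normr_id.
Qed.

Lemma H1semi_le_H1norm u : H1semi D u <= H1norm D u.
Proof.
rewrite -[X in X <= _]ger0_norm ?H1semi_ge0// -sqrtr_sqr /H1norm.
by rewrite ler_sqrt ?addr_ge0 ?sqr_ge0// lerDr sqr_ge0.
Qed.

Lemma is_weak_partial_ae i u u' : L2 D u -> L2 D u' ->
  ae_in D (fun x => u x = u' x) ->
  is_weak_partial D i u = is_weak_partial D i u'.
Proof.
move=> lu lu' uu'; apply/funext => g; apply/propext.
have E phi : test_function D phi ->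
    L2dot D u (partial i phi) = L2dot D u' (partial i phi).
  by move=> tphi; apply: (L2dot_ae mD) => //; exact: test_function_partial_L2.
by split=> -[lg hg]; split=> // phi tphi; rewrite -hg// E.
Qed.

(** The conclusion is an equality of functions, not one a.e.: both arguments have the same set of
    weak derivatives, and the choice made by [xget] depends on that set only. *)
Lemma wpartial_ae i u u' : L2 D u -> L2 D u' ->
  ae_in D (fun x => u x = u' x) -> wpartial D i u = wpartial D i u'.
Proof. by move=> lu lu' uu'; rewrite /wpartial (is_weak_partial_ae i lu lu' uu'). Qed.

Lemma H1_ae u u' : L2 D u -> L2 D u' -> ae_in D (fun x => u x = u' x) ->
  H1 D u -> H1 D u'.
Proof.
move=> lu lu' uu' [_ Hu]; split=> // i; have [g hg] := Hu i.
by exists g; rewrite -(is_weak_partial_ae i lu lu' uu').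
Qed.

Lemma H1semi_ae u u' : L2 D u -> L2 D u' -> ae_in D (fun x => u x = u' x) ->
  H1semi D u = H1semi D u'.
Proof.
move=> lu lu' uu'; rewrite /H1semi; congr Num.sqrt; apply: eq_bigr => i _.
by rewrite (wpartial_ae i lu lu' uu').
Qed.

Lemma H1norm_ae u u' : L2 D u -> L2 D u' -> ae_in D (fun x => u x = u' x) ->
  H1norm D u = H1norm D u'.
Proof.
by move=> lu lu' uu'; rewrite /H1norm (H1semi_ae lu lu' uu') (L2norm_ae mD lu lu' uu').
Qed.

Lemma H10_L2 u : H10 D u -> L2 D u. Proof. by case=> -[]. Qed.

Lemma H10_ae u u' : L2 D u' -> ae_in D (fun x => u x = u' x) ->
  H10 D u -> H10 D u'.
Proof.
move=> lu' uu' [Hu hu]; have lu : L2 D u by case: Hu.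
split; first exact: H1_ae lu lu' uu' Hu.
move=> e e0; have [phi [tphi Hphi] h] := hu _ e0; exists phi; first by split.
have lphi : L2 D phi by case: Hphi.
rewrite -(H1norm_ae (L2B lu lphi) (L2B lu' lphi)); first exact: h.
by apply: ae_in_imp uu' => x _; rewrite !fctE => ->.
Qed.

Lemma H10D u v : H10 D u -> H10 D v -> H10 D (u + v).
Proof.
move=> [Hu hu] [Hv hv]; split; first exact: H1D.
move=> e e0; have e20 : 0 < e / 2 by rewrite divr_gt0.
have [phi [tphi Hphi] h] := hu _ e20; have [psi [tpsi Hpsi] h'] := hv _ e20.
exists (phi + psi); first by split; [exact: test_functionD|exact: H1D].
have HB w w' : H1 D w -> H1 D w' -> H1 D (w - w').
  by move=> Hw Hw'; apply: H1D => //; rewrite -scaleN1r; exact: H1Z.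
rewrite [_ \- _](_ : _ = (u - phi) + (v - psi)).
  apply: le_lt_trans (H1norm_triangle (HB _ _ Hu Hphi) (HB _ _ Hv Hpsi)) _.
  by rewrite [e]splitr; exact: ltrD h h'.
by rewrite addrACA -opprD.
Qed.

Lemma H10Z a u : H10 D u -> H10 D (a *: u).
Proof.
move=> [Hu hu]; split; first exact: H1Z.
move=> e e0; have e20 : 0 < e / (`|a| + 1) by rewrite divr_gt0// ltr_wpDl.
have [phi [tphi Hphi] h] := hu _ e20.
exists (a *: phi); first by split; [exact: test_functionZ|exact: H1Z].
have HB : H1 D (u - phi).
  by apply: H1D => //; rewrite -scaleN1r; exact: H1Z.
rewrite [_ \- _](_ : _ = a *: (u - phi)); last by rewrite scalerBr.
rewrite H1normZ//; move: h; rewrite ltr_pdivlMr ?ltr_wpDl// => h.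
apply: le_lt_trans h; rewrite mulrC ler_wpM2l ?H1norm_ge0//.
by rewrite lerDl.
Qed.

Lemma H10_sum (I : Type) (s : seq I) (f : I -> X -> R) :
  (forall j, H10 D (f j)) -> H10 D 0 -> H10 D (\sum_(j <- s) f j).
Proof.
move=> Hf H0; elim: s => [|j s IH]; first by rewrite big_nil.
by rewrite big_cons; exact: H10D (Hf j) IH.
Qed.

Lemma test_function0 : test_function D (0 : X -> R).
Proof.
split; first by move=> k; exact: (Ck_cst d k 0).
by exists set0; [split => //; exact: compact0|].
Qed.

Lemma H10_0 : H10 D 0.
Proof.
split; first exact: H1_0.
move=> e e0; exists 0; first by split; [exact: test_function0|exact: H1_0].
rewrite [_ \- _](_ : _ = 0 *: (0 : X -> R)); last by rewrite scale0r; exact: subrr.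
by rewrite H1normZ; [rewrite normr0 mul0r|exact: H1_0].
Qed.

Lemma subspace_H10 (Y : set (X -> R)) : finite_dim_subspace D (H10 D) Y -> Y `<=` H10 D.
Proof.
move=> [m [b [Hb ->]]] u [lu [c uc]].
apply: (@H10_ae (\sum_(j < m) c j *: b j)) => //.
  by apply: ae_in_imp uc => x _ ->; rewrite fct_sumE; apply: eq_bigr.
by apply: H10_sum; [move=> j; exact: H10Z|exact: H10_0].
Qed.

(** A vanishing seminorm would make the quotient [+oo], contradicting that the supremum is a real
    number. *)
Lemma friedrichs_ratio (CD : R) w : friedrichs D = CD%:E -> H10 D w ->
  ~ ae_in D (fun x => w x = 0) ->
  [/\ 0 < L2norm D w, 0 < H1semi D w & L2norm D w <= CD * H1semi D w].
Proof.
move=> hCD Hw w0; have lw := H10_L2 Hw.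
have wp : 0 < L2norm D w.
  rewrite lt_neqAle L2norm_ge0 andbT eq_sym; apply/eqP => /(L2norm_eq0 mD lw).
  exact: w0.
have : ((L2norm D w)%:E / (H1semi D w)%:E <= CD%:E)%E.
  by rewrite -hCD; apply: ereal_sup_ubound; exists w.
have := H1semi_ge0 w; rewrite le_eqVlt => /predU1P[<-|s0].
  by rewrite inve0 mulry gtr0_sg// mul1e leye_eq.
by rewrite inver gt_eqF// -EFinM lee_fin ler_pdivrMr.
Qed.

(** If [CD] were not positive, no function of H^1_0(D) could be nonzero, and the supremum over the
    empty set would be [-oo] instead of a real number. *)
Lemma friedrichs_gt0 (CD : R) : friedrichs D = CD%:E -> 0 < CD.
Proof.
move=> hCD; apply: contrapT => /negP; rewrite -leNgt => CD0.
suff : friedrichs D = -oo%E by rewrite hCD.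
apply/ereal_sup_ninfty => _ [w [Hw w0] <-].
have [wp s0 h] := friedrichs_ratio hCD Hw w0.
by have := lt_le_trans wp h; rewrite pmulr_lgt0// ltNge CD0.
Qed.

Lemma friedrichs_le (CD : R) v : friedrichs D = CD%:E -> H10 D v ->
  L2norm D v <= CD * H1semi D v.
Proof.
move=> hCD Hv; have lv := H10_L2 Hv.
have [v0|v0] := pselect (ae_in D (fun x => v x = 0)).
  by rewrite ((L2norm_eq0 mD lv).2 v0) mulr_ge0 ?H1semi_ge0// ltW// friedrichs_gt0.
by have [_ _ h] := friedrichs_ratio hCD Hv v0.
Qed.

Lemma H1semiB u v : H1 D u -> H1 D v ->
  H1semi D (u - v) = fieldnorm D ((fun i => wpartial D i u) - (fun i => wpartial D i v)).
Proof.
move=> Hu Hv; rewrite (_ : u - v = -1 *: v + u); last by rewrite scaleN1r addrC.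
by rewrite H1semi_lin// scaleN1r addrC.
Qed.

End sobolev.

(** * Galerkin solution operators *)

Lemma sqrt_le_mul (R : rcfType) (x a f : R) : 0 <= a -> 0 <= f ->
  x <= a * f * f -> Num.sqrt x <= Num.sqrt a * f.
Proof.
move=> a0 f0 h; rewrite -[X in _ <= _ * X](ger0_norm f0) -sqrtr_sqr -sqrtrM//.
by rewrite ler_wsqrtr// expr2 mulrA.
Qed.

Local Opaque H1semi H1norm wpartial fieldnorm.

Section galerkin.
Context (R : realType) (d : nat) (D : set 'rV[R]_d).
Context (oD : open D) (bD : bounded_set D).
Context (CD : R) (hCD : friedrichs D = CD%:E).
Context (kmin kmax : R) (kmin0 : 0 < kmin) (kmax0 : 0 < kmax).
Local Notation X := 'rV[R]_d.
Local Notation mu := (leb R d).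
Local Notation mD := (open_rV_measurable oD).
Local Notation grad u := (fun i => wpartial D i u).
Implicit Types (u v w g k : X -> R) (a : R) (Y : set (X -> R)).

(** With [Y = H10 D] this is the exact solution operator, so a bound proved for general [Y] serves
    both [S] and [S_h]. *)
Definition galerkin_operator Y k (T : (X -> R) -> X -> R) :=
  forall u, L2 D u -> is_galerkin_solution D Y k u (T u).

Lemma galerkin_L2 Y k T u : Y `<=` H10 D -> galerkin_operator Y k T -> L2 D u ->
  L2 D (T u).
Proof. by move=> YH ST /ST[/YH] /H10_L2. Qed.

Lemma galerkin_grad_L2 Y k T u : Y `<=` H10 D -> galerkin_operator Y k T -> L2 D u ->
  L2field D (grad (T u)).
Proof. by move=> YH ST /ST[/YH [Hy _] _]; exact: wpartial_L2. Qed.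

Lemma galerkinE Y k T u v : galerkin_operator Y k T -> L2 D u -> Y v ->
  wform D k (grad (T u)) (grad v) = L2dot D u v.
Proof. by move=> ST /ST[_]; exact. Qed.

(** Both sides are the energy product of [T u] and [T g], which is symmetric. *)
Lemma galerkin_sym Y k T u g : galerkin_operator Y k T -> L2 D u -> L2 D g ->
  L2dot D (T u) g = L2dot D u (T g).
Proof.
move=> ST lu lg; rewrite L2dotC -(galerkinE ST lg (proj1 (ST _ lu))).
by rewrite -(galerkinE ST lu (proj1 (ST _ lg))) wformC.
Qed.

(** Testing the equation with the solution itself, then coercivity and Friedrichs' inequality, and
    division by the seminorm; hence the separate case where it vanishes. *)
Lemma galerkin_H1semi Y k T u : Y `<=` H10 D -> weight D kmin kmax k ->
  galerkin_operator Y k T -> L2 D u ->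
  H1semi D (T u) <= CD / kmin * L2norm D u.
Proof.
move=> YH wk ST lu; have [YT _] := ST _ lu; have lT := galerkin_L2 YH ST lu.
have lG := galerkin_grad_L2 YH ST lu.
have CD0 := friedrichs_gt0 oD hCD.
have h1 := wform_coercive mD kmin0 wk lG.
have {h1} : kmin * H1semi D (T u) ^+ 2 <= L2norm D u * (CD * H1semi D (T u)).
  apply: (le_trans h1); rewrite (galerkinE ST lu YT).
  apply: (le_trans (L2dot_ler mD lu lT)); rewrite ler_wpM2l ?L2norm_ge0//.
  exact: (friedrichs_le oD hCD (YH _ YT)).
have := H1semi_ge0 D (T u); rewrite le_eqVlt => /predU1P[<- _|s0].
  by rewrite mulr_ge0 ?L2norm_ge0// divr_ge0// ltW.
rewrite expr2 !mulrA ler_pM2r// => h.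
by rewrite mulrAC ler_pdivlMr// mulrC (mulrC CD).
Qed.

Lemma galerkin_L2norm Y k T u : Y `<=` H10 D -> weight D kmin kmax k ->
  galerkin_operator Y k T -> L2 D u ->
  L2norm D (T u) <= CD ^+ 2 / kmin * L2norm D u.
Proof.
move=> YH wk ST lu; have [YT _] := ST _ lu.
apply: le_trans (friedrichs_le oD hCD (YH _ YT)) _.
rewrite expr2 -!mulrA ler_wpM2l ?(ltW (friedrichs_gt0 oD hCD))// mulrA.
exact: galerkin_H1semi wk ST lu.
Qed.

(** [T] is an arbitrary selection of solutions. Pairing with any [g] and moving [T] onto [g] by
    symmetry turns the claim into linearity of the inner product in the data. *)
Lemma galerkin_lin Y k T a u v : Y `<=` H10 D -> galerkin_operator Y k T ->
  L2 D u -> L2 D v ->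
  ae_in D (fun x => T (a *: u + v) x = (a *: T u + T v) x).
Proof.
move=> YH ST lu lv; have lT w : L2 D w -> L2 D (T w) by exact: galerkin_L2 YH ST.
have luv := L2D (L2Z a lu) lv; have lTuv := L2D (L2Z a (lT _ lu)) (lT _ lv).
apply: (L2norm_sub_eq0 mD (lT _ luv) lTuv).
apply/eqP; rewrite eq_le L2norm_ge0 andbT.
apply: (L2norm_le_dual mD (L2B (lT _ luv) lTuv)) => // g lg; rewrite mul0r.
rewrite (L2dotBl mD)//; last exact: lT.
rewrite (L2dotDl mD)//; [|exact: (L2Z a (lT _ lu))|exact: lT].
rewrite (L2dotZl mD)//; last exact: lT.
rewrite !(galerkin_sym ST)// (L2dotDl mD)//; [|exact: L2Z|exact: lT].
by rewrite (L2dotZl mD)//; [rewrite subrr|exact: lT].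
Qed.

(** Paired with [g], the difference equals the integral of [(k' - k) grad (T' u) . grad (T g)]. Only
    the sup norm of [k - k'] on [D] enters, and each gradient contributes a factor [CD / kmin]. *)
Lemma galerkin_lipschitz Y k k' T T' u (eta : R) : Y `<=` H10 D ->
  weight D kmin kmax k -> weight D kmin kmax k' ->
  galerkin_operator Y k T -> galerkin_operator Y k' T' ->
  (forall x, D x -> `|k x - k' x| <= eta) -> 0 <= eta -> L2 D u ->
  L2norm D (T u - T' u) <= eta * (CD / kmin) ^+ 2 * L2norm D u.
Proof.
move=> YH wk wk' ST ST' kk' eta0 lu.
have CD0 := friedrichs_gt0 oD hCD.
have lT := galerkin_L2 YH ST lu; have lT' := galerkin_L2 YH ST' lu.
apply: (L2norm_le_dual mD (L2B lT lT')).
  by rewrite mulr_ge0 ?L2norm_ge0// mulr_ge0 ?sqr_ge0.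
move=> g lg; rewrite (L2dotBl mD)//.
have [Yg _] := ST _ lg; have [Yu' _] := ST' _ lu.
have -> : L2dot D (T u) g = wform D k' (grad (T' u)) (grad (T g)).
  by rewrite (galerkinE ST' lu Yg) (galerkin_sym ST).
have -> : L2dot D (T' u) g = wform D k (grad (T' u)) (grad (T g)).
  by rewrite wformC (galerkinE ST lg Yu') L2dotC.
have lg1 := galerkin_grad_L2 YH ST lg; have lu1 := galerkin_grad_L2 YH ST' lu.
have [mk _] := wk; have [mk' _] := wk'.
have -> : wform D k' (grad (T' u)) (grad (T g)) - wform D k (grad (T' u)) (grad (T g)) =
   \int[mu]_(x in D) ((k' \- k) x * \sum_i wpartial D i (T' u) x * wpartial D i (T g) x).
  rewrite (wformE mD kmin0 wk lu1 lg1) (wformE mD kmin0 wk' lu1 lg1) -sumrB.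
  have mkk : measurable_fun D (k' \- k) by exact: measurable_funB.
  have lkk i : L2 D ((k' \- k) \* wpartial D i (T' u)).
    by apply: (L2_bounded_mul mD mkk _ (lu1 i)) => x Dx; rewrite /= distrC; exact: kk'.
  have lk i := L2field_weight mD kmin0 wk i lu1.
  have lk' i := L2field_weight mD kmin0 wk' i lu1.
  transitivity (\sum_i L2dot D ((k' \- k) \* wpartial D i (T' u)) (wpartial D i (T g))).
    apply: eq_bigr => i _; rewrite -(L2dotBl mD); [|exact: lk'|exact: lk|exact: lg1].
    by congr L2dot; apply/funext => x; rewrite !fctE /= mulrBl.
  exact: (esym (wform_sum mD lkk lg1)).
have mkk : measurable_fun D (k' \- k) by exact: measurable_funB.
apply: le_trans (ler_norm _) _.
apply: (le_trans (wform_le mD mkk _ eta0 lu1 lg1)).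
  by move=> x Dx; rewrite /= distrC; exact: kk'.
have h1 := galerkin_H1semi YH wk' ST' lu; have h2 := galerkin_H1semi YH wk ST lg.
have h := ler_pM (fieldnorm_ge0 D _) (fieldnorm_ge0 D _) h1 h2.
rewrite -mulrA; apply: le_trans (ler_wpM2l eta0 h) _.
by rewrite le_eqVlt; apply/orP; left; apply/eqP; ring.
Qed.

Section discretization.
Context (Yh : set (X -> R)) (YhH : Yh `<=` H10 D) (k : X -> R) (wk : weight D kmin kmax k).
Context (S Sh : (X -> R) -> X -> R).
Context (HS : galerkin_operator (H10 D) k S) (HSh : galerkin_operator Yh k Sh).

Definition energy_error u : R :=
  Num.sqrt (wform D k (grad (S u) - grad (Sh u)) (grad (S u) - grad (Sh u))).

(** Galerkin orthogonality allows the discrete solution for [g] to be subtracted in the second slot,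
    so the error paired with data becomes a product of two errors. *)
Lemma galerkin_error_dot u g : L2 D u -> L2 D g ->
  L2dot D (S u - Sh u) g =
  wform D k (grad (S u) - grad (Sh u)) (grad (S g) - grad (Sh g)).
Proof.
move=> lu lg; have HH : H10 D `<=` H10 D by [].
have lSu := galerkin_grad_L2 HH HS lu; have lSg := galerkin_grad_L2 HH HS lg.
have lShu := galerkin_grad_L2 YhH HSh lu; have lShg := galerkin_grad_L2 YhH HSh lg.
have [HSu _] := HS lu; have [HSg _] := HS lg.
have [YSu _] := HSh lu; have [YSg _] := HSh lg.
have lSB := L2fieldB lSg lShg.
rewrite (wformBl mD kmin0 wk lSu lShu lSB).
rewrite !(wformBr mD kmin0 wk)//.
rewrite (galerkinE HS lu HSg) (galerkinE HS lu (YhH YSg)) (galerkinE HSh lu YSg).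
rewrite wformC (galerkinE HS lg (YhH YSu)) (L2dotBl mD); last 3 first.
- exact: galerkin_L2 HH HS lu.
- exact: galerkin_L2 YhH HSh lu.
- by [].
by rewrite (galerkin_sym HS lu lg) (L2dotC _ g (Sh u)); ring.
Qed.

(** Céa's lemma in the energy norm: the error is orthogonal to [Yh], so in one slot [Sh u] may be
    replaced by any [w]. Measuring in the energy norm costs only the factor [sqrt kmax]. *)
Lemma energy_error_le u w : L2 D u -> Yh w ->
  energy_error u <= Num.sqrt kmax * H1semi D (S u - w).
Proof.
move=> lu Yw; have HH : H10 D `<=` H10 D by [].
have lSu := galerkin_grad_L2 HH HS lu; have lShu := galerkin_grad_L2 YhH HSh lu.
have [HSu _] := HS lu; have [YSu _] := HSh lu.
have lw : L2field D (grad w) by apply: wpartial_L2; case: (YhH Yw).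
have lSB := L2fieldB lSu lShu; have lSw := L2fieldB lSu lw.
have E : wform D k (grad (S u) - grad (Sh u)) (grad (S u) - grad (Sh u)) =
         wform D k (grad (S u) - grad (Sh u)) (grad (S u) - grad w).
  rewrite (wformBr mD kmin0 wk lSu lShu lSB) (wformBr mD kmin0 wk lSu lw lSB).
  have orth v : Yh v -> wform D k (grad (S u) - grad (Sh u)) (grad v) = 0.
    move=> Yv; have lv : L2field D (grad v) by apply: wpartial_L2; case: (YhH Yv).
    rewrite (wformBl mD kmin0 wk lSu lShu lv) (galerkinE HS lu (YhH Yv)).
    by rewrite (galerkinE HSh lu Yv) subrr.
  by rewrite (orth _ YSu) (orth _ Yw).
have e0 := wform_ge0 mD kmin0 wk lSB.
have le1 : wform D k (grad (S u) - grad (Sh u)) (grad (S u) - grad (Sh u)) <=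
    energy_error u * (Num.sqrt kmax * H1semi D (S u - w)).
  rewrite E; apply: le_trans (ler_norm _) _.
  apply: le_trans (wform_le_sqrt mD kmin0 wk lSB lSw) _.
  apply: ler_wpM2l; first exact: sqrtr_ge0.
  rewrite (H1semiB oD bD (proj1 HSu) (proj1 (YhH Yw))).
  have [mk _] := wk.
  have := wform_le mD mk (weight_norm kmin0 wk) (ltW kmax0) lSw lSw.
  move=> /(le_trans (ler_norm _)) h.
  have f0 := fieldnorm_ge0 D (grad (S u) - grad w).
  exact: sqrt_le_mul (ltW kmax0) f0 h.
have := sqrtr_ge0 (wform D k (grad (S u) - grad (Sh u)) (grad (S u) - grad (Sh u))).
rewrite -/(energy_error u) le_eqVlt => /predU1P[<-|E0].
  by rewrite mulr_ge0 ?sqrtr_ge0// H1semi_ge0.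
by rewrite -(ler_pM2l E0); apply: le_trans le1; rewrite -expr2 sqr_sqrtr.
Qed.

Context (c : R) (c0 : 0 <= c).
Context (approx : forall u, L2 D u -> forall e, 0 < e ->
  exists2 w, Yh w & H1semi D (S u - w) <= c * L2norm D u + e).

(** The slack [e] in [approx] reflects that an infimum over [Yh] is bounded, whose attainment is not
    assumed; it is sent to zero here. *)
Lemma energy_error_le_approx u : L2 D u ->
  energy_error u <= Num.sqrt kmax * (c * L2norm D u).
Proof.
move=> lu; apply/ler_addgt0Pr => e e0.
have s0 : 0 < Num.sqrt kmax by rewrite sqrtr_gt0.
have [w Yw h] := approx lu (divr_gt0 e0 s0).
apply: le_trans (energy_error_le lu Yw) _.
rewrite -(ler_pM2l s0) mulrDr in h; apply: le_trans h _.
by rewrite lerD2l mulrC divfK// gt_eqF.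
Qed.

(* Aubin-Nitsche duality: the error functional is itself an energy product of
   two Galerkin errors, which squares the rate. *)
Lemma galerkin_error u : L2 D u ->
  L2norm D (S u - Sh u) <= kmax * c ^+ 2 * L2norm D u.
Proof.
move=> lu; have HH : H10 D `<=` H10 D by [].
have lB v : L2 D v -> L2field D (grad (S v) - grad (Sh v)).
  move=> lv; apply: L2fieldB; first exact: galerkin_grad_L2 HH HS lv.
  exact: galerkin_grad_L2 YhH HSh lv.
have lSB : L2 D (S u - Sh u).
  by apply: L2B; [exact: galerkin_L2 HH HS lu|exact: galerkin_L2 YhH HSh lu].
apply: (L2norm_le_dual mD lSB).
  by rewrite mulr_ge0 ?L2norm_ge0// mulr_ge0 ?sqr_ge0// ltW.
move=> g lg; rewrite galerkin_error_dot//; apply: le_trans (ler_norm _) _.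
apply: le_trans (wform_le_sqrt mD kmin0 wk (lB _ lu) (lB _ lg)) _.
apply: le_trans (ler_pM (sqrtr_ge0 _) (sqrtr_ge0 _)
  (energy_error_le_approx lu) (energy_error_le_approx lg)) _.
rewrite mulrACA -expr2 sqr_sqrtr ?(ltW kmax0)//.
by rewrite le_eqVlt; apply/orP; left; apply/eqP; ring.
Qed.

End discretization.
End galerkin.

(** * Concentration of sums of L^2(D)-valued variables *)

(** If [x > 1/2] then [x <= 2 x^2] and monotonicity suffices. Otherwise
    [exp x <= 1 / (1 - x) <= 1 + x + 2 x^2], since [(1 + x + 2 x^2) (1 - x) = 1 + x^2 (1 - 2 x)]. *)
Lemma expR_le_sqr (R : realType) (x : R) : expR x <= x + expR (2 * x ^+ 2).
Proof.
have [x1|x1] := leP x 2^-1; last first.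
  apply: le_trans (_ : expR (2 * x ^+ 2) <= _); last by rewrite lerDr; lra.
  by rewrite ler_expR; nra.
apply: (@le_trans _ _ (x + (1 + 2 * x ^+ 2))); last first.
  by rewrite lerD2l expR_ge1Dx.
have h := expR_ge1Dx (- x).
have p : 0 < 1 - x by lra.
have e0 := expR_gt0 x.
have : expR x * (1 - x) <= 1.
  by apply: (le_trans (ler_wpM2l (ltW e0) h)); rewrite expRxMexpNx_1.
have q : 1 <= (x + (1 + 2 * x ^+ 2)) * (1 - x) by nra.
move=> h2; rewrite -(ler_pM2r p); exact: le_trans h2 q.
Qed.

Lemma big_tuple_cons (R : nmodType) (I : finType) n (F : n.+1.-tuple I -> R) :
  \sum_(t : n.+1.-tuple I) F t =
  \sum_(j : I) \sum_(t : n.-tuple I) F [tuple of j :: t].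
Proof.
rewrite pair_big /= (reindex (fun p : I * n.-tuple I => [tuple of p.1 :: p.2])) //=.
exists (fun t => (thead t, [tuple of behead t])) => [[j t] _|t _].
  by congr pair; apply: val_inj.
by case/tupleP: t => j t; apply: val_inj.
Qed.

Section concentration.
Context (R : realType) (d : nat) (D : set 'rV[R]_d) (mD : measurable D).
Local Notation X := 'rV[R]_d.
Context (I : finType) (p : I -> R) (p0 : forall j, 0 <= p j) (p1 : \sum_j p j = 1).
Context (V : I -> X -> R) (lV : forall j, L2 D (V j)).
Context (b : R) (b0 : 0 < b) (Vb : forall j, L2norm D (V j) <= b).
Context (V0 : forall w, L2 D w -> \sum_j p j * L2dot D (V j) w = 0).

(* [exp s <= s + exp (2 s^2)] applied to [s = 2 mu (u, V j)]: the linear term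
   averages out. *)
Lemma expected_exp_sqr_norm (mu : R) u : 0 <= mu -> L2 D u ->
  \sum_j p j * expR (mu * L2norm D (u + V j) ^+ 2) <=
  expR (mu * b ^+ 2 + (mu + 8 * mu ^+ 2 * b ^+ 2) * L2norm D u ^+ 2).
Proof.
move=> mu0 lu.
pose A := expR (mu * (b ^+ 2 + L2norm D u ^+ 2)).
pose B := expR (8 * mu ^+ 2 * b ^+ 2 * L2norm D u ^+ 2).
have step j : p j * expR (mu * L2norm D (u + V j) ^+ 2) <=
    A * (2 * mu * (p j * L2dot D (V j) u) + p j * B).
  have -> : A * (2 * mu * (p j * L2dot D (V j) u) + p j * B) =
      p j * (A * (2 * mu * L2dot D (V j) u + B)) by ring.
  rewrite ler_wpM2l//.
  rewrite (L2_sqr_normD mD lu (lV j)) (L2dotC _ u).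
  set s := L2dot D (V j) u.
  have Vb2 : L2norm D (V j) ^+ 2 <= b ^+ 2.
    by rewrite lerXn2r ?nnegrE ?L2norm_ge0// ltW.
  have sb : s ^+ 2 <= b ^+ 2 * L2norm D u ^+ 2.
    rewrite -(real_normK (num_real s)) -exprMn lerXn2r ?nnegrE ?mulr_ge0 ?L2norm_ge0//.
      exact: ltW.
    apply: le_trans (L2dot_le mD (lV j) lu) _.
    by rewrite ler_wpM2r ?L2norm_ge0.
  apply: (@le_trans _ _ (A * expR (2 * mu * s))).
    rewrite -expRD ler_expR; move: (L2norm D u) (L2norm D (V j)) Vb2 => y z.
    by move=> Vb2; have := ler_wpM2l mu0 Vb2; lra.
  rewrite ler_wpM2l ?expR_ge0//; apply: le_trans (expR_le_sqr _) _.
  rewrite lerD2l ler_expR.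
  have := ler_wpM2l (mulr_ge0 (ler0n _ 8) (sqr_ge0 mu)) sb; nra.
apply: le_trans (ler_sum _ (fun j _ => step j)) _.
rewrite -mulr_sumr big_split /= -mulr_sumr V0// mulr0 add0r -mulr_suml p1 mul1r.
by rewrite -expRD ler_expR; lra.
Qed.

(* The bound on [lam] keeps the coefficient of [|u|^2] below [2 lam] along the
   induction on the number of summands. *)
Lemma expected_exp_sqr_norm_sum (N : nat) (lam : R) n u : 0 <= lam -> (0 < N)%N ->
  32 * lam * b ^+ 2 * N%:R <= 1 -> (n <= N)%N -> L2 D u ->
  \sum_(t : n.-tuple I) (\prod_(j <- t) p j) *
     expR (lam * L2norm D (u + \sum_(j <- t) V j) ^+ 2) <=
  expR (2 * lam * n%:R * b ^+ 2 + lam * (1 + n%:R / N%:R) * L2norm D u ^+ 2).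
Proof.
move=> lam0 N0 hlam; elim: n u => [|n IH] u nN lu.
  rewrite (eq_bigr (fun=> expR (lam * L2norm D u ^+ 2))); last first.
    by move=> t _; rewrite tuple0 !big_nil mul1r addr0.
  by rewrite big_const card_tuple expn0 /= addr0 mulr0 !mul0r addr0 mulr1 add0r.
rewrite big_tuple_cons.
rewrite (eq_bigr (fun j => p j * \sum_(t : n.-tuple I) (\prod_(j <- t) p j) *
     expR (lam * L2norm D ((u + V j) + \sum_(j <- t) V j) ^+ 2))); last first.
  move=> j _; rewrite mulr_sumr; apply: eq_bigr => t _.
  by rewrite !big_cons mulrA addrA.
have Nr0 : 0 < N%:R :> R by rewrite ltr0n.
(* The induction hypothesis at [u + V j] leaves the average over [j] of an exponential with
   coefficient [m], to which the one-step estimate applies. *)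
pose m := lam * (1 + n%:R / N%:R).
have m0 : 0 <= m by rewrite mulr_ge0// addr_ge0// divr_ge0.
apply: (@le_trans _ _ (\sum_j expR (2 * lam * n%:R * b ^+ 2) *
    (p j * expR (m * L2norm D (u + V j) ^+ 2)))).
  apply: ler_sum => j _; rewrite mulrCA ler_wpM2l// -expRD.
  by apply: IH; [exact: ltnW|exact: L2D].
rewrite -mulr_sumr.
apply: le_trans (ler_wpM2l (expR_ge0 _) (expected_exp_sqr_norm m0 lu)) _.
rewrite -expRD ler_expR.
have nN1 : n%:R / N%:R <= 1 :> R by rewrite ler_pdivrMr// mul1r ler_nat ltnW.
have nN0 : 0 <= n%:R / N%:R :> R by rewrite divr_ge0.
have m2 : m <= 2 * lam by rewrite /m; nra.
have h1 : m * b ^+ 2 <= 2 * lam * b ^+ 2 by rewrite ler_wpM2r ?sqr_ge0.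
(* One summand may raise the coefficient by [lam / N]. As [m <= 2 lam], the increase is at most
   [32 lam^2 b^2], and [hlam] bounds this by [lam / N]; that is where 32 comes from. *)
have h2 : m + 8 * m ^+ 2 * b ^+ 2 <= lam * (1 + n.+1%:R / N%:R).
  have -> : lam * (1 + n.+1%:R / N%:R) = m + lam * N%:R^-1.
    by rewrite /m -[n.+1]addn1 natrD; ring.
  rewrite lerD2l -ler_pdivrMr ?invr_gt0// invrK.
  have h4 : m ^+ 2 <= 4 * lam ^+ 2.
    have := ler_pM m0 m0 m2 m2; rewrite -expr2 -expr2 exprMn; lra.
  have bN0 : 0 <= 8 * b ^+ 2 * N%:R by rewrite !mulr_ge0 ?sqr_ge0// ltW.
  have := ler_wpM2l bN0 h4; have := ler_wpM2l lam0 hlam; nra.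
have := ler_wpM2r (sqr_ge0 (L2norm D u)) h2.
by rewrite -[n.+1]addn1 natrD; move: h1; lra.
Qed.

(** Markov's inequality for [exp (lam |sum|^2)] with the largest [lam] that the moment bound admits;
    the moment is then at most [exp (2 lam N b^2) = exp (1/16)]. *)
Lemma concentration_tuple (N : nat) (r : R) : (0 < N)%N -> 0 <= r ->
  \sum_(t : N.-tuple I | r <= L2norm D (\sum_(j <- t) V j)) \prod_(j <- t) p j <=
  expR (16^-1 - r ^+ 2 / (32 * b ^+ 2 * N%:R)).
Proof.
move=> N0 r0; have Nr0 : 0 < N%:R :> R by rewrite ltr0n.
have K0 : 0 < 32 * b ^+ 2 * N%:R by rewrite mulr_gt0// mulr_gt0// exprn_gt0.
pose lam := (32 * b ^+ 2 * N%:R)^-1.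
have lam0 : 0 <= lam by rewrite invr_ge0 ltW.
have hlam : 32 * lam * b ^+ 2 * N%:R = 1.
  have -> : 32 * lam * b ^+ 2 * N%:R = lam * (32 * b ^+ 2 * N%:R) by ring.
  by rewrite mulVf// gt_eqF.
have := @expected_exp_sqr_norm_sum N lam N 0 lam0 N0 _ (leqnn N) (L2_0 mD).
rewrite hlam lexx => /(_ isT) h.
rewrite -(ler_pM2l (expR_gt0 (lam * r ^+ 2))) -expRD.
have -> : lam * r ^+ 2 + (16^-1 - r ^+ 2 / (32 * b ^+ 2 * N%:R)) = 16^-1.
  by rewrite /lam; ring.
apply: (le_trans _ (le_trans h _)).
  rewrite mulr_sumr big_mkcond /=; apply: ler_sum => t _.
  have pt0 : 0 <= \prod_(j <- t) p j by apply: prodr_ge0 => j _.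
  case: ifP => [rt|_]; last by rewrite mulr_ge0// expR_ge0.
  rewrite mulrC ler_wpM2l// ler_expR ler_wpM2l// add0r lerXn2r ?nnegrE//.
  exact: L2norm_ge0.
rewrite ler_expR ((L2norm_eq0 mD (L2_0 mD)).2 _); last exact: aeW.
by rewrite expr0n /= mulr0 addr0; move: hlam; nra.
Qed.

End concentration.

(** * Measurable dependence on the random element *)

Section C1_sup.
Context (R : realType) (d : nat) (D : set 'rV[R]_d) (bD : bounded_set D).
Local Notation X := 'rV[R]_d.

Lemma closure_bounded_compact : compact (closure D).
Proof.
have [a [b Dab]] := bounded_cbox bD.
apply: (@subclosed_compact _ (closure D) (cbox a b)); [exact: closed_closure|exact: compact_cbox|].
have /closure_id -> : closed (cbox a b).
  by apply: compact_closed; [exact: norm_hausdorff|exact: compact_cbox].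
exact: closure_subset.
Qed.

Lemma sup_norm_ge0 (V : Type) (A : set V) (f : V -> R) :
  0 <= sup [set `|f x| | x in A].
Proof.
have [h|/sup_out->//] := pselect (has_sup [set `|f x| | x in A]).
have [[y [x Ax fx]] ub] := h.
apply: le_trans (ub_le_sup ub _); last by exists x.
exact: normr_ge0.
Qed.

Lemma le_C1norm (f : X -> R) x : {within closure D, continuous f} -> D x ->
  `|f x| <= C1norm D f.
Proof.
move=> cf Dx; rewrite /C1norm.
have [M [_ HM]] := compact_bounded (continuous_compact cf closure_bounded_compact).
have s0 : 0 <= \sum_(i < d) sup [set `|partial i f x| | x in D].
  by apply: sumr_ge0 => i _; exact: sup_norm_ge0.
apply: le_trans (_ : sup [set `|f x| | x in closure D] <= _); last by rewrite lerDl.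
apply: ub_le_sup; last by exists x => //; exact: subset_closure.
exists (M + 1) => _ [y Dy <-]; apply: HM; first by rewrite ltrDl.
by exists y.
Qed.

End C1_sup.

Section measurable_partition.
Context (R : realType) (d : nat) (D : set 'rV[R]_d) (bD : bounded_set D).
Local Notation X := 'rV[R]_d.
Context d0 (T : measurableType d0) (kappa : T -> X -> R).

Lemma measurable_fibers (C : countType) (g : T -> C) (B : set C) :
  (forall c, measurable (g @^-1` [set c])) -> measurable (g @^-1` B).
Proof.
move=> mg; rewrite (_ : _ @^-1` B = \bigcup_n
  (if (unpickle n : option C) is Some c then
     if `[< B c >] then g @^-1` [set c] else set0 else set0)).
  apply: bigcup_measurable => n _; case: unpickle => // c.
  by case: asboolP => // _; exact: mg.
apply/seteqP; split => [z Bz|z [n _]].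
  by exists (pickle (g z)) => //; rewrite pickleK asboolT.
by case: unpickle => // c; case: asboolP => // Bc /= ->.
Qed.

(** The code of [t] records which sets [A j] contain it and determines [s t]. Codes are in
    [seq bool] because the number of sets varies with the simple map, while the codes of all stages
    of a sequence must share one countable type. *)
Lemma C1simple_code (s : T -> X -> R) : C1simple D s ->
  exists (J : T -> seq bool) (g : seq bool -> X -> R),
    [/\ forall c, measurable (J @^-1` [set c]), forall t, s t = g (J t) &
        forall t, {within closure D, continuous (s t)}].
Proof.
move=> [m [A [f [mA Cf sE]]]].
exists (fun t => [seq `[< A j t >] | j <- enum 'I_m]).
exists (fun c x => \sum_(j < m) (nth false c j)%:R * f j x); split.
- move=> c; have [sc|sc] := eqVneq (size c) m; last first.
    rewrite (_ : _ @^-1` _ = set0)//; apply/seteqP; split => // t /= tc.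
    by move: sc; rewrite -tc size_map size_enum_ord eqxx.
  rewrite (_ : _ @^-1` _ = \bigcap_(j in setT)
      (if nth false c (j : 'I_m) then A j else ~` A j)).
    apply: fin_bigcap_measurable => // j _; case: ifP => _; first exact: mA.
    exact: measurableC.
  have nthE t (j : 'I_m) : nth false [seq `[< A j t >] | j <- enum 'I_m] j = `[< A j t >].
    by rewrite (nth_map j) ?size_enum_ord// nth_ord_enum.
  apply/seteqP; split => [t /= tc j _|t tc] /=.
    by rewrite -tc nthE; case: asboolP.
  apply: (@eq_from_nth _ false); first by rewrite size_map size_enum_ord sc.
  move=> i; rewrite size_map size_enum_ord => im.
  have := tc (Ordinal im) I; rewrite (nthE t (Ordinal im)) /=.
  by case: ifP => _ At; [exact: asboolT|exact: asboolF].
- move=> t; rewrite sE; apply/funext => x; apply: eq_bigr => j _.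
  rewrite indicE (nth_map j) ?size_enum_ord// nth_ord_enum.
  suff -> : (t \in A j) = `[< A j t >] by [].
  by apply/idP/idP => [/set_mem/asboolP|/asboolP/mem_set].
- move=> t; rewrite sE => x; apply: cvg_big; first exact: add_continuous.
  move=> j _; apply: cvgMr.
  by have [cf _] := Cf j; exact: cf.
Qed.

(* [K z] encodes the first stage after which the simple approximations of
   [kappa z] stay within [eta / 2] of each other, and their value there. *)
Lemma measurable_partition : C1strongly_measurable D kappa -> forall eta, 0 < eta ->
  exists2 K : T -> nat, measurable_fun setT K &
    forall z z', K z = K z' -> forall x, D x -> `|kappa z x - kappa z' x| <= eta.
Proof.
move=> [Ck [s [ss sk]]] eta eta0.
have /choice[J HJ] := fun n => C1simple_code (ss n).
have /choice[g HJg] := HJ; move: HJg => {HJ} HJg.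
have mJ n c : measurable (J n @^-1` [set c]) by have [] := HJg n.
have sE n t : s n t = g n (J n t) by have [] := HJg n.
have cs n t : {within closure D, continuous (s n t)} by have [] := HJg n.
pose good n t := forall m, (n <= m)%N -> forall x, D x -> `|s m t x - s n t x| <= eta / 2.
(* [good n] compares simple maps with each other only, so it is a countable intersection of
   conditions on codes; no measurability of [kappa] itself is called for. *)
have mgood n : measurable [set t | good n t].
  rewrite (_ : [set t | _] = \bigcap_(m in [set m | (n <= m)%N])
      ((fun t => (J m t, J n t)) @^-1`
         [set c | forall x, D x -> `|g m c.1 x - g n c.2 x| <= eta / 2])).
    apply: bigcap_measurable; first by exists n => /=.
    move=> m _; apply: measurable_fibers => -[c c'].
    rewrite (_ : _ @^-1` _ = J m @^-1` [set c] `&` J n @^-1` [set c']).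
      by apply: measurableI; exact: mJ.
    by apply/seteqP; split => [t [<- <-]|t [/= -> ->]].
  apply/seteqP; split => [t gt m /= nm x Dx|t gt m nm x Dx].
    by rewrite -!sE; exact: gt.
  by rewrite !sE; exact: (gt m nm x Dx).
have close t : forall e, 0 < e -> exists n, forall m, (n <= m)%N ->
    forall x, D x -> `|s m t x - kappa t x| <= e.
  move=> e e0; have /cvgr0Pnorm_le /(_ _ e0) [n _ hn] := sk t.
  exists n => m nm x Dx; have [ck _] := Ck t.
  apply: le_trans (_ : C1norm D (s m t \- kappa t) <= _).
    apply: (le_C1norm bD (f := s m t \- kappa t)) => //.
    by move=> y; exact: cvgB (cs m t y) (ck y).
  by apply: le_trans (ler_norm _) _; exact: hn.
have ex t : exists n, `[< good n t >].
  (* Two maps within [eta / 4] of [kappa t] are within [eta / 2] of each other. Conversely, passing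
     to the limit puts [kappa t] within [eta / 2] of the first good stage, and two points with the
     same code then differ by at most [eta]. *)
  have [|n hn] := close t (eta / 4); first by rewrite divr_gt0.
  exists n; apply/asboolP => m nm x Dx.
  have h1 := hn m nm x Dx; have h2 := hn n (leqnn n) x Dx.
  rewrite (_ : s m t x - s n t x = (s m t x - kappa t x) - (s n t x - kappa t x)); last by ring.
  apply: le_trans (ler_normB _ _) _; lra.
pose nu t := ex_minn (ex t).
have nuP t : good (nu t) t /\ forall m, good m t -> (nu t <= m)%N.
  rewrite /nu; case: ex_minnP => n /asboolP gn mn; split=> // m gm.
  by apply: mn; apply/asboolP.
have mnu n : measurable (nu @^-1` [set n]).
  rewrite (_ : _ @^-1` _ = [set t | good n t] `&`
     \bigcap_(m in [set m | (m < n)%N]) ~` [set t | good m t]).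
    apply: measurableI; first exact: mgood.
    by apply: fin_bigcap_measurable; [exact: finite_II|move=> m _; exact: measurableC].
  apply/seteqP; split => [t /= <-|t [/= gn ngm]].
    have [g1 g2] := nuP t; split=> // m /= mn gm.
    by have := g2 _ gm; rewrite leqNgt mn.
  have [g1 g2] := nuP t; apply/eqP; rewrite eqn_leq g2//= leqNgt; apply/negP => h.
  exact: (ngm _ h).
exists (fun t => pickle (nu t, J (nu t) t)).
  move=> _ B _; rewrite setTI.
  rewrite (_ : _ @^-1` B = (fun t => (nu t, J (nu t) t)) @^-1` (pickle @^-1` B))//.
  apply: measurable_fibers => -[n c].
  rewrite (_ : _ @^-1` _ = nu @^-1` [set n] `&` J n @^-1` [set c]).
    exact: measurableI.
  by apply/seteqP; split => [t [<- <-]|t [/= -> ->]].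
move=> z z' /(pcan_inj pickleK)[nE JE] x Dx.
have lim t : `|kappa t x - s (nu t) t x| <= eta / 2.
  apply/ler_addgt0Pr => e e0; have [n hn] := close t e e0.
  have h1 := hn (maxn n (nu t)) (leq_maxl _ _) x Dx.
  have [/(_ (maxn n (nu t)) (leq_maxr _ _) x Dx) h2 _] := nuP t.
  move: h1 h2; set a := s (maxn n (nu t)) t x => h1 h2.
  rewrite (_ : _ - _ = (a - s (nu t) t x) - (a - kappa t x)); last by ring.
  by apply: le_trans (ler_normB _ _) _; exact: lerD.
have sE' : s (nu z) z x = s (nu z') z' x by rewrite !sE JE nE.
have h1 := lim z; have h2 := lim z'; rewrite sE' in h1.
move: h1 h2; set a := s _ _ x => h1 h2.
rewrite (_ : _ - _ = (kappa z x - a) - (kappa z' x - a)); last by ring.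
apply: le_trans (ler_normB _ _) _; rewrite [eta]splitr; exact: lerD.
Qed.

(** [f] is the pointwise limit of functions that are constant on the cells of ever finer countable
    partitions; on each nonempty cell the value is that of [f] at some point of the cell. *)
Lemma measurable_kappa_lipschitz (f : T -> R) (C : R) :
  C1strongly_measurable D kappa -> 0 <= C ->
  (forall eta z z', 0 < eta -> (forall x, D x -> `|kappa z x - kappa z' x| <= eta) ->
    `|f z - f z'| <= C * eta) ->
  measurable_fun setT f.
Proof.
move=> sm C0 lip.
have /choice[K HK] : forall n, exists K : T -> nat, measurable_fun setT K /\
    forall z z', K z = K z' -> forall x, D x -> `|kappa z x - kappa z' x| <= n.+1%:R^-1.
  by move=> n; have [|K mK hK] := @measurable_partition sm n.+1%:R^-1; [by []|exists K].
have /choice[rep Hrep] : forall n, exists r : nat -> R,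
    forall z, exists2 z', K n z' = K n z & r (K n z) = f z'.
  move=> n; have /choice[r hr] : forall c, exists y : R,
      (exists z, K n z = c) -> exists2 z', K n z' = c & y = f z'.
    move=> c; have [[z zc]|h] := pselect (exists z, K n z = c).
      by exists (f z) => _; exists z.
    by exists 0 => /h.
  by exists r => z; apply: hr; exists z.
apply: (@measurable_fun_cvg _ _ _ setT (fun n => rep n \o K n)).
  move=> n; apply: measurableT_comp; last by case: (HK n).
  by move=> _ B _.
move=> z _; apply/cvgrPdist_le => e e0.
have : C / n.+1%:R @[n --> \oo] --> (0 : R).
  by rewrite -[X in _ --> X](mulr0 C); apply: cvgMr; exact: cvg_harmonic.
move=> /cvgr0Pnorm_le /(_ _ e0); apply: filterS => n h.
have [z' zz' rE] := Hrep n z; rewrite /= rE.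
have [_ /(_ z z' (esym zz')) hk] := HK n.
apply: le_trans (lip n.+1%:R^-1 z z' _ hk) _; first by rewrite invr_gt0.
exact: le_trans (ler_norm _) h.
Qed.

End measurable_partition.

(** * Samples of a finitely valued map *)

Section iid_finite.
Context (R : realType) dO (Omega : measurableType dO) (P : probability Omega R).
Context dO0 (Omega0 : measurableType dO0) (P0 : probability Omega0 R).
Context dT (T : measurableType dT) (X : nat -> {RV P >-> T}) (X0 : {RV P0 >-> T}).
Context (C : finType) (J : T -> C) (mJ : forall j, measurable (J @^-1` [set j])).

Definition law (j : C) : R := fine (P0 (X0 @^-1` (J @^-1` [set j]))).

Lemma measurable_law_set j : measurable (X0 @^-1` (J @^-1` [set j])).
Proof. by rewrite -[X in measurable X]setTI; exact: measurable_funPT. Qed.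

Lemma lawE j : P0 (X0 @^-1` (J @^-1` [set j])) = (law j)%:E.
Proof. by rewrite /law fineK// fin_num_measure//; exact: measurable_law_set. Qed.

Lemma law_ge0 j : 0 <= law j.
Proof. by rewrite fine_ge0. Qed.

Lemma Rintegral_law (g : C -> R) :
  \int[P0]_t g (J (X0 t)) = \sum_j g j * law j.
Proof.
pose E j : set Omega0 := X0 @^-1` (J @^-1` [set j]).
have mE j : measurable (E j) by exact: measurable_law_set.
rewrite /Rintegral (_ : (\int[P0]_t (g (J (X0 t)))%:E = \int[P0]_t \sum_j (g j * \1_(E j) t)%:E)%E).
  rewrite integral_sum//=; last first.
    move=> j; rewrite (_ : (fun _ => _) = (fun t => (g j)%:E * (\1_(E j) t)%:E)%E)//.
    by apply: integrableZl => //; exact: integrable_indic.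
  rewrite (eq_bigr (fun j => (g j * law j)%:E)) ?sumEFin//.
  move=> j _; under eq_integral do rewrite EFinM.
  rewrite integralZl//; last exact: integrable_indic.
  by rewrite EFinM -lawE integral_indic// setIT.
apply: eq_integral => t _; rewrite sumEFin; congr EFin.
rewrite (bigD1 (J (X0 t)))//= indicE mem_set//= mulr1 big1 ?addr0// => j jJ.
by rewrite indicE memNset ?mulr0// => /= h; rewrite h eqxx in jJ.
Qed.

Lemma sum_law : \sum_j law j = 1.
Proof.
have := Rintegral_law (fun=> 1).
rewrite Rintegral_cst//= probability_setT /= mulr1 => h; rewrite [RHS]h.
by apply: eq_bigr => j _; rewrite mul1r.
Qed.

Context (iid : iid_copies P P0 (fun i => X i : Omega -> T) X0).

Lemma measurable_iid_set i j : measurable (X i @^-1` (J @^-1` [set j])).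
Proof. by rewrite -[X in measurable X]setTI; exact: measurable_funPT. Qed.

Lemma iid_tuple_law N (t : N.-tuple C) :
  P [set w | [tuple J (X i w) | i < N] = t] = (\prod_(j <- t) law j)%:E.
Proof.
have [ind same] := iid.
(* Independence is stated for families indexed by all naturals; [setT] fills the places beyond the
   first [N], which the intersection does not visit. *)
pose A i : set T := if insub i is Some k then J @^-1` [set tnth t (k : 'I_N)] else setT.
have mA i : measurable (A i) by rewrite /A; case: insub => // k; exact: mJ.
have -> : [set w | [tuple J (X i w) | i < N] = t] =
    \bigcap_(i in [set` iota 0 N]) (X i @^-1` A i).
  apply/seteqP; split => [w /= h i|w /= h].
    rewrite /= mem_iota add0n => /= iN; rewrite /A insubT /= -h tnth_mktuple.
    by rewrite SubK.
  apply: eq_from_tnth => k; rewrite tnth_mktuple.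
  have := h k; rewrite /= mem_iota add0n ltn_ord => /(_ isT).
  by rewrite /A valK.
rewrite ind ?iota_uniq// -[in RHS](map_tnth_enum t) big_map big_enum /=.
have -> : iota 0 N = index_iota 0 N by rewrite /index_iota subn0.
rewrite big_mkord -prodEFin.
apply: eq_big => [//|k _]; rewrite same// /A valK; exact: lawE.
Qed.

Lemma measurable_iid_tuple N (t : N.-tuple C) :
  measurable [set w | [tuple J (X i w) | i < N] = t].
Proof.
rewrite (_ : [set w | _] =
    \bigcap_(i in setT) (X (i : 'I_N) @^-1` (J @^-1` [set tnth t i]))).
  by apply: fin_bigcap_measurable => // i _; exact: measurable_iid_set.
apply/seteqP; split => [w /= <- i _|w h] /=; first by rewrite tnth_mktuple.
by apply: eq_from_tnth => k; rewrite tnth_mktuple; by have := h k I.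
Qed.

(** Induction on a list of tuples with subadditivity at each step: an upper bound suffices, so
    disjointness of the events is not tracked. *)
Lemma iid_tuple_le N (B : pred (N.-tuple C)) :
  measurable [set w | B [tuple J (X i w) | i < N]] /\
  (P [set w | B [tuple J (X i w) | i < N]] <=
     (\sum_(t : N.-tuple C | B t) \prod_(j <- t) law j)%:E)%E.
Proof.
suff H (s : seq (N.-tuple C)) : measurable [set w | [tuple J (X i w) | i < N] \in s] /\
    (P [set w | [tuple J (X i w) | i < N] \in s] <=
       (\sum_(t <- s) \prod_(j <- t) law j)%:E)%E.
  have := H (enum B); rewrite big_enum /=.
  suff -> : [set w | [tuple J (X i w) | i < N] \in enum B] =
            [set w | B [tuple J (X i w) | i < N]] by [].
  by apply/seteqP; split => w /=; rewrite mem_enum.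
elim: s => [|t s [ms IH]].
  rewrite (_ : [set w | _] = set0) ?measure0 ?big_nil//.
  by apply/seteqP; split.
rewrite (_ : [set w | _] = [set w | [tuple J (X i w) | i < N] = t] `|`
    [set w | [tuple J (X i w) | i < N] \in s]); last first.
  apply/seteqP; split => w /=; rewrite in_cons.
    by case/orP => [/eqP|]; [left|right].
  by case=> [->|->]; rewrite ?eqxx// orbT.
split; first by apply: measurableU => //; exact: measurable_iid_tuple.
rewrite big_cons EFinD -iid_tuple_law; apply: le_trans (measureU2 _ _ _) _ => //.
  exact: measurable_iid_tuple.
by rewrite leeD2l.
Qed.

End iid_finite.

(** * The sample mean of an L^2(D)-valued map *)

Section monte_carlo.
Context (R : realType) (d : nat) (D : set 'rV[R]_d) (mD : measurable D).
Local Notation E := 'rV[R]_d.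
Context dO (Omega : measurableType dO) (P : probability Omega R).
Context dO0 (Omega0 : measurableType dO0) (P0 : probability Omega0 R).
Context dT (T : measurableType dT) (X : nat -> {RV P >-> T}) (X0 : {RV P0 >-> T}).
Context (iid : iid_copies P P0 (fun i => X i : Omega -> T) X0).
Context (q : T -> E -> R) (lq : forall z, L2 D (q z)).
Context (tau : R) (tau0 : 0 < tau) (q_tau : forall z, L2norm D (q z) <= tau).
Context (mq : forall v, L2 D v -> measurable_fun setT (fun z => L2dot D (q z) v)).
Context (qK : forall eta, 0 < eta -> exists2 K : T -> nat, measurable_fun setT K &
  forall z z', K z = K z' -> L2norm D (q z - q z') <= eta).

Lemma probability_integrable (f : Omega0 -> R) (M : R) :
  measurable_fun setT f -> (forall t, `|f t| <= M) -> P0.-integrable setT (EFin \o f).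
Proof.
move=> mf fM; apply: measurable_bounded_integrable => //.
  by rewrite (le_lt_trans (probability_le1 P0 measurableT))// ltry.
exists M; split; first exact: num_real.
by move=> y My t _ /=; rewrite (le_trans (fM t))// ltW.
Qed.

Lemma q_dot_integrable v : L2 D v ->
  P0.-integrable setT (EFin \o (fun t => L2dot D (q (X0 t)) v)).
Proof.
move=> lv; apply: (@probability_integrable _ (tau * L2norm D v)).
  exact: (measurableT_comp (mq lv)).
move=> t; apply: le_trans (L2dot_le mD (lq _) lv) _.
by rewrite ler_wpM2r ?L2norm_ge0.
Qed.

(** The sets where [K] is at least [M] decrease to the empty set, and the law is continuous from
    above. *)
Lemma tail_small (K : T -> nat) (beta : R) : measurable_fun setT K -> 0 < beta ->
  exists M : nat, fine (P0 (X0 @^-1` (K @^-1` [set n | (M <= n)%N]))) <= beta.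
Proof.
move=> mK b0; pose F M : set Omega0 := X0 @^-1` (K @^-1` [set n | (M <= n)%N]).
have mF M : measurable (F M).
  rewrite /F -[X in measurable X]setTI; apply: measurable_funPT => //.
  by rewrite -[X in measurable X]setTI; exact: mK.
have : P0 (F n) @[n --> \oo] --> P0 (\bigcap_n F n).
  apply: nonincreasing_cvg_mu => //.
  - by rewrite (le_lt_trans (probability_le1 P0 _))// ltry.
  - exact: bigcapT_measurable.
  - move=> m n mn; apply/subsetPset => t /=; exact: leq_trans.
rewrite (_ : \bigcap_n F n = set0) ?measure0; last first.
  apply/seteqP; split=> // t /(_ (K (X0 t)).+1 I) /=.
  by rewrite /F /= ltnn.
move=> /fine_cvgP[_ /cvgr0Pnorm_le/(_ _ b0)[M _ hM]].
by exists M; apply: le_trans (ler_norm _) (hM M (leqnn M)).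
Qed.

(* For a map with finitely many values the mean is a finite sum, so that no
   [L^2(D)]-valued integral is needed. *)
Lemma finite_approximation (eta beta : R) : 0 < eta -> 0 < beta ->
  exists (M : nat) (J : T -> 'I_M.+1) (V : 'I_M.+1 -> E -> R),
  [/\ forall j, measurable (J @^-1` [set j]), law X0 J ord_max <= beta,
      forall j, L2 D (V j) /\ L2norm D (V j) <= tau &
      forall z, J z != ord_max -> L2norm D (q z - V (J z)) <= eta].
Proof.
move=> eta0 beta0; have [K mK hK] := qK eta0.
have [M hM] := tail_small mK beta0.
(* Cells numbered [M] and beyond are merged into the class [ord_max], on which nothing is known
   about [q] except its norm bound. *)
pose J z : 'I_M.+1 := inord (minn (K z) M).
have JE z : J z = minn (K z) M :> nat by rewrite inordK// ltnS geq_minr.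
have JM z : (J z != ord_max) = (K z < M)%N.
  by rewrite -val_eqE /= JE (sameP eqP minn_idPr) -ltnNge.
have /choice[V HV] : forall j : 'I_M.+1, exists V : E -> R,
    [/\ L2 D V, L2norm D V <= tau &
     forall z, J z != ord_max -> J z = j -> L2norm D (q z - V) <= eta].
  move=> j; have [[z0 [z0M z0j]]|h] := pselect (exists z, J z != ord_max /\ J z = j).
    exists (q z0); split=> // z zM zj; apply: hK.
    have : nat_of_ord (J z) = J z0 by rewrite zj z0j.
    by rewrite !JE; move: zM z0M; rewrite !JM => h1 h2; rewrite !(minn_idPl (ltnW _)).
  (* The value 0 serves empty classes and [ord_max], where the closeness condition is void. *)
  exists 0; split; first exact: (L2_0 mD).
    rewrite ((L2norm_eq0 mD (L2_0 mD)).2 _); [exact: ltW|exact: aeW].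
  by move=> z zM zj; exfalso; apply: h; exists z.
exists M, J, V; split.
- move=> j; rewrite (_ : _ @^-1` _ = K @^-1` [set n | inord (minn n M) = j])//.
  by rewrite -[X in measurable X]setTI; exact: mK.
- apply: le_trans hM; rewrite /law le_eqVlt; apply/orP; left; apply/eqP.
  congr (fine (P0 _)); apply/seteqP; split => t /= h.
    by rewrite leqNgt -JM h eqxx.
  by apply/eqP; rewrite -[_ == _]negbK JM -leqNgt.
- by move=> j; have [? ? _] := HV j.
- by move=> z zM; have [_ _] := HV (J z); apply.
Qed.

(* [12 = 3 + 8 + 1]: finite approximation of the mean, concentration, and finite
   approximation of the sample. *)
Lemma monte_carlo_event (N : nat) (eps delta : R) : 0 < eps -> 0 < delta < 1 ->
  2 * ln (2 / delta) / eps ^+ 2 <= N%:R ->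
  exists W : set Omega, [/\ measurable W, ((1 - delta)%:E <= P W)%E &
    forall w, W w -> forall v, L2 D v ->
      (\int[P0]_t L2dot D (q (X0 t)) v) -
      N%:R^-1 * \sum_(i < N) L2dot D (q (X i w)) v <= 12 * tau * eps * L2norm D v].
Proof.
move=> eps0 /andP[delta0 delta1] hN.
have ln0 : 0 < ln (2 / delta).
  by rewrite ln_gt0// ltr_pdivlMr//; lra.
have Nr0 : 0 < N%:R :> R.
  by apply: lt_le_trans hN; rewrite divr_gt0 ?exprn_gt0// mulr_gt0.
have N0 : (0 < N)%N by rewrite -(ltr0n R).
(* The bound [eps] limits the effect of the last class on the mean; [delta / (4 N)] lets a union
   bound over the [N] samples cost only [delta / 4]. *)
pose beta := Num.min eps (delta / (4 * N%:R)).
have beta0 : 0 < beta by rewrite lt_min eps0 divr_gt0// mulr_gt0.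
have [M [J [V [mJ hbad HV JV]]]] := finite_approximation (mulr_gt0 tau0 eps0) beta0.
pose p := law X0 J.
have lV j : L2 D (V j) by have [] := HV j.
have Vt j : L2norm D (V j) <= tau by have [] := HV j.
have p0 j : 0 <= p j by exact: law_ge0.
have p1 : \sum_j p j = 1 by exact: (sum_law X0 mJ).
pose m := \sum_j p j *: V j.
have lpV j : L2 D (p j *: V j) by exact: (L2Z (p j) (lV j)).
have lm : L2 D m by exact: (L2_sum mD _ _ lpV).
have mE v : L2 D v -> L2dot D m v = \sum_j p j * L2dot D (V j) v.
  move=> lv; rewrite (L2dot_suml mD _ _ lpV lv).
  by apply: eq_bigr => j _; rewrite (L2dotZl mD).
have mt : L2norm D m <= tau.
  apply: (L2norm_le_dual mD lm (ltW tau0)) => g lg; rewrite mE//.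
  rewrite -[X in _ <= X]mul1r -p1 mulr_suml; apply: ler_sum => j _.
  rewrite ler_wpM2l//; apply: le_trans (L2dot_ler mD (lV j) lg) _.
  by rewrite ler_wpM2r ?L2norm_ge0.
pose Z j := V j - m.
have lZ j : L2 D (Z j) by exact: (L2B (lV j) lm).
have Zt j : L2norm D (Z j) <= 2 * tau.
  apply: le_trans (L2norm_triangleB mD (lV j) lm) _.
  by have := Vt j; move: mt; lra.
have Z0 v : L2 D v -> \sum_j p j * L2dot D (Z j) v = 0.
  move=> lv; under eq_bigr do rewrite (L2dotBl mD (lV _) lm lv) mulrBr.
  by rewrite sumrB -mulr_suml p1 mul1r -mE// subrr.
have t20 : 0 < 2 * tau by rewrite mulr_gt0.
(* The centred values are bounded by [2 tau], so with this [r] the exponent [r^2 / (32 (2 tau)^2 N)]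
   equals [N eps^2 / 2], which is at least [ln (2 / delta)]. *)
pose r := 8 * N%:R * tau * eps.
have r0 : 0 <= r by rewrite !mulr_ge0 ?ltW.
have conc := concentration_tuple mD p0 p1 lZ t20 Zt Z0 N0 r0.
pose tup w : N.-tuple 'I_M.+1 := [tuple J (X i w) | i < N].
pose W2 := [set w | r <= L2norm D (\sum_(j <- tup w) Z j)].
have [mW2 PW2] := iid_tuple_le mJ iid (fun t : N.-tuple _ => r <= L2norm D (\sum_(j <- t) Z j)).
pose bad (i : nat) : set Omega := X i @^-1` (J @^-1` [set ord_max]).
have mbad i : measurable (bad i) by exact: measurable_iid_set.
pose W1 := \big[setU/set0]_(i < N) bad i.
have mW1 : measurable W1 by exact: bigsetU_measurable.
have PW1 : (P W1 <= (delta / 4)%:E)%E.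
  apply: le_trans (Boole_inequality _ _) _ => //.
  rewrite (eq_bigr (fun=> (p ord_max)%:E)); last first.
    move=> i _; have [_ same] := iid.
    by apply: etrans (same i _ (mJ ord_max)) _; exact: lawE.
  rewrite sumEFin lee_fin sumr_const card_ord -[_ *+ N]mulr_natl.
  apply: le_trans (ler_wpM2l (ltW Nr0) hbad) _.
  apply: (@le_trans _ _ (N%:R * (delta / (4 * N%:R)))).
    by rewrite ler_wpM2l ?(ltW Nr0)// ge_min lexx orbT.
  rewrite le_eqVlt; apply/orP; left; apply/eqP; field.
  by rewrite gt_eqF.
have PW2' : (P W2 <= (3 / 4 * delta)%:E)%E.
  apply: le_trans PW2 _; rewrite lee_fin; apply: le_trans conc _.
  have -> : r ^+ 2 / (32 * (2 * tau) ^+ 2 * N%:R) = N%:R * eps ^+ 2 / 2.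
    rewrite /r; field; by rewrite !gt_eqF.
  have h1 : ln (2 / delta) <= N%:R * eps ^+ 2 / 2.
    by move: hN; rewrite ler_pdivrMr ?exprn_gt0//; lra.
  apply: (@le_trans _ _ (expR (16^-1 - ln (2 / delta)))).
    by rewrite ler_expR lerD2l lerN2.
  rewrite expRB lnK ?posrE ?divr_gt0// invf_div.
  (* The tail is at most [exp (1/16) delta / 2], hence at most [3/4 delta], and the remaining
     [delta / 4] pays for samples in the last class. *)
  have h2 : expR (16^-1 : R) <= 3 / 2.
    have := expR_ge1Dx (- (16^-1) : R); have := expRxMexpNx_1 (16^-1 : R).
    have := expR_gt0 (16^-1 : R); nra.
  by have := ler_wpM2r (ltW delta0) h2; lra.
exists (~` (W1 `|` W2)); split.
- by apply: measurableC; exact: measurableU.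
- rewrite probability_setC; last exact: measurableU.
  rewrite EFinB leeB//; apply: le_trans (measureU2 _ mW1 mW2) _.
  apply: le_trans (leeD PW1 PW2') _; rewrite -EFinD lee_fin; lra.
move=> w; rewrite setCU => -[w1 w2] v lv.
have nb (i : 'I_N) : J (X i w) != ord_max.
  apply/eqP => h; apply: w1; rewrite /W1 -bigcup_mkord; exists i => //=.
have w2' : L2norm D (\sum_(j <- tup w) Z j) <= r.
  by move/negP : w2; rewrite -ltNge => /ltW.
have nv := L2norm_ge0 D v.
pose A := \int[P0]_t L2dot D (q (X0 t)) v.
have hA : A - L2dot D m v <= 3 * (tau * eps) * L2norm D v.
  pose g j := L2dot D (V j) v.
  (* The error is [tau eps] off the last class and at most [2 tau] on it; as that class has
     probability at most [eps], the total is [(1 + 2) tau eps]. *)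
  pose h (j : 'I_M.+1) := (tau * eps + (if j == ord_max then 2 * tau else 0)) * L2norm D v.
  have iJ (f : 'I_M.+1 -> R) : P0.-integrable setT (EFin \o (fun t => f (J (X0 t)))).
    apply: (@probability_integrable _ (\sum_j `|f j|)).
      apply: (measurableT_comp (_ : measurable_fun setT (f \o J))) => //.
      by move=> _ B _; rewrite setTI; exact: (measurable_fibers (f @^-1` B) mJ).
    by move=> t; rewrite (bigD1 (J (X0 t)))//= lerDl; exact: sumr_ge0.
  have -> : L2dot D m v = \int[P0]_t g (J (X0 t)).
    by rewrite mE// (Rintegral_law X0 mJ); apply: eq_bigr => j _; rewrite mulrC.
  rewrite /A -(RintegralB measurableT (q_dot_integrable lv) (iJ g)).
  apply: (@le_trans _ _ (\int[P0]_t h (J (X0 t)))).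
    apply: (le_Rintegral measurableT _ (iJ h)).
      exact: (integrableB measurableT (q_dot_integrable lv) (iJ g)).
    move=> t _; rewrite /g -(L2dotBl mD (lq _) (lV _) lv).
    apply: le_trans (L2dot_ler mD (L2B (lq _) (lV _)) lv) _; rewrite ler_wpM2r//.
    case: ifPn => [_|/JV]; last by rewrite addr0.
    apply: le_trans (L2norm_triangleB mD (lq _) (lV _)) _.
    have := q_tau (X0 t); have := Vt (J (X0 t)); have := mulr_gt0 tau0 eps0.
    move: (L2norm _ _) (L2norm _ _) => a b; lra.
  rewrite (Rintegral_law X0 mJ) /h.
  under eq_bigr do rewrite mulrAC.
  rewrite -mulr_suml ler_wpM2r//.
  under eq_bigr do rewrite mulrDl.
  rewrite big_split /= -mulr_sumr p1 mulr1.
  rewrite (bigD1 ord_max)//= eqxx big1; last first.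
    by move=> j /negbTE ->; rewrite mul0r.
  rewrite addr0; have : p ord_max <= eps.
    by apply: le_trans hbad _; rewrite ge_min lexx.
  by move/(ler_wpM2l (ltW tau0)); rewrite -/(p ord_max); lra.
have tupE : \sum_(j <- tup w) Z j = \sum_(i < N) Z (J (X i w)).
  rewrite -[in LHS](map_tnth_enum (tup w)) big_map big_enum /=.
  by apply: eq_bigr => i _; rewrite tnth_mktuple.
have hB : L2dot D m v - N%:R^-1 * \sum_(i < N) L2dot D (V (J (X i w))) v <=
    8 * (tau * eps) * L2norm D v.
  have -> : L2dot D m v - N%:R^-1 * \sum_(i < N) L2dot D (V (J (X i w))) v =
      N%:R^-1 * L2dot D (- \sum_(j <- tup w) Z j) v.
    have lS : L2 D (\sum_(i < N) Z (J (X i w))) by apply: (L2_sum mD) => i; exact: lZ.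
    rewrite tupE (L2dotNl mD lS lv).
    rewrite (L2dot_suml mD _ _ (fun i : 'I_N => lZ (J (X i w))) lv).
    under [in RHS]eq_bigr do rewrite (L2dotBl mD (lV _) lm lv).
    rewrite sumrB sumr_const card_ord -[L2dot D m v *+ N]mulr_natl opprB mulrBr mulKf//.
    by rewrite gt_eqF.
  have lS : L2 D (\sum_(j <- tup w) Z j) by apply: (L2_sum mD) => i; exact: lZ.
  rewrite ler_pdivrMl//; apply: le_trans (L2dot_ler mD (L2N lS) lv) _.
  rewrite (L2normN mD lS); apply: le_trans (ler_wpM2r nv w2') _.
  by rewrite /r le_eqVlt; apply/orP; left; apply/eqP; ring.
have hC : N%:R^-1 * \sum_(i < N) L2dot D (V (J (X i w))) v -
    N%:R^-1 * \sum_(i < N) L2dot D (q (X i w)) v <= tau * eps * L2norm D v.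
  rewrite -mulrBr -sumrB ler_pdivrMl//.
  rewrite mulr_natl -[X in _ <= _ *+ X](card_ord N) -sumr_const; apply: ler_sum => i _.
  rewrite -(L2dotBl mD (lV _) (lq _) lv).
  apply: le_trans (L2dot_ler mD (L2B (lV _) (lq _)) lv) _; rewrite ler_wpM2r//.
  rewrite -(L2normN mD (L2B (lV _) (lq _))) opprB; exact: JV.
move: hA hB hC; rewrite /A; lra.
Qed.

End monte_carlo.

(** * Quasi-interpolation *)

Section L1_interp.
Context (R : realType) (d : nat) (D : set 'rV[R]_d) (mD : measurable D).
Context (Doo : (leb R d D < +oo)%E).
Local Notation X := 'rV[R]_d.
Local Notation mu := (leb R d).
Implicit Types (u v w : X -> R).

Lemma Lp_measurable p u : Lp D p u -> measurable_fun D u.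
Proof.
move=> /sub_Lfun_mfun; rewrite inE => mu_.
by apply/(measurable_restrictT _ mD).
Qed.

Lemma L2_norm u : L2 D u -> L2 D (fun x => `|u x|).
Proof.
move=> lu; apply: (sqr_integrable_L2 mD).
  exact: measurableT_comp (L2_measurable mD lu).
have := L2dot_integrable mD lu lu; congr (integrable _ _ _).
by apply/funext => x /=; rewrite real_normK ?num_real// expr2.
Qed.

Lemma L2_ae_bounded u (M : R) : measurable_fun D u ->
  ae_in D (fun x => `|u x| <= M) -> L2 D u.
Proof.
move=> mu_ uM; apply: (sqr_integrable_L2 mD) => //.
apply/integrableP; split; first by apply/measurable_EFinP; exact: measurable_funX.
apply: (@le_lt_trans _ _ (\int[mu]_(x in D) (M ^+ 2)%:E)%E); last first.
  by rewrite integral_cst//; apply: lte_mul_pinfty => //; rewrite lee_fin sqr_ge0.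
apply: ae_ge0_le_integral => //.
- apply/measurableT_comp => //; apply/measurable_EFinP; exact: measurable_funX.
- by move=> x _; rewrite lee_fin sqr_ge0.
move: uM; rewrite /ae_in; apply: filterS => x h Dx /=; have {}h := h Dx.
rewrite lee_fin ger0_norm ?sqr_ge0// -(real_normK (num_real (u x))).
by rewrite lerXn2r ?nnegrE// (le_trans _ h).
Qed.

Lemma L2_cst (c : R) : L2 D (cst c).
Proof. by apply: (@L2_ae_bounded _ `|c|); [exact: measurable_cst|exact: aeW]. Qed.

Lemma L2dot_ae_ge0 u v : L2 D u -> L2 D v -> ae_in D (fun x => 0 <= u x) ->
  ae_in D (fun x => 0 <= v x) -> 0 <= L2dot D u v.
Proof.
move=> lu lv u0 v0; have lu' := L2_norm lu; have lv' := L2_norm lv.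
rewrite (L2dot_ae mD lu lu' lv); last by apply: ae_in_imp u0 => x _ h; rewrite ger0_norm.
rewrite L2dotC (L2dot_ae mD lv lv' lu'); last first.
  by apply: ae_in_imp v0 => x _ h; rewrite ger0_norm.
by apply: Rintegral_ge0 => x _; rewrite mulr_ge0.
Qed.

Lemma Rintegral_L2dot u : \int[mu]_(x in D) u x = L2dot D u (cst 1).
Proof. by apply: eq_Rintegral => x _; rewrite mulr1. Qed.

(** As a pairing with the constant 1, which is in L^2 because [D] has finite measure, the L^1 norm
    inherits the linearity and order properties of [L2dot]. *)
Lemma L1normE u : Lpnorm D 1%E u = L2dot D (fun x => `|u x|) (cst 1).
Proof.
rewrite -Rintegral_L2dot /Lpnorm Lnorm1 /Rintegral; congr fine.
rewrite [RHS]integral_mkcond; apply: eq_integral => x _ /=.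
by rewrite !patchE; case: ifP => // _; rewrite normr0.
Qed.

Lemma L2dot_ae_le u v w : L2 D u -> L2 D v -> L2 D w -> ae_in D (fun x => 0 <= w x) ->
  ae_in D (fun x => u x <= v x) -> L2dot D u w <= L2dot D v w.
Proof.
move=> lu lv lw w0 uv; rewrite -subr_ge0 -(L2dotBl mD lv lu lw).
apply: (L2dot_ae_ge0 (L2B lv lu) lw _ w0).
by apply: ae_in_imp uv => x _; rewrite !fctE subr_ge0.
Qed.

Lemma cst1_ge0 : ae_in D (fun x => 0 <= (cst 1 : X -> R) x).
Proof. exact: aeW. Qed.

Lemma L1norm_convex (t : R) u v : 0 <= t <= 1 -> L2 D u -> L2 D v ->
  Lpnorm D 1%E (u + t *: (v - u)) <= (1 - t) * Lpnorm D 1%E u + t * Lpnorm D 1%E v.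
Proof.
move=> /andP[t0 t1] lu lv; rewrite !L1normE.
have lw := L2D lu (L2Z t (L2B lv lu)); have l1 := L2_cst 1.
have nu := L2_norm lu; have nv := L2_norm lv.
rewrite -(L2dotZl mD _ nu l1) -(L2dotZl mD _ nv l1).
rewrite -(L2dotDl mD (L2Z _ nu) (L2Z _ nv) l1).
apply: L2dot_ae_le => //; [exact: L2_norm|exact: L2D (L2Z _ nu) (L2Z _ nv)|exact: cst1_ge0|].
apply: aeW => x _; rewrite !fctE.
rewrite (_ : u x + t *: (v x - u x) = (1 - t) * u x + t * v x).
  apply: le_trans (ler_normD _ _) _; rewrite !normrM (ger0_norm t0).
  by rewrite (@ger0_norm _ (1 - t)) ?subr_ge0.
by rewrite /GRing.scale /=; ring.
Qed.

Section quasi_interpolation.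
Context (n : nat) (phi : 'I_n -> X -> R) (mphi : forall j, measurable_fun D (phi j)).
Context (phi0 : forall j, ae_in D (fun x => 0 <= phi j x)).
Context (phi1 : ae_in D (fun x => \sum_j phi j x = 1)).

Lemma phi_ae_ge0 : ae_in D (fun x => forall j, 0 <= phi j x).
Proof.
rewrite /ae_in; have : {ae mu, forall x, forall j, D x -> 0 <= phi j x}.
  by apply: filter_forall => j; exact: phi0.
by apply: filterS => x h Dx j; exact: h.
Qed.

(** Nonnegativity and the partition of unity give [0 <= phi j <= 1] almost everywhere. *)
Lemma phi_L2 j : L2 D (phi j).
Proof.
apply: (@L2_ae_bounded _ 1) => //; apply: ae_in_imp2 phi_ae_ge0 phi1 => x _ h0 h1.
rewrite ger0_norm// -h1 (bigD1 j)//= lerDl.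
by apply: sumr_ge0.
Qed.

Let c u j := L2dot D (phi j) u / \int[mu]_(z in D) phi j z.

Lemma quasi_interpE u : quasi_interp D phi u = \sum_j c u j *: phi j.
Proof. by apply/funext => x; rewrite fct_sumE. Qed.

Lemma quasi_interp_L2 u : L2 D (quasi_interp D phi u).
Proof.
by rewrite quasi_interpE; apply: (L2_sum mD) => j; exact: L2Z (phi_L2 j).
Qed.

Lemma quasi_interp_span u : L2span D phi (quasi_interp D phi u).
Proof. by split; [exact: quasi_interp_L2|exists (c u); exact: aeW]. Qed.

Lemma phi_int_ge0 j : 0 <= \int[mu]_(z in D) phi j z.
Proof.
by rewrite Rintegral_L2dot; apply: L2dot_ae_ge0 (phi_L2 j) (L2_cst 1) (phi0 j) cst1_ge0.
Qed.

(** The coefficient is a weighted average of [u]. If the weight has integral 0, the quotient is 0 by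
    convention, which lies between the bounds because [l <= 0 <= r]. *)
Lemma quasi_interp_coef_le (l r : R) u j : l <= 0 <= r -> L2 D u ->
  ae_in D (fun x => l <= u x <= r) -> l <= c u j <= r.
Proof.
move=> /andP[l0 r0] lu ulr; rewrite /c.
have := phi_int_ge0 j; rewrite le_eqVlt => /predU1P[<-|p0].
  by rewrite invr0 mulr0 l0.
rewrite ler_pdivlMr// ler_pdivrMr// !Rintegral_L2dot.
have lc a : L2 D (cst a) by exact: L2_cst.
have E a : a * L2dot D (phi j) (cst 1) = L2dot D (cst a) (phi j).
  rewrite -(L2dotZr mD a (lc 1) (phi_L2 j)) L2dotC; congr L2dot.
  by apply/funext => x; rewrite !fctE /GRing.scale /= mulr1.
rewrite !E (L2dotC _ (phi j)); apply/andP; split; apply: L2dot_ae_le => //;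
  try exact: phi_L2; by apply: ae_in_imp ulr => x _ /andP[].
Qed.

(** Almost everywhere the interpolant is a convex combination of its coefficients. *)
Lemma quasi_interp_Uad (l r : R) u : l <= 0 <= r -> Uad D l r u ->
  Uad D l r (quasi_interp D phi u).
Proof.
move=> lr [lu ulr]; split; first exact: quasi_interp_L2.
apply: ae_in_imp2 phi_ae_ge0 phi1 => x _ h0 h1; rewrite /quasi_interp.
rewrite -[l]mulr1 -[r]mulr1 -h1 !mulr_sumr; apply/andP.
by split; apply: ler_sum => j _; rewrite ler_wpM2r//;
  have /andP[] := quasi_interp_coef_le j lr lu ulr.
Qed.

(** Each [|c u j|] times the integral of [phi j] is at most the integral of [phi j |u|], and these
    integrals add up to the norm of [u] by the partition of unity. *)
Lemma quasi_interp_L1 u : L2 D u ->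
  Lpnorm D 1%E (quasi_interp D phi u) <= Lpnorm D 1%E u.
Proof.
move=> lu; rewrite !L1normE; have nu := L2_norm lu; have l1 := L2_cst 1.
have lc j : L2 D (`|c u j| *: phi j) by exact: L2Z (phi_L2 j).
have lS := L2_sum mD (index_enum 'I_n) xpredT lc.
apply: (@le_trans _ _ (L2dot D (\sum_j `|c u j| *: phi j) (cst 1))).
  apply: L2dot_ae_le => //; [exact: L2_norm (quasi_interp_L2 u)|exact: cst1_ge0|].
  apply: ae_in_imp phi_ae_ge0 => x _ h0; rewrite /quasi_interp fct_sumE.
  apply: le_trans (ler_norm_sum _ _ _) _; apply: ler_sum => j _.
  by rewrite normrM (ger0_norm (h0 j)).
rewrite (L2dot_suml mD _ _ lc l1).
apply: (@le_trans _ _ (\sum_j L2dot D (phi j) (fun x => `|u x|))).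
  apply: ler_sum => j _; rewrite (L2dotZl mD _ (phi_L2 j) l1).
  have up : `|L2dot D (phi j) u| <= L2dot D (phi j) (fun x => `|u x|).
    rewrite ler_norml -(L2dotNr mD nu (phi_L2 j)) !(L2dotC _ (phi j)).
    apply/andP; split; apply: L2dot_ae_le => //; try exact: phi_L2; try exact: L2N.
      by apply: aeW => x _; rewrite !fctE lerNl -normrN ler_norm.
    by apply: aeW => x _; exact: ler_norm.
  rewrite /c -Rintegral_L2dot; have := phi_int_ge0 j.
  rewrite le_eqVlt => /predU1P[<-|p0].
    by rewrite invr0 !mulr0; exact: le_trans (normr_ge0 _) up.
  by rewrite normrM normfV (gtr0_norm p0) divfK// gt_eqF.
rewrite -(L2dot_suml mD _ _ phi_L2 nu) L2dotC.
rewrite [X in _ <= X]L2dotC [X in X <= _]L2dotC le_eqVlt; apply/orP; left; apply/eqP.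
apply: (L2dot_ae mD) => //; first exact: (L2_sum mD _ _ phi_L2).
by apply: ae_in_imp phi1 => x _; rewrite fct_sumE.
Qed.

End quasi_interpolation.
End L1_interp.

(** * Pairings controlled by the dual norm of H^1(D) *)

Section H1_dual.
Context (R : realType) (d : nat) (D : set 'rV[R]_d).
Context (oD : open D) (bD : bounded_set D).
Local Notation X := 'rV[R]_d.
Local Notation mD := (open_rV_measurable oD).
Implicit Types (v w : X -> R).

Lemma H1dual_le w v (c : R) : L2 D w -> (H1dual_norm D w <= c%:E)%E -> H1 D v ->
  `|L2dot D w v| <= c * H1norm D v.
Proof.
move=> lw wc Hv.
have ub v' : H1 D v' -> H1norm D v' <= 1 -> `|L2dot D w v'| <= c.
  move=> Hv' v1; rewrite -lee_fin; apply: le_trans wc.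
  by apply: ereal_sup_ubound; exists v'.
have lv : L2 D v by case: Hv.
have c0 : 0 <= c.
  apply: le_trans (ub 0 (H1_0 oD) _); first exact: normr_ge0.
  rewrite -(scale0r (0 : X -> R)) (H1normZ oD bD _ (H1_0 oD)) normr0 mul0r.
  exact: ler01.
have n0 := H1norm_ge0 D v.
(* Dividing by [H1norm D v + e] instead of the norm also covers a vanishing norm. *)
have key e : 0 < e -> `|L2dot D w v| <= c * (H1norm D v + e).
  move=> e0; have s0 : 0 < H1norm D v + e by rewrite ltr_wpDl.
  have := ub ((H1norm D v + e)^-1 *: v) (H1Z oD bD _ Hv).
  rewrite (H1normZ oD bD _ Hv) (L2dotZr mD _ lv lw) normrM.
  rewrite ger0_norm ?invr_ge0 ?(ltW s0)// ler_pdivrMl// ler_pdivrMl// mulr1 lerDl.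
  by rewrite mulrC; apply; exact: ltW.
apply/ler_addgt0Pr => e e0; have c10 : 0 < c + 1 by rewrite ltr_wpDl.
apply: le_trans (key (e / (c + 1)) (divr_gt0 e0 c10)) _.
rewrite mulrDr lerD2l mulrCA ger_pMr// ler_pdivrMr// mul1r.
by rewrite lerDl ler01.
Qed.

(** Friedrichs' inequality gives the factor [sqrt (CD^2 + 1) <= CD + 1]; this is the origin of
    [CD + 1] in the final bound. *)
Lemma H1norm_le_H1semi (CD : R) v : friedrichs D = CD%:E -> H10 D v ->
  H1norm D v <= (CD + 1) * H1semi D v.
Proof.
move=> hCD Hv; have CD0 := friedrichs_gt0 oD hCD.
have h := friedrichs_le oD hCD Hv; have s0 := H1semi_ge0 D v.
have CDs0 : 0 <= CD * H1semi D v by rewrite mulr_ge0// ltW.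
rewrite -ler_sqr ?nnegrE ?mulr_ge0 ?H1norm_ge0//; last by rewrite addr_ge0// ltW.
rewrite sqr_H1norm; have := ler_pM (L2norm_ge0 D v) (L2norm_ge0 D v) h h.
have := mulr_ge0 CDs0 s0; rewrite -expr2 -expr2.
by move: (L2norm D v) (H1semi D v) => a b; nra.
Qed.

End H1_dual.

(** * First-order optimality *)

(** Extracts a variational inequality from minimality on a segment: divided by [t], the second-order
    term vanishes as [t] tends to 0. *)
Lemma first_order_ge0 (R : realFieldType) (A B : R) :
  (forall t, 0 < t <= 1 -> 0 <= t * A + t ^+ 2 * B) -> 0 <= A.
Proof.
move=> h; rewrite leNgt; apply/negP => A0.
have s0 : 0 < - A + `|B| by rewrite ltr_pwDl ?oppr_gt0.
(* For negative [A] this step is small enough that [t |B| < - A]. *)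
pose t := - A / (- A + `|B|).
have t0 : 0 < t by rewrite divr_gt0// oppr_gt0.
have t1 : t <= 1 by rewrite ler_pdivrMr// mul1r lerDl.
have ht : t * (- A + `|B|) = - A by rewrite divfK// gt_eqF.
have := h t; rewrite t0 t1 => /(_ isT).
have -> : t * A + t ^+ 2 * B = t * (A + t * B) by ring.
rewrite pmulr_rge0// => h1.
have : t * B <= t * `|B| by rewrite ler_wpM2l ?(ltW t0)// ler_norm.
have := mulr_gt0 t0 s0; nra.
Qed.

Section optimality.
Context (R : realType) (d : nat) (D : set 'rV[R]_d).
Context (oD : open D) (bD : bounded_set D).
Local Notation X := 'rV[R]_d.
Local Notation mD := (open_rV_measurable oD).
Local Notation Doo := (leb_bounded_lty oD bD).
Context (yd : X -> R) (lyd : L2 D yd) (alpha gamma : R) (gamma0 : 0 <= gamma).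
Implicit Types (u v w : X -> R).

(** The L^1 term is convex but not differentiable, so its directional derivative is replaced by the
    difference of its values at the endpoints; this is why only an inequality holds. *)
Lemma control_cost_segment (t : R) u v : 0 <= t <= 1 -> L2 D u -> L2 D v ->
  control_cost D alpha gamma (u + t *: (v - u)) <= control_cost D alpha gamma u +
    t * (alpha * L2dot D u (v - u) + gamma * (Lpnorm D 1%E v - Lpnorm D 1%E u)) +
    t ^+ 2 * (alpha / 2 * L2norm D (v - u) ^+ 2).
Proof.
move=> t01 lu lv; rewrite /control_cost.
have lw := L2B lv lu; have ltw := L2Z t lw.
rewrite (L2_sqr_normD mD lu ltw) (L2dotZr mD t lw lu) (L2normZ mD t lw) exprMn.
rewrite (real_normK (num_real t)).
have := ler_wpM2l gamma0 (L1norm_convex mD Doo t01 lu lv).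
set a := L2dot D u _; set b := L2norm D (v - u); set c := L2norm D u.
set e := Lpnorm D _ _; set f := Lpnorm D _ u; set g := Lpnorm D _ v; lra.
Qed.

(** An exact expansion, as [T] is linear a.e.; symmetry of [T] turns the mixed term into a pairing
    of [w] with the adjoint state [T (T u - yd)]. *)
Lemma galerkin_misfit (Y : set (X -> R)) k T (t : R) u w :
  Y `<=` H10 D -> galerkin_operator D Y k T -> L2 D u -> L2 D w ->
  L2norm D (T (u + t *: w) - yd) ^+ 2 = L2norm D (T u - yd) ^+ 2 +
    2 * t * L2dot D (T (T u - yd)) w + t ^+ 2 * L2norm D (T w) ^+ 2.
Proof.
move=> YH ST lu lw; have lT g : L2 D g -> L2 D (T g) by exact: galerkin_L2 YH ST.
have lTu := lT _ lu; have lTw := lT _ lw; have ltw := L2Z t lTw.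
have lB := L2B lTu lyd; have luw := L2D lu (L2Z t lw).
have E : ae_in D (fun x => (T (u + t *: w) - yd) x = ((T u - yd) + t *: T w) x).
  apply: ae_in_imp (galerkin_lin oD t YH ST lw lu) => x _.
  by rewrite (addrC (t *: w)) !fctE => ->; ring.
rewrite (L2norm_ae mD (L2B (lT _ luw) lyd) (L2D lB ltw) E).
rewrite (L2_sqr_normD mD lB ltw) (L2dotZr mD t lTw lB) (L2normZ mD t lTw) exprMn.
rewrite (real_normK (num_real t)) (galerkin_sym ST lB lw).
by rewrite -mulr_natr; ring.
Qed.

Lemma saa_first_order (Xi : Type) (Y : set (X -> R)) (k : Xi -> X -> R)
    (Sh : (X -> R) -> Xi -> X -> R) (N : nat) (xs : nat -> Xi) u v :
  Y `<=` H10 D -> (forall z, galerkin_operator D Y (k z) (Sh ^~ z)) ->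
  (0 < N)%N -> L2 D u -> L2 D v ->
  (forall t, 0 < t <= 1 -> saa_objective D yd alpha gamma Sh N xs u <=
     saa_objective D yd alpha gamma Sh N xs (u + t *: (v - u))) ->
  0 <= N%:R^-1 * \sum_(i < N) L2dot D (Sh (Sh u (xs i) - yd) (xs i)) (v - u) +
    (alpha * L2dot D u (v - u) + gamma * (Lpnorm D 1%E v - Lpnorm D 1%E u)).
Proof.
move=> YH HSh N0 lu lv hmin; have lw := L2B lv lu.
apply: (@first_order_ge0 _ _ ((2 * N%:R)^-1 * \sum_(i < N) L2norm D (Sh (v - u) (xs i)) ^+ 2 +
   alpha / 2 * L2norm D (v - u) ^+ 2)) => t t01.
have t01' : 0 <= t <= 1 by case/andP: t01 => /ltW -> ->.
have := le_trans (hmin t t01) (lerD (lexx _) (control_cost_segment t01' lu lv)).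
rewrite /saa_objective.
have -> : \sum_(i < N) L2norm D (Sh (u + t *: (v - u)) (xs i) \- yd) ^+ 2 =
    \sum_(i < N) L2norm D (Sh u (xs i) \- yd) ^+ 2 +
    (2 * t * \sum_(i < N) L2dot D (Sh (Sh u (xs i) - yd) (xs i)) (v - u) +
     t ^+ 2 * \sum_(i < N) L2norm D (Sh (v - u) (xs i)) ^+ 2).
  rewrite !mulr_sumr -!big_split /=; apply: eq_bigr => i _.
  by rewrite addrA; exact: (galerkin_misfit t YH (HSh (xs i)) lu lw).
rewrite invfM.
set a := \sum_(i < N) L2norm D (_ \- _) ^+ 2; set b := \sum_(i < N) L2dot D _ _.
set c := \sum_(i < N) L2norm D (Sh (v - u) _) ^+ 2; set e := control_cost _ _ _ _.
have -> : 2^-1 / N%:R * (a + (2 * t * b + t ^+ 2 * c)) = 2^-1 / N%:R * a +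
    t * (N%:R^-1 * b) + t ^+ 2 * (2^-1 / N%:R * c) by field; rewrite pnatr_eq0 -lt0n.
lra.
Qed.

End optimality.

(** * The random adjoint state and the risk-neutral variational inequality *)

Section stochastic_galerkin.
Context (R : realType) (d : nat) (D : set 'rV[R]_d).
Context (oD : open D) (bD : bounded_set D).
Context (CD : R) (hCD : friedrichs D = CD%:E).
Context (kmin kmax : R) (kmin0 : 0 < kmin).
Local Notation X := 'rV[R]_d.
Local Notation mD := (open_rV_measurable oD).
Context dT (T : measurableType dT) (kappa : T -> X -> R).
Context (sm : C1strongly_measurable D kappa) (wk : forall z, weight D kmin kmax (kappa z)).
Context (S : (X -> R) -> T -> X -> R).
Context (HS : forall z, galerkin_operator D (H10 D) (kappa z) (S ^~ z)).
Context (yd : X -> R) (lyd : L2 D yd).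
Implicit Types (u v w : X -> R).

Let HH : H10 D `<=` H10 D. Proof. by []. Qed.

Lemma solution_L2 u z : L2 D u -> L2 D (S u z).
Proof. exact: galerkin_L2 HH (HS z). Qed.

(** By [galerkin_misfit], the L^2(D) gradient at [u] of half the squared misfit. *)
Definition adjoint u z := S (S u z - yd) z.

Lemma adjoint_L2 u z : L2 D u -> L2 D (adjoint u z).
Proof. by move=> lu; apply: solution_L2; exact: L2B (solution_L2 z lu) lyd. Qed.

Lemma misfit_le u z : L2 D u ->
  L2norm D (S u z - yd) <= CD ^+ 2 / kmin * L2norm D u + L2norm D yd.
Proof.
move=> lu; apply: le_trans (L2norm_triangleB mD (solution_L2 z lu) lyd) _.
by rewrite lerD2r; exact: (galerkin_L2norm oD hCD kmin0 HH (wk z) (HS z) lu).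
Qed.

Lemma adjoint_le u z : L2 D u -> L2norm D (adjoint u z) <=
  CD ^+ 2 / kmin * (CD ^+ 2 / kmin * L2norm D u + L2norm D yd).
Proof.
move=> lu; have lB := L2B (solution_L2 z lu) lyd.
apply: le_trans (galerkin_L2norm oD hCD kmin0 HH (wk z) (HS z) lB) _.
rewrite ler_wpM2l ?divr_ge0 ?sqr_ge0 ?(ltW kmin0)//.
exact: misfit_le.
Qed.

Lemma solution_lipschitz u z z' (eta : R) : 0 <= eta ->
  (forall x, D x -> `|kappa z x - kappa z' x| <= eta) -> L2 D u ->
  L2norm D (S u z - S u z') <= eta * (CD / kmin) ^+ 2 * L2norm D u.
Proof.
move=> eta0 kk lu.
exact: (galerkin_lipschitz oD hCD kmin0 HH (wk z) (wk z') (HS z) (HS z') kk eta0 lu).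
Qed.

(** Changing the coefficient in the outer solve costs [(CD / kmin)^2] times the misfit bound,
    changing it in the inner solve [CD^2 / kmin] times [(CD / kmin)^2 |u|]; the term in [|u|] thus
    occurs twice. *)
Definition adjoint_lip u : R := (CD / kmin) ^+ 2 *
  (2 * (CD ^+ 2 / kmin * L2norm D u) + L2norm D yd).

Lemma adjoint_lip_ge0 u : 0 <= adjoint_lip u.
Proof.
rewrite /adjoint_lip mulr_ge0 ?sqr_ge0// addr_ge0 ?L2norm_ge0// mulr_ge0//.
by rewrite mulr_ge0 ?L2norm_ge0// divr_ge0 ?sqr_ge0// ltW.
Qed.

Lemma adjoint_lipschitz u z z' (eta : R) : 0 <= eta ->
  (forall x, D x -> `|kappa z x - kappa z' x| <= eta) -> L2 D u ->
  L2norm D (adjoint u z - adjoint u z') <= adjoint_lip u * eta.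
Proof.
move=> eta0 kk lu.
have lSz := solution_L2 z lu; have lSz' := solution_L2 z' lu.
have lB := L2B lSz lyd; have lB' := L2B lSz' lyd.
have lBB := L2B lSz lSz'.
have l1 := L2B (solution_L2 z lB) (solution_L2 z' lB).
have E : ae_in D (fun x => (adjoint u z - adjoint u z') x =
    ((S (S u z - yd) z - S (S u z - yd) z') + S (S u z - S u z') z') x).
  have := galerkin_lin oD 1 HH (HS z') lBB lB'.
  rewrite !scale1r (_ : S u z - S u z' + (S u z' - yd) = S u z - yd); last first.
    by rewrite addrA subrK.
  by apply: ae_in_imp => x _; rewrite /adjoint !fctE => ->; ring.
rewrite (L2norm_ae mD (L2B (adjoint_L2 z lu) (adjoint_L2 z' lu)) (L2D l1 (solution_L2 z' lBB)) E).
apply: le_trans (L2norm_triangle mD l1 (solution_L2 z' lBB)) _.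
have h1 := solution_lipschitz eta0 kk lB.
have h2 := galerkin_L2norm oD hCD kmin0 HH (wk z') (HS z') lBB.
have h3 := solution_lipschitz eta0 kk lu.
have h4 := misfit_le z lu.
have c0 : 0 <= CD ^+ 2 / kmin by rewrite divr_ge0 ?sqr_ge0// ltW.
have e0 : 0 <= eta * (CD / kmin) ^+ 2 by rewrite mulr_ge0 ?sqr_ge0.
apply: le_trans (lerD (le_trans h1 (ler_wpM2l e0 h4)) (le_trans h2 (ler_wpM2l c0 h3))) _.
by rewrite /adjoint_lip le_eqVlt; apply/orP; left; apply/eqP; ring.
Qed.

Lemma misfit_measurable u : L2 D u ->
  measurable_fun setT (fun z => L2norm D (S u z - yd)).
Proof.
move=> lu; have C0 : 0 <= (CD / kmin) ^+ 2 * L2norm D u.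
  by rewrite mulr_ge0 ?sqr_ge0 ?L2norm_ge0.
apply: (measurable_kappa_lipschitz bD sm C0) => eta z z' eta0 kk.
have lSz := solution_L2 z lu; have lSz' := solution_L2 z' lu.
have h : L2norm D (S u z - S u z') <= (CD / kmin) ^+ 2 * L2norm D u * eta.
  apply: le_trans (solution_lipschitz (ltW eta0) kk lu) _.
  by rewrite le_eqVlt; apply/orP; left; apply/eqP; ring.
have tri a b : L2 D a -> L2 D b -> L2norm D (a - yd) - L2norm D (b - yd) <= L2norm D (a - b).
  move=> la lb; rewrite lerBlDr; have lab := L2B la lb; have lb' := L2B lb lyd.
  have := L2norm_triangle mD lab lb'.
  by rewrite (_ : a - b + (b - yd) = a - yd)// addrA subrK.
rewrite ler_norml lerNl opprB; apply/andP; split; last exact: le_trans (tri _ _ lSz lSz') h.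
apply: le_trans (tri _ _ lSz' lSz) _.
by rewrite -(L2normN mD (L2B lSz' lSz)) opprB.
Qed.

Lemma adjoint_dot_measurable u v : L2 D u -> L2 D v ->
  measurable_fun setT (fun z => L2dot D (adjoint u z) v).
Proof.
move=> lu lv; have C0 := mulr_ge0 (adjoint_lip_ge0 u) (L2norm_ge0 D v).
apply: (measurable_kappa_lipschitz bD sm C0) => eta z z' eta0 kk.
rewrite -(L2dotBl mD (adjoint_L2 z lu) (adjoint_L2 z' lu) lv).
apply: le_trans (L2dot_le mD (L2B (adjoint_L2 z lu) (adjoint_L2 z' lu)) lv) _.
rewrite mulrAC ler_wpM2r ?L2norm_ge0//.
exact: adjoint_lipschitz (ltW eta0) kk lu.
Qed.

Lemma adjoint_partition u : L2 D u -> forall eta, 0 < eta ->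
  exists2 K : T -> nat, measurable_fun setT K &
    forall z z', K z = K z' -> L2norm D (adjoint u z - adjoint u z') <= eta.
Proof.
move=> lu eta eta0; have L0 := adjoint_lip_ge0 u.
have s0 : 0 < adjoint_lip u + 1 by rewrite ltr_wpDl.
have [K mK hK] := measurable_partition bD sm (divr_gt0 eta0 s0).
exists K => // z z' /hK kk.
apply: le_trans (adjoint_lipschitz (ltW (divr_gt0 eta0 s0)) kk lu) _.
by rewrite mulrCA ger_pMr// ler_pdivrMr// mul1r lerDl.
Qed.

Context dO (Omega : measurableType dO) (P : probability Omega R) (X0 : {RV P >-> T}).
Context (alpha gamma : R) (gamma0 : 0 <= gamma).

Lemma misfit_integrable u : L2 D u ->
  P.-integrable setT (EFin \o (fun t => L2norm D (S u (X0 t) - yd) ^+ 2)).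
Proof.
move=> lu; apply: (@probability_integrable _ _ _ _ _
  ((CD ^+ 2 / kmin * L2norm D u + L2norm D yd) ^+ 2)).
  by apply: measurable_funX; exact: (measurableT_comp (misfit_measurable lu)).
move=> t; rewrite ger0_norm ?sqr_ge0//.
have h := misfit_le (X0 t) lu; have n0 := L2norm_ge0 D (S u (X0 t) - yd).
by rewrite lerXn2r ?nnegrE// (le_trans n0 h).
Qed.

Lemma rn_objectiveE u : L2 D u -> rn_objective D yd alpha gamma S P X0 u =
  (2^-1 * \int[P]_t (L2norm D (S u (X0 t) - yd) ^+ 2) + control_cost D alpha gamma u)%:E.
Proof.
move=> lu; rewrite /rn_objective.
have -> : 'E_P[fun t => (L2norm D (S u (X0 t) \- yd) ^+ 2)%R]%E =
    (\int[P]_t (L2norm D (S u (X0 t) - yd) ^+ 2))%:E.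
  rewrite unlock /Rintegral fineK //.
  exact: (integrable_fin_num measurableT (misfit_integrable lu)).
by rewrite EFinD EFinM.
Qed.

Lemma rn_first_order u v : L2 D u -> L2 D v ->
  (forall t, 0 < t <= 1 -> (rn_objective D yd alpha gamma S P X0 u <=
     rn_objective D yd alpha gamma S P X0 (u + t *: (v - u))%R)%E) ->
  0 <= \int[P]_t L2dot D (adjoint u (X0 t)) (v - u) +
    (alpha * L2dot D u (v - u) + gamma * (Lpnorm D 1%E v - Lpnorm D 1%E u)).
Proof.
move=> lu lv hmin; have lw := L2B lv lu.
have c0 : 0 <= CD ^+ 2 / kmin by rewrite divr_ge0 ?sqr_ge0// ltW.
(* A uniform bound on [|S (v - u) z|^2] stands in for its expectation, so the second-order term of
   the expansion is dominated by a constant. *)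
pose C := (CD ^+ 2 / kmin * L2norm D (v - u)) ^+ 2.
apply: (@first_order_ge0 _ _ (2^-1 * C + alpha / 2 * L2norm D (v - u) ^+ 2)) => t t01.
have t01' : 0 <= t <= 1 by case/andP: t01 => /ltW -> ->.
have ltw := L2Z t lw; have lut := L2D lu ltw.
have := hmin t t01; rewrite (rn_objectiveE lu) (rn_objectiveE lut) lee_fin.
move=> /le_trans/(_ (lerD (lexx _) (control_cost_segment oD bD alpha gamma0 t01' lu lv))).
have iq : P.-integrable setT (EFin \o (fun s => L2dot D (adjoint u (X0 s)) (v - u))).
  apply: (@probability_integrable _ _ _ _ _ (CD ^+ 2 / kmin *
     (CD ^+ 2 / kmin * L2norm D u + L2norm D yd) * L2norm D (v - u))).
    exact: (measurableT_comp (adjoint_dot_measurable lu lw)).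
  move=> s; apply: le_trans (L2dot_le mD (adjoint_L2 _ lu) lw) _.
  by rewrite ler_wpM2r ?L2norm_ge0//; exact: adjoint_le.
have iC : P.-integrable setT (EFin \o (fun _ : Omega => t ^+ 2 * C)).
  by apply: (@probability_integrable _ _ _ _ _ `|t ^+ 2 * C|).
have i2q : P.-integrable setT (EFin \o (fun s => 2 * t * L2dot D (adjoint u (X0 s)) (v - u))).
  exact: (integrableZl measurableT (2 * t) iq).
have iqC : P.-integrable setT
    (EFin \o (fun s => 2 * t * L2dot D (adjoint u (X0 s)) (v - u) + t ^+ 2 * C)).
  exact: (integrableD measurableT i2q iC).
have imu := misfit_integrable lu.
have : \int[P]_s (L2norm D (S (u + t *: (v - u)) (X0 s) - yd) ^+ 2) <=
    \int[P]_s (L2norm D (S u (X0 s) - yd) ^+ 2 +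
     (2 * t * L2dot D (adjoint u (X0 s)) (v - u) + t ^+ 2 * C)).
  apply: (le_Rintegral measurableT (misfit_integrable lut)).
    exact: (integrableD measurableT imu iqC).
  move=> s _; rewrite (galerkin_misfit oD lyd t HH (HS (X0 s)) lu lw) -addrA lerD2l lerD2l.
  rewrite ler_wpM2l ?sqr_ge0// /C lerXn2r ?nnegrE ?L2norm_ge0//.
    by rewrite mulr_ge0 ?L2norm_ge0.
  exact: (galerkin_L2norm oD hCD kmin0 HH (wk (X0 s)) (HS (X0 s)) lw).
rewrite (RintegralD measurableT imu iqC) (RintegralD measurableT i2q iC).
rewrite (RintegralZl _ measurableT iq) (Rintegral_cst _ measurableT).
rewrite (_ : fine _ = 1) ?mulr1; last first.
  exact: (congr1 fine (@probability_setT _ _ _ P)).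
set a := \int[P]_s _; set b := \int[P]_s _; set c := \int[P]_s _; lra.
Qed.

End stochastic_galerkin.

(** * Error estimate *)

Lemma quadratic_le (R : realFieldType) (a E K s A : R) :
  0 < a -> 0 <= E -> 0 <= K -> 0 <= s -> A <= a * s ^+ 2 ->
  a * E ^+ 2 <= a * K * E + A -> E <= K + s.
Proof.
move=> a0 E0 K0 s0 As h; rewrite leNgt; apply/negP => KE.
have : a * (E * (E - K)) <= a * s ^+ 2 by move: h As; rewrite !expr2; nra.
rewrite (ler_pM2l a0) leNgt => /negP; apply.
have h1 : s < E - K by lra.
have h2 : s <= E by lra.
rewrite expr2; apply: le_lt_trans (ler_wpM2r s0 h2) _.
by rewrite ltr_pM2l //; lra.
Qed.

(** The argument produces [kmax^3 / kmin^8]; the half powers of the stated bound add only the factor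
    [sqrt (b / a) >= 1]. *)
Lemma powR_half_ratio (R : realType) (a b : R) : 0 < a -> a <= b ->
  b ^+ 3 / a ^+ 8 <= b `^ (7 / 2) / a `^ (17 / 2).
Proof.
move=> a0 ab; have b0 := lt_le_trans a0 ab.
have E (x : R) n : 0 < x -> x `^ ((2 * n + 1)%:R / 2) = x ^+ n * Num.sqrt x.
  move=> x0; rewrite (_ : (2 * n + 1)%:R / 2 = n%:R + 2^-1); last first.
    by rewrite natrD natrM; field.
  by rewrite powRD ?(gt_eqF x0) ?implybT// powR_mulrn ?(ltW x0)// powR12_sqrt// ltW.
rewrite (E b 3 b0) (E a 8 a0) -[leRHS]mulf_div.
apply: ler_peMr; first by rewrite divr_ge0 ?exprn_ge0 ?ltW.
by rewrite ler_pdivlMr ?sqrtr_gt0// mul1r ler_wsqrtr.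
Qed.

Section discrete_adjoint.
Context (R : realType) (d : nat) (D : set 'rV[R]_d).
Context (oD : open D).
Context (CD : R) (hCD : friedrichs D = CD%:E).
Context (kmin kmax : R) (kmin0 : 0 < kmin).
Local Notation X := 'rV[R]_d.
Local Notation mD := (open_rV_measurable oD).
Context (Y : set (X -> R)) (YH : Y `<=` H10 D) (k : X -> R) (wk : weight D kmin kmax k).
Context (T : (X -> R) -> X -> R) (HT : galerkin_operator D Y k T).
Context (yd : X -> R) (lyd : L2 D yd).
Implicit Types (u v w : X -> R).

Let lT u : L2 D u -> L2 D (T u). Proof. exact: galerkin_L2 YH HT. Qed.

Lemma galerkinB u v : L2 D u -> L2 D v ->
  ae_in D (fun x => T (u - v) x = (T u - T v) x).
Proof.
move=> lu lv; have := galerkin_lin oD (-1) YH HT lv lu.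
rewrite (_ : -1 *: v + u = u - v); last by rewrite scaleN1r addrC.
by apply: ae_in_imp => x _ ->; rewrite scaleN1r addrC.
Qed.

(* The remainder comes from [a b - a^2 <= b^2 / 4]: the sampled misfit is convex. *)
Lemma misfit_gradient_le u v w : L2 D u -> L2 D v -> L2 D w ->
  L2dot D (T (T v - yd)) (w - v) <= L2dot D (T (T u - yd)) (w - v) +
    4^-1 * L2norm D (T (w - u)) ^+ 2.
Proof.
move=> lu lv lw; have lTu := lT lu; have lTv := lT lv.
have lBu := L2B lTu lyd; have lBv := L2B lTv lyd.
have lwv := L2B lw lv; have lvu := L2B lv lu; have lwu := L2B lw lu.
have lTBu := lT lBu; have lTBv := lT lBv.
have lTvu := lT lvu; have lTwv := lT lwv; have lTwu := lT lwu.
rewrite -lerBlDl -(L2dotBl mD lTBv lTBu lwv).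
have E1 : ae_in D (fun x => (T (T v - yd) - T (T u - yd)) x = T (T v - T u) x).
  have := galerkinB lBv lBu.
  rewrite (_ : T v - yd - (T u - yd) = T v - T u); last first.
    by rewrite opprB addrA subrK.
  by apply: ae_in_imp => x _ ->.
have lTT := L2B lTv lTu.
rewrite (L2dot_ae mD (L2B lTBv lTBu) (lT lTT) lwv E1).
rewrite (galerkin_sym HT lTT lwv).
have E2 : ae_in D (fun x => (T v - T u) x = T (v - u) x).
  by apply: ae_in_imp (galerkinB lv lu) => x _ ->.
have E3 : ae_in D (fun x => T (w - v) x = (T (w - u) - T (v - u)) x).
  have := galerkinB lwu lvu.
  rewrite (_ : w - u - (v - u) = w - v); first by [].
  by rewrite opprB addrA subrK.
rewrite (L2dot_ae mD lTT lTvu lTwv E2) (L2dotC _ _ (T (w - v))).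
rewrite (L2dot_ae mD lTwv (L2B lTwu lTvu) lTvu E3) (L2dotC _ (_ - _)).
rewrite (L2dotBr mD lTwu lTvu lTvu) -(sqr_L2norm mD lTvu).
have := L2dot_ler mD lTvu lTwu.
set a := L2norm D _; set b := L2norm D _; set c := L2dot _ _ _ => h.
have := sqr_ge0 (a - b / 2); rewrite !expr2; nra.
Qed.

Context (S : (X -> R) -> X -> R) (HS : galerkin_operator D (H10 D) k S).
Context (q : R) (q0 : 0 <= q).
Context (hq : forall u, L2 D u -> L2norm D (S u - T u) <= q * L2norm D u).

(** The difference is the discretization error for the exact misfit plus [T] applied to the state
    error. The former is at most [q C*], the latter [(CD^2 / kmin) q |u|], again at most [q C*]. *)
Lemma adjoint_error u : L2 D u ->
  L2norm D (S (S u - yd) - T (T u - yd)) <=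
  2 * q * (CD ^+ 2 / kmin * L2norm D u + L2norm D yd).
Proof.
move=> lu; have HH : H10 D `<=` H10 D by [].
have lSu := galerkin_L2 HH HS lu; have lTu := lT lu.
have lB := L2B lSu lyd; have lBT := L2B lTu lyd; have lST := L2B lSu lTu.
have lSB := galerkin_L2 HH HS lB; have lTB := lT lB; have lTBT := lT lBT.
have lTST := lT lST.
have E : ae_in D (fun x => (S (S u - yd) - T (T u - yd)) x =
    ((S (S u - yd) - T (S u - yd)) + T (S u - T u)) x).
  have := galerkinB lB lBT.
  rewrite (_ : S u - yd - (T u - yd) = S u - T u); last first.
    by rewrite opprB addrA subrK.
  by apply: ae_in_imp => x _; rewrite !fctE => ->; rewrite addrA subrK.
rewrite (L2norm_ae mD (L2B lSB lTBT) (L2D (L2B lSB lTB) lTST) E).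
apply: le_trans (L2norm_triangle mD (L2B lSB lTB) lTST) _.
have h1 := hq lB.
have h2 := galerkin_L2norm oD hCD kmin0 YH wk HT lST.
have h3 := hq lu.
have h4 := galerkin_L2norm oD hCD kmin0 HH wk HS lu.
have h5 := L2norm_triangleB mD lSu lyd.
have c0 : 0 <= CD ^+ 2 / kmin by rewrite divr_ge0 ?sqr_ge0// ltW.
have n0 := L2norm_ge0 D yd.
apply: le_trans (lerD (le_trans h1 (ler_wpM2l q0 (le_trans h5 (lerD h4 (lexx _)))))
  (le_trans h2 (ler_wpM2l c0 h3))) _.
rewrite -subr_ge0 (_ : _ - _ = q * L2norm D yd) ?mulr_ge0//; ring.
Qed.

End discrete_adjoint.

Lemma kappa_weight (R : realType) (d : nat) (D : set 'rV[R]_d) (k : 'rV[R]_d -> R) (m M : R) :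
  open D -> C1bar D k -> (forall x, closure D x -> m <= k x <= M) -> weight D m M k.
Proof.
move=> oD [kc _] kb; split; last by move=> x Dx; apply: kb; exact: subset_closure.
apply: (continuous_rV_measurable oD) => x Dx.
have := continuous_subspaceW (@subset_closure _ D) kc.
by rewrite (continuous_open_subspace _ oD); apply; rewrite inE.
Qed.

Section admissible_segments.
Context (R : realType) (d : nat) (D : set 'rV[R]_d).
Local Notation X := 'rV[R]_d.
Implicit Types (u v : X -> R).

Lemma Uad_segment (l r t : R) u v : 0 <= t <= 1 ->
  Uad D l r u -> Uad D l r v -> Uad D l r (u + t *: (v - u)).
Proof.
move=> t01 [lu ulr] [lv vlr]; split; first exact: L2D lu (L2Z t (L2B lv lu)).
apply: ae_in_imp2 ulr vlr => x _; rewrite !fctE.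
rewrite (_ : u x + _ = (1 - t) * u x + t * v x); last first.
  by rewrite /GRing.scale /=; ring.
move=> /andP[lu' ur'] /andP[lv' vr']; case/andP: t01 => t0 t1.
have s0 : 0 <= 1 - t by rewrite subr_ge0.
have := ler_wpM2l s0 lu'; have := ler_wpM2l s0 ur'.
have := ler_wpM2l t0 lv'; have := ler_wpM2l t0 vr'.
by move=> *; apply/andP; split; lra.
Qed.

Lemma L2span_segment m (b : 'I_m -> X -> R) (t : R) u v :
  L2span D b u -> L2span D b v -> L2span D b (u + t *: (v - u)).
Proof.
move=> [lu [c uc]] [lv [e ve]]; split; first exact: L2D lu (L2Z t (L2B lv lu)).
exists (fun j => (1 - t) * c j + t * e j).
apply: ae_in_imp2 uc ve => x _; rewrite !fctE => -> ->.
rewrite [RHS](eq_bigr (fun j => (1 - t) * (c j * b j x) + t * (e j * b j x))); last first.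
  by move=> j _; ring.
by rewrite big_split /= -!mulr_sumr /GRing.scale /=; ring.
Qed.

End admissible_segments.

(** * The quadratic inequality for one realization of the sample *)

Section deterministic_estimate.
Context (R : realType) (d : nat) (D : set 'rV[R]_d).
Context (oD : open D) (bD : bounded_set D).
Context (CD : R) (hCD : friedrichs D = CD%:E).
Context (kmin kmax : R) (kmin0 : 0 < kmin).
Local Notation X := 'rV[R]_d.
Local Notation mD := (open_rV_measurable oD).
Local Notation Doo := (leb_bounded_lty oD bD).
Context dT (T : measurableType dT) (kappa : T -> X -> R).
Context (sm : C1strongly_measurable D kappa) (wk : forall z, weight D kmin kmax (kappa z)).
Context (S : (X -> R) -> T -> X -> R).
Context (HS : forall z, galerkin_operator D (H10 D) (kappa z) (S ^~ z)).
Context (Y : set (X -> R)) (YH : Y `<=` H10 D) (Sh : (X -> R) -> T -> X -> R).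
Context (HSh : forall z, galerkin_operator D Y (kappa z) (Sh ^~ z)).
Context (q : R) (q0 : 0 <= q).
Context (hq : forall z u, L2 D u -> L2norm D (S u z - Sh u z) <= q * L2norm D u).
Context (yd : X -> R) (lyd : L2 D yd).
Context dO (Omega : measurableType dO) (P : probability Omega R) (X0 : {RV P >-> T}).
Context (alpha gamma : R) (gamma0 : 0 <= gamma) (l r : R) (lr : (l <= 0) && (0 <= r)).
Context (n : nat) (phi : 'I_n -> X -> R).
Context (mphi : forall j, measurable_fun D (phi j)).
Context (phi0 : forall j, ae_in D (fun x => 0 <= phi j x)).
Context (phi1 : ae_in D (fun x => \sum_(j < n) phi j x = 1)).
Context (us : X -> R) (us_H1 : H1 D us).
Context (us_min : is_minimizer (Uad D l r) (rn_objective D yd alpha gamma S P X0) us).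
Local Notation Ius := (quasi_interp D phi us).
Context (c1 c2 : R) (c20 : 0 <= c2).
Context (us_L2 : L2norm D (us \- Ius) <= c1).
Context (us_dual : (H1dual_norm D (us \- Ius)%R <= c2%:E)%E).
Context (N : nat) (N0 : (0 < N)%N) (xs : nat -> T) (uh : X -> R).
Context (uh_min : is_minimizer (Uad D l r `&` L2span D phi)
  (saa_objective D yd alpha gamma Sh N xs) uh).
Context (mu : R) (sampling : forall v, L2 D v ->
  \int[P]_t L2dot D (adjoint S yd us (X0 t)) v -
    N%:R^-1 * \sum_(i < N) L2dot D (adjoint S yd us (xs i)) v <= mu * L2norm D v).
Implicit Types (u v w : X -> R).

Let Cstar := CD ^+ 2 / kmin * L2norm D us + L2norm D yd.

Let lus : L2 D us. Proof. by case: us_min => -[]. Qed.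
Let luh : L2 D uh. Proof. by case: uh_min => -[[]]. Qed.
Let lI : L2 D Ius. Proof. exact: (quasi_interp_L2 mD Doo mphi phi0 phi1 us). Qed.

Let lSh u z : L2 D u -> L2 D (Sh u z). Proof. exact: galerkin_L2 YH (HSh z). Qed.

Let adjh z := Sh (Sh us z - yd) z.

Let ladjh z : L2 D (adjh z).
Proof. by apply: lSh; exact: L2B (lSh z lus) lyd. Qed.

Let average_le (f : 'I_N -> R) (c : R) : (forall i, f i <= c) ->
  N%:R^-1 * \sum_(i < N) f i <= c.
Proof.
move=> fc; rewrite mulrC ler_pdivrMr ?ltr0n//.
apply: (@le_trans _ _ (\sum_(i < N) c)); first by apply: ler_sum => i _.
by rewrite sumr_const card_ord mulr_natr.
Qed.

Lemma rn_optimality :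
  0 <= \int[P]_t L2dot D (adjoint S yd us (X0 t)) (uh - us) +
    (alpha * L2dot D us (uh - us) + gamma * (Lpnorm D 1%E uh - Lpnorm D 1%E us)).
Proof.
apply: (rn_first_order oD bD hCD kmin0 sm wk HS lyd gamma0 lus luh) => t /andP[t0 t1].
case: us_min => us_ad; apply; apply: Uad_segment => //; first by rewrite ltW.
by case: uh_min => -[].
Qed.

(** The discrete problem can be tested only with the interpolant of [us]; L^1 stability then puts
    [us] back in the L^1 term, so that it cancels against that of [rn_optimality]. *)
Lemma saa_optimality :
  0 <= N%:R^-1 * \sum_(i < N) L2dot D (Sh (Sh uh (xs i) - yd) (xs i)) (Ius - uh) +
    (alpha * L2dot D uh (Ius - uh) + gamma * (Lpnorm D 1%E us - Lpnorm D 1%E uh)).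
Proof.
have h : 0 <= N%:R^-1 * \sum_(i < N) L2dot D (Sh (Sh uh (xs i) - yd) (xs i)) (Ius - uh) +
    (alpha * L2dot D uh (Ius - uh) + gamma * (Lpnorm D 1%E Ius - Lpnorm D 1%E uh)).
  apply: (saa_first_order oD bD lyd gamma0 YH HSh N0 luh lI) => t /andP[t0 t1].
  case: uh_min => -[uh_ad uh_span]; apply; split.
    apply: Uad_segment => //; first by rewrite ltW.
    exact: (quasi_interp_Uad mD Doo mphi phi0 phi1 lr us_min.1).
  by apply: L2span_segment => //; exact: (quasi_interp_span mD Doo mphi phi0 phi1 us).
apply: le_trans h _; rewrite lerD2l lerD2l ler_wpM2l// lerD2r.
exact: (quasi_interp_L1 mD Doo mphi phi0 phi1 lus).
Qed.

(** Replacing the mean by the sample mean costs [mu]; replacing exact by discrete adjoint states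
    costs [2 q C*]. *)
Lemma sampled_adjoint_le : \int[P]_t L2dot D (adjoint S yd us (X0 t)) (uh - us) -
    N%:R^-1 * \sum_(i < N) L2dot D (adjh (xs i)) (uh - us) <=
  (mu + 2 * q * Cstar) * L2norm D (uh - us).
Proof.
have le := L2B luh lus.
have h := sampling le.
have h2 : N%:R^-1 * \sum_(i < N) (L2dot D (adjoint S yd us (xs i)) (uh - us) -
    L2dot D (adjh (xs i)) (uh - us)) <= 2 * q * Cstar * L2norm D (uh - us).
  apply: average_le => i; have la := adjoint_L2 HS lyd (xs i) lus.
  rewrite -(L2dotBl mD la (ladjh (xs i)) le).
  apply: le_trans (L2dot_ler mD (L2B la (ladjh (xs i))) le) _.
  rewrite ler_wpM2r ?L2norm_ge0//.
  exact: (adjoint_error oD hCD kmin0 YH (wk (xs i)) (HSh (xs i)) lyd (HS (xs i)) q0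
    (hq (xs i)) lus).
move: h h2; rewrite sumrB mulrBr mulrDl.
set a := \int[P]_t _; set b := _ * _; set c := N%:R^-1 * _; set f := L2norm _ _; lra.
Qed.

(** Discrete adjoint states lie in H^1_0(D) with a seminorm bounded uniformly over the sample, which
    is all that the dual-norm estimate of the interpolation error requires. *)
Lemma adjoint_interp_le : N%:R^-1 * \sum_(i < N) L2dot D (adjh (xs i)) (Ius - us) <=
  c2 * ((CD + 1) * (CD / kmin * Cstar)).
Proof.
apply: average_le => i; have lw := L2B lus lI.
have lB := L2B (lSh (xs i) lus) lyd.
have CD0 := friedrichs_gt0 oD hCD.
have aH : H10 D (adjh (xs i)) by apply: YH; case: (HSh (xs i) lB).
have -> : L2dot D (adjh (xs i)) (Ius - us) = - L2dot D (us - Ius) (adjh (xs i)).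
  by rewrite -(L2dotNl mD lw (ladjh _)) L2dotC opprB.
apply: le_trans (ler_norm _) _; rewrite normrN.
apply: le_trans (H1dual_le oD bD lw us_dual aH.1) _.
rewrite ler_wpM2l//; apply: le_trans (H1norm_le_H1semi oD hCD aH) _.
rewrite ler_wpM2l ?addr_ge0 ?(ltW CD0)//.
apply: le_trans (galerkin_H1semi oD hCD kmin0 YH (wk _) (HSh (xs i)) lB) _.
rewrite ler_wpM2l ?divr_ge0 ?(ltW CD0) ?(ltW kmin0)//.
apply: le_trans (L2norm_triangleB mD (lSh _ lus) lyd) _; rewrite lerD2r.
exact: (galerkin_L2norm oD hCD kmin0 YH (wk _) (HSh (xs i)) lus).
Qed.

Lemma interp_misfit_le : N%:R^-1 * \sum_(i < N) (4^-1 * L2norm D (Sh (Ius - us) (xs i)) ^+ 2) <=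
  4^-1 * (CD ^+ 2 / kmin * c1) ^+ 2.
Proof.
apply: average_le => i; have lw := L2B lI lus.
have c0 : 0 <= CD ^+ 2 / kmin by rewrite divr_ge0 ?sqr_ge0// ltW.
rewrite ler_wpM2l ?invr_ge0//.
have h := galerkin_L2norm oD hCD kmin0 YH (wk _) (HSh (xs i)) lw.
have h' : L2norm D (Ius - us) <= c1.
  by apply: le_trans us_L2; rewrite -(L2normN mD lw) opprB lexx.
have := le_trans h (ler_wpM2l c0 h').
have n0 := L2norm_ge0 D (Sh (Ius - us) (xs i)).
by move=> hh; rewrite lerXn2r ?nnegrE// (le_trans n0 hh).
Qed.

Lemma saa_error_quadratic : 0 < alpha ->
  alpha * L2norm D (uh - us) ^+ 2 <=
  (mu + 2 * q * Cstar) * L2norm D (uh - us) + alpha * c1 * L2norm D (uh - us) +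
  (alpha * (c2 * H1norm D us) + c2 * ((CD + 1) * (CD / kmin * Cstar)) +
   4^-1 * (CD ^+ 2 / kmin * c1) ^+ 2).
Proof.
move=> alpha0; have le := L2B luh lus; have lw := L2B lI lus.
have h1 := rn_optimality; have h2 := saa_optimality.
have h3 := sampled_adjoint_le; have h4 := adjoint_interp_le; have h5 := interp_misfit_le.
(* Convexity of the misfit trades the gradient at the random [uh] for the one at [us], after which
   [Ius - uh] splits into interpolation and total error. *)
have h6 : N%:R^-1 * \sum_(i < N) L2dot D (Sh (Sh uh (xs i) - yd) (xs i)) (Ius - uh) <=
    N%:R^-1 * \sum_(i < N) L2dot D (adjh (xs i)) (Ius - us) -
    N%:R^-1 * \sum_(i < N) L2dot D (adjh (xs i)) (uh - us) +
    N%:R^-1 * \sum_(i < N) (4^-1 * L2norm D (Sh (Ius - us) (xs i)) ^+ 2).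
  rewrite -mulrBr -mulrDr ler_wpM2l ?invr_ge0// -sumrB -big_split /=.
  apply: ler_sum => i _.
  apply: le_trans (misfit_gradient_le oD YH (HSh (xs i)) lyd lus luh lI) _.
  rewrite lerD2r -(L2dotBr mD lw le (ladjh _)).
  rewrite (_ : Ius - us - (uh - us) = Ius - uh); first by [].
  by rewrite opprB addrA subrK.
(* With [e = uh - us] and [w = Ius - us] this reads [(us + e, w - e) + (us, e) = (us, w) + (e, w) -
   |e|^2]; the last term provides the left side of the estimate. *)
have e1 : L2dot D uh (Ius - uh) + L2dot D us (uh - us) =
    L2dot D us (Ius - us) + L2dot D (uh - us) (Ius - us) - L2norm D (uh - us) ^+ 2.
  rewrite (sqr_L2norm mD le) (L2dotBl mD luh lus lw) (L2dotBl mD luh lus le).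
  rewrite (L2dotBr mD lI luh luh) !(L2dotBr mD luh lus lus) !(L2dotBr mD lI lus lus).
  rewrite !(L2dotBr mD luh lus luh) !(L2dotBr mD lI lus luh).
  set a := L2dot _ _ _; set b := L2dot _ _ _; set c := L2dot _ _ _.
  set f := L2dot _ _ _; set g := L2dot _ _ _; set k := L2dot _ _ _; ring.
have e2 : L2dot D us (Ius - us) <= c2 * H1norm D us.
  apply: le_trans (ler_norm _) _; rewrite L2dotC -normrN.
  rewrite -(L2dotNl mD lw lus) opprB.
  exact: (H1dual_le oD bD (L2B lus lI) us_dual us_H1).
have e3 : L2dot D (uh - us) (Ius - us) <= c1 * L2norm D (uh - us).
  apply: le_trans (L2dot_ler mD le lw) _; rewrite mulrC ler_wpM2r ?L2norm_ge0//.
  by apply: le_trans us_L2; rewrite -(L2normN mD lw) opprB lexx.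
have e4 := ler_wpM2l (ltW alpha0) e2; have e5 := ler_wpM2l (ltW alpha0) e3.
have e6 := congr1 (fun x => alpha * x) e1.
move: h1 h2 h3 h4 h5 h6 e4 e5 e6.
set i1 := \int[P]_t _; set s1 := _ * \sum_(i < N) L2dot _ (Sh _ _) (_ - uh).
set s2 := _ * \sum_(i < N) L2dot D (adjh _) (uh - us).
set s3 := _ * \sum_(i < N) L2dot D (adjh _) (Ius - us).
set s4 := _ * \sum_(i < N) (4^-1 * _).
set nu := Lpnorm D 1 us; set nh := Lpnorm D 1 uh.
set E := L2norm D (uh - us); set a1 := L2dot D uh _; set a2 := L2dot D us (uh - us).
set a3 := L2dot D us _; set a4 := L2dot D (uh - us) _; set X1 := H1norm D us.
move: (c2 * _) (4^-1 * _) (2 * q * Cstar) => k1 k2 k3.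
lra.
Qed.

End deterministic_estimate.

(** The root of the constant term is bounded without being computed: [CU h^2 Z (Z + kap)] is
    completed to the square of [s h (Z + kap / 2)], and with [X = CU h Z] the remaining
    [rho X^2 / 4] is at most [((1 + rho) X / 4)^2]. *)
Lemma error_bound (R : realType) (a CU CD kmin h E G C Z : R) :
  0 < a -> 0 < CU -> 0 < CD -> 0 < kmin -> 0 < h -> 0 <= E -> 0 <= G -> 0 <= C -> 0 <= Z ->
  a * E ^+ 2 <= G * E + a * (CU * h * Z) * E +
    (a * (CU * h ^+ 2 * Z * Z) + CU * h ^+ 2 * Z * ((CD + 1) * (CD / kmin * C)) +
     4^-1 * (CD ^+ 2 / kmin * (CU * h * Z)) ^+ 2) ->
  E <= G / a +
    h / a * (Num.sqrt CU * a + 2 * CU * a + CU * CD ^+ 4 / kmin ^+ 2) * Z +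
    h / a * (Num.sqrt CU * (CD + 1) * CD * C / kmin).
Proof.
move=> a0 CU0 CD0 kmin0 h0 E0 G0 C0 Z0 hE.
pose s := Num.sqrt CU; have s0 : 0 < s by rewrite sqrtr_gt0.
have sE : CU = s ^+ 2 by rewrite sqr_sqrtr// ltW.
pose rho := CD ^+ 4 / (kmin ^+ 2 * a); pose kap := (CD + 1) * CD * C / (kmin * a).
have rho0 : 0 <= rho by rewrite divr_ge0 ?mulr_ge0 ?exprn_ge0 ?ltW.
have kap0 : 0 <= kap.
  have D1 : 0 <= CD + 1 by rewrite addr_ge0 // ltW.
  by apply: divr_ge0; rewrite !mulr_ge0 // ltW.
have kE : a * kap = (CD + 1) * (CD / kmin * C).
  by rewrite /kap; field; rewrite !gt_eqF.
have rE : a * rho = (CD ^+ 2 / kmin) ^+ 2 by rewrite /rho; field; rewrite !gt_eqF.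
have := @quadratic_le _ a E (G / a + CU * h * Z)
  (s * h * (Z + kap / 2) + 4^-1 * (1 + rho) * (CU * h * Z)) _ a0 E0 _ _ _ _.
have hZ0 : 0 <= h * Z by rewrite mulr_ge0 // ltW.
have X0 : 0 <= CU * h * Z by rewrite -mulrA mulr_ge0 // ltW.
have K0 : 0 <= G / a + CU * h * Z by rewrite addr_ge0 ?divr_ge0 // ltW.
set sb := _ + 4^-1 * _ * _.
have r1 : 0 <= 4^-1 * (1 + rho) * (CU * h * Z).
  by rewrite mulr_ge0// mulr_ge0 ?invr_ge0 ?addr_ge0.
have r2 : 0 <= s * h * (Z + kap / 2).
  have sh0 := ltW (mulr_gt0 s0 h0).
  by apply: mulr_ge0 => //; rewrite addr_ge0 // divr_ge0.
have sb0 : 0 <= sb by rewrite addr_ge0.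
have As : a * (CU * h ^+ 2 * Z * Z) + CU * h ^+ 2 * Z * ((CD + 1) * (CD / kmin * C)) +
     4^-1 * (CD ^+ 2 / kmin * (CU * h * Z)) ^+ 2 <= a * sb ^+ 2.
  rewrite -kE exprMn -rE.
  rewrite (_ : _ + _ + _ = a * (CU * h ^+ 2 * Z * Z + CU * h ^+ 2 * Z * kap +
    4^-1 * rho * (CU * h * Z) ^+ 2)); last by ring.
  rewrite (ler_pM2l a0) /sb sqrrD.
  have -> : (s * h * (Z + kap / 2)) ^+ 2 =
      CU * h ^+ 2 * Z * Z + CU * h ^+ 2 * Z * kap + (s * h * (kap / 2)) ^+ 2.
    by rewrite sE; field.
  have h1 : 4^-1 * rho * (CU * h * Z) ^+ 2 <= (4^-1 * (1 + rho) * (CU * h * Z)) ^+ 2.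
    rewrite [leRHS]exprMn ler_wpM2r ?sqr_ge0//; have := sqr_ge0 (1 - rho); rewrite !expr2; nra.
  have h2 := sqr_ge0 (s * h * (kap / 2)); have h3 := mulr_ge0 r2 r1.
  move: h1 h2 h3; lra.
move=> /(_ _ K0 sb0 As) h1.
have {}h1 : E <= G / a + CU * h * Z + sb.
  by apply: h1; apply: le_trans hE _; rewrite lerD2r le_eqVlt; apply/orP; left;
     apply/eqP; field; rewrite gt_eqF.
apply: le_trans h1 _; rewrite -/s -subr_ge0.
rewrite (_ : _ - _ = 3 / 4 * (CU * h * Z) + 3 / 4 * (rho * (CU * h * Z)) +
  2^-1 * (s * h * kap)).
  have r3 := mulr_ge0 rho0 X0; have r4 := mulr_ge0 (ltW (mulr_gt0 s0 h0)) kap0.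
  by move: r3 r4 X0; lra.
by rewrite /sb /rho /kap; field; rewrite !gt_eqF.
Qed.

Lemma L2open_ball (R : realType) (d : nat) (D : set 'rV[R]_d) (u : 'rV[R]_d -> R) (b : R) :
  open D -> L2 D u -> L2open D [set v | L2 D v /\ L2norm D (v \- u) < b].
Proof.
move=> oD lu; split => [v []//|v [lv vb]].
exists (b - L2norm D (v \- u)); first by rewrite subr_gt0.
move=> w lw wv; split => //; have mD := open_rV_measurable oD.
have := L2norm_triangle mD (L2B lw lv) (L2B lv lu).
rewrite (_ : w - v + (v - u) = w \- u); last by rewrite addrA subrK.
by move/le_lt_trans; apply; move: wv; rewrite ltrBrDr.
Qed.

Lemma galerkin_approximation (R : realType) (d : nat) (D : set 'rV[R]_d)
    (Y : set ('rV[R]_d -> R)) (v : 'rV[R]_d -> R) (c e : R) :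
  Y !=set0 -> inf [set H1semi D (v \- w) | w in Y] <= c -> 0 < e ->
  exists2 w, Y w & H1semi D (v - w) <= c + e.
Proof.
move=> [y Yy] vc e0.
have hinf : has_inf [set H1semi D (v \- w) | w in Y].
  split; first by exists (H1semi D (v \- y)); exists y.
  by exists 0 => _ [w _ <-]; exact: H1semi_ge0.
have [_ [w Yw <-] hw] := inf_adherent e0 hinf.
by exists w => //; apply: ltW; apply: lt_le_trans hw _; rewrite lerD2r.
Qed.

(** Each coefficient on the left is at most its counterpart on the right. The gap in the [eps] term,
    12 against 32, is strictly positive because [C > 0], and this alone gives strictness. *)
Lemma error_bound_lt (R : realType) (kmax1 CY CH2 a CU CD kmin kmax h eps C Z : R) :
  0 < a -> 0 < CU -> 0 < CD -> 0 < kmin -> kmin <= kmax -> 0 < h -> 0 < eps -> 0 < C -> 0 <= Z ->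
  (12 * (CD ^+ 2 / kmin * C) * eps +
     2 * (kmax * (CY * h * (CH2 * (kmax / kmin ^+ 4) * kmax1 ^+ 2)) ^+ 2) * C) / a +
    h / a * (Num.sqrt CU * a + 2 * CU * a + CU * CD ^+ 4 / kmin ^+ 2) * Z +
    h / a * (Num.sqrt CU * (CD + 1) * CD * C / kmin) <
  h / a * (8 * CU `^ (1 / 2) * a + 17 * CU * a + 16 * CU * CD ^+ 4 / kmin ^+ 2) * Z
    + 32 / a * eps * (CD ^+ 2 * C / kmin)
    + 4 / a * h * (CU `^ (1 / 2) * (CD + 1) * CD * C / kmin)
    + 32 / a * h ^+ 2 * CY ^+ 2 * CH2 ^+ 2 *
        (kmax `^ (7 / 2) / kmin `^ (17 / 2)) * kmax1 ^+ 4 * C.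
Proof.
move=> a0 CU0 CD0 kmin0 kk h0 eps0 C0 Z0.
have pr := powR_half_ratio kmin0 kk; have kmax0 := lt_le_trans kmin0 kk.
rewrite mul1r powR12_sqrt ?(ltW CU0)//.
set s := Num.sqrt CU; have s0 : 0 < s by rewrite sqrtr_gt0.
set p := _ / kmin `^ _ in pr *.
have p0 : 0 <= p - kmax ^+ 3 / kmin ^+ 8 by rewrite subr_ge0.
have r0 : 0 <= kmax ^+ 3 / kmin ^+ 8 by rewrite divr_ge0 ?exprn_ge0 // ltW.
have i0 : 0 < a^-1 by rewrite invr_gt0.
have ha0 : 0 < h / a by rewrite divr_gt0.
have e1 : 0 <= h / a * (7 * s * a + 15 * CU * a + 15 * CU * CD ^+ 4 / kmin ^+ 2) * Z.
  apply: mulr_ge0 => //; apply: mulr_ge0; first exact: ltW.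
  by rewrite ltW // !addr_gt0 // ?divr_gt0 ?exprn_gt0 ?mulr_gt0 ?exprn_gt0.
have e2 : 0 < 20 / a * eps * (CD ^+ 2 * C / kmin).
  by rewrite mulr_gt0 // ?divr_gt0 ?mulr_gt0 ?exprn_gt0 // divr_gt0.
have e3 : 0 <= 3 * (h / a) * (s * (CD + 1) * CD * C / kmin).
  by rewrite ltW // mulr_gt0 // ?divr_gt0 ?mulr_gt0 // addr_gt0.
have e4 : 0 <= a^-1 * h ^+ 2 * CY ^+ 2 * CH2 ^+ 2 * kmax1 ^+ 4 * C *
    (32 * (p - kmax ^+ 3 / kmin ^+ 8) + 30 * (kmax ^+ 3 / kmin ^+ 8)).
  apply: mulr_ge0; last by rewrite addr_ge0 // mulr_ge0.
  rewrite [leRHS](_ : _ = a^-1 * (h * CY * CH2 * kmax1 ^+ 2) ^+ 2 * C); last by ring.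
  by rewrite mulr_ge0 ?(ltW C0) // mulr_ge0 ?(ltW i0) // sqr_ge0.
rewrite -subr_gt0.
rewrite [X in 0 < X](_ : _ = h / a * (7 * s * a + 15 * CU * a + 15 * CU * CD ^+ 4 / kmin ^+ 2) * Z +
  20 / a * eps * (CD ^+ 2 * C / kmin) + 3 * (h / a) * (s * (CD + 1) * CD * C / kmin) +
  a^-1 * h ^+ 2 * CY ^+ 2 * CH2 ^+ 2 * kmax1 ^+ 4 * C *
    (32 * (p - kmax ^+ 3 / kmin ^+ 8) + 30 * (kmax ^+ 3 / kmin ^+ 8))).
  by apply: ltr_pwDl => //; rewrite ltr_wpDr // ltr_wpDl.
by field; rewrite !gt_eqF.
Qed.

Theorem theorem4p1
  (R : realType) (d : nat) (d_range : (1 <= d <= 3)%N)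
  (D : set 'rV[R]_d) (D_domain : convex_polyhedral_domain D)
  (Xi : completeMetricType R) (Xi_separable : separable Xi)
  (dO0 : measure_display) (Omega0 : measurableType dO0)
  (P0 : probability Omega0 R) (xi : {RV P0 >-> borel Xi})
  (dO : measure_display) (Omega : measurableType dO)
  (P : probability Omega R) (P_complete : measure_is_complete P)
  (xis : nat -> {RV P >-> borel Xi})
  (xis_iid : iid_copies P P0 (fun i => xis i : Omega -> borel Xi) xi)
  (yd : 'rV[R]_d -> R) (yd_L2 : L2 D yd)
  (* for yd = 0 both sides of the strict estimate vanish *)
  (yd_neq0 : ~ ae_in D (fun x => yd x = 0))
  (alpha gamma l r : R)
  (alpha_gt0 : 0 < alpha) (gamma_ge0 : 0 <= gamma) (l_le0 : l <= 0) (r_ge0 : 0 <= r)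
  (kappa : borel Xi -> 'rV[R]_d -> R)
  (kappa_measurable : C1strongly_measurable D kappa)
  (kmin kmax kmax1 : R)
  (kmin_gt0 : 0 < kmin) (kmax_gt0 : 0 < kmax) (kmax1_gt0 : 0 < kmax1)
  (kappa_bounds : forall (z : borel Xi) (x : 'rV[R]_d), closure D x -> kmin <= kappa z x <= kmax)
  (kappa_C1 : forall z, C1norm D (kappa z) <= kmax1)
  (CD : R) (CD_friedrichs : friedrichs D = CD%:E)
  (S : ('rV[R]_d -> R) -> borel Xi -> 'rV[R]_d -> R)
  (S_solution : forall u z, L2 D u ->
     is_galerkin_solution D (H10 D) (kappa z) u (S u z))
  (CH2 : R) (CH2_gt0 : 0 < CH2)
  (S_H2 : forall u z, L2 D u -> H2 D (S u z) /\
     H2norm D (S u z) <= CH2 * (kmax / kmin ^+ 4) * kmax1 ^+ 2 * L2norm D u)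
  (Y : R -> set ('rV[R]_d -> R))
  (Y_subspace : forall h : R, 0 < h < 1 -> finite_dim_subspace D (H10 D) (Y h))
  (CY : R) (CY_gt0 : 0 < CY)
  (Y_approx : forall h : R, 0 < h < 1 -> forall v, H10 D v -> H2 D v ->
     inf [set H1semi D (v \- w) | w in Y h] <= CY * h * H2norm D v)
  (n : R -> nat) (phi : forall h, 'I_(n h) -> 'rV[R]_d -> R)
  (phi_Linfty : forall h : R, 0 < h < 1 -> forall j, Lp D +oo%E (phi h j))
  (phi_ge0 : forall h : R, 0 < h < 1 -> forall j, ae_in D (fun x => 0 <= phi h j x))
  (phi_norm : forall h : R, 0 < h < 1 -> forall j, Lpnorm D +oo%E (phi h j) = 1)
  (phi_sum1 : forall h : R, 0 < h < 1 -> ae_in D (fun x => \sum_(j < n h) phi h j x = 1))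
  (CU : R) (CU_gt0 : 0 < CU)
  (interp_L2 : forall h : R, 0 < h < 1 -> forall u, H1 D u ->
     L2norm D (u \- quasi_interp D (phi h) u) <= CU * h * H1semi D u)
  (interp_H1dual : forall h : R, 0 < h < 1 -> forall u, H1 D u ->
     (H1dual_norm D (u \- quasi_interp D (phi h) u)%R
        <= (CU * h ^+ 2 * H1norm D u)%:E)%E)
  (us : 'rV[R]_d -> R)
  (us_minimizer :
     is_minimizer (Uad D l r) (rn_objective D yd alpha gamma S P0 xi) us)
  (us_H1 : H1 D us)
  (eps delta h : R)
  (eps_gt0 : 0 < eps) (delta_range : 0 < delta < 1) (h_range : 0 < h < 1)
  (N : nat) (N_large : 2 * ln (2 / delta) / eps ^+ 2 <= N%:R)
  (Sh : ('rV[R]_d -> R) -> borel Xi -> 'rV[R]_d -> R)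
  (Sh_solution : forall u z, L2 D u ->
     is_galerkin_solution D (Y h) (kappa z) u (Sh u z))
  (uhN : Omega -> 'rV[R]_d -> R)
  (uhN_random : L2random D uhN)
  (uhN_minimizer : forall w,
     is_minimizer (Uad D l r `&` L2span D (phi h))
       (saa_objective D yd alpha gamma Sh N (fun i => xis i w)) (uhN w)) :
  let Cstar := CD ^+ 2 / kmin * L2norm D us + L2norm D yd in
  let bound :=
    h / alpha * (8 * CU `^ (1 / 2) * alpha + 17 * CU * alpha +
                 16 * CU * CD ^+ 4 / kmin ^+ 2) * H1norm D us
    + 32 / alpha * eps * (CD ^+ 2 * Cstar / kmin)
    + 4 / alpha * h * (CU `^ (1 / 2) * (CD + 1) * CD * Cstar / kmin)
    + 32 / alpha * h ^+ 2 * CY ^+ 2 * CH2 ^+ 2 *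
        (kmax `^ (7 / 2) / kmin `^ (17 / 2)) * kmax1 ^+ 4 * Cstar in
  ((1 - delta)%:E <= P [set w | (L2norm D (uhN w \- us) < bound)%R])%E.
Proof.
cbv zeta; set Cstar := _ * _ + L2norm D yd.
set bound := (X in [set w | _ < X]).
have [oD D0 bD _ _] := D_domain.
have mD := open_rV_measurable oD.
have CD0 := friedrichs_gt0 oD CD_friedrichs.
have lus := us_H1.1.
have yd0 : 0 < L2norm D yd.
  rewrite lt_neqAle L2norm_ge0 andbT eq_sym; apply/eqP => /(L2norm_eq0 mD yd_L2).
  exact: yd_neq0.
have us0 := L2norm_ge0 D us.
have k0 : 0 < CD ^+ 2 / kmin by rewrite divr_gt0 ?exprn_gt0.
have Cstar0 : 0 < Cstar by rewrite ltr_wpDl // mulr_ge0 // ltW.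
have kk : kmin <= kmax.
  (* The bounds on [kappa] are comparable once evaluated somewhere, which the nonemptiness of [D]
     permits. *)
  have [x Dx] := D0; have /andP[a b] := kappa_bounds point _ (subset_closure Dx).
  exact: le_trans a b.
have wk z : weight D kmin kmax (kappa z).
  by apply: (kappa_weight oD) => [|x]; [case: kappa_measurable|exact: kappa_bounds].
have HS z : galerkin_operator D (H10 D) (kappa z) (S ^~ z) by move=> u; exact: S_solution.
have HSh z : galerkin_operator D (Y h) (kappa z) (Sh ^~ z) by move=> u; exact: Sh_solution.
have YH := subspace_H10 oD bD (Y_subspace h h_range).
have h0 : 0 < h by case/andP: h_range.
have N0 : (0 < N)%N.
  rewrite -(ltr0n R); apply: lt_le_trans N_large.
  rewrite divr_gt0 ?exprn_gt0 // mulr_gt0 // ln_gt0 //.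
  by case/andP: delta_range => d0 d1; rewrite ltr_pdivlMr //; lra.
pose tau := CD ^+ 2 / kmin * Cstar.
have tau0 : 0 < tau by rewrite mulr_gt0.
(* The H^2 bound inserted in the approximation property of [Y h]: the best approximation error of
   [S u z] per unit of [L2norm D u]. Duality squares it in [q]. *)
pose c := CY * h * (CH2 * (kmax / kmin ^+ 4) * kmax1 ^+ 2).
pose q := kmax * c ^+ 2.
have q0 : 0 <= q by rewrite mulr_ge0 ?sqr_ge0 // ltW.
have hq z u : L2 D u -> L2norm D (S u z - Sh u z) <= q * L2norm D u.
  apply: (galerkin_error oD bD kmin_gt0 kmax_gt0 YH (wk z) (HS z) (HSh z)) => v lv e e0.
  have [vH2 vle] := S_H2 v z lv.
  apply: galerkin_approximation => //; first by exists (Sh v z); case: (HSh z v lv).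
  apply: le_trans (Y_approx h h_range _ (HS z v lv).1 vH2) _.
  by rewrite /c -[leRHS]mulrA ler_wpM2l // ltW // mulr_gt0.
have mphi j : measurable_fun D (phi h j) := Lp_measurable mD (phi_Linfty h h_range j).
have lr : (l <= 0) && (0 <= r) by rewrite l_le0.
have Z0 := H1norm_ge0 D us.
have c1le : L2norm D (us \- quasi_interp D (phi h) us) <= CU * h * H1norm D us.
  apply: le_trans (interp_L2 h h_range us us_H1) _.
  by rewrite ler_wpM2l ?H1semi_le_H1norm // ltW // mulr_gt0.
have [W [mW PW hW]] := @monte_carlo_event _ _ _ mD _ _ _ _ _ _ _ _ _ _ xis_iid
  (adjoint S yd us) (fun z => adjoint_L2 HS yd_L2 z lus) tau tau0
  (fun z => adjoint_le oD CD_friedrichs kmin_gt0 wk HS yd_L2 z lus)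
  (fun v lv => adjoint_dot_measurable oD bD CD_friedrichs kmin_gt0 kappa_measurable wk HS
    yd_L2 lus lv)
  (adjoint_partition oD bD CD_friedrichs kmin_gt0 kappa_measurable wk HS yd_L2 lus)
  N eps delta eps_gt0 delta_range N_large.
have [luhN uhN_meas] := uhN_random.
(* The event is the preimage of an open ball of L^2(D) under [uhN]; its measurability is needed to
   compare its probability with that of [W] by monotonicity. *)
have mB : measurable [set w | L2norm D (uhN w \- us) < bound].
  rewrite (_ : [set w | _] = uhN @^-1` [set v | L2 D v /\ L2norm D (v \- us) < bound]).
    exact/uhN_meas/L2open_ball.
  by apply/seteqP; split => w //= [].
apply: le_trans PW _; apply: le_measure; rewrite ?inE //.
move=> w Ww /=.
have E0 := L2norm_ge0 D (uhN w - us).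
have c2 : 0 <= CU * h ^+ 2 * H1norm D us.
  by rewrite mulr_ge0 // mulr_ge0 ?sqr_ge0 // ltW.
have := saa_error_quadratic oD bD CD_friedrichs kmin_gt0 kappa_measurable wk HS YH HSh
  q0 hq yd_L2 gamma_ge0 lr mphi (phi_ge0 h h_range) (phi_sum1 h h_range) us_H1 us_minimizer
  c2 c1le (interp_H1dual h h_range us us_H1) N0 (uhN_minimizer w) (hW w Ww) alpha_gt0.
rewrite -/Cstar => /(error_bound alpha_gt0 CU_gt0 CD0 kmin_gt0 h0 E0) hb.
have G0 : 0 <= 12 * tau * eps + 2 * q * Cstar.
  rewrite addr_ge0 // mulr_ge0 ?(ltW Cstar0) ?(ltW eps_gt0) //.
    by rewrite mulr_ge0 // ltW.
  by rewrite mulr_ge0.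
apply: le_lt_trans (hb G0 (ltW Cstar0) Z0) _.
exact: (error_bound_lt kmax1 CY CH2 alpha_gt0 CU_gt0 CD0 kmin_gt0 kk h0 eps_gt0 Cstar0 Z0).
Qed.
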